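(* Let $\mathbb{V}^{m\times n}$ ($m\le n$) be the space of $m\times n$ real (or complex) matrices, let $\mathcal{N}\subseteq\mathbb{V}^{m\times n}$ be a nonempty open set, let $g:\mathbb{R}^m\to\mathbb{R}^m$ be absolutely symmetric on an open set $\hat{\sigma}_{\mathcal N}\subseteq\mathbb{R}^m$ containing $\sigma_{\mathcal N}=\{\sigma(X)\mid X\in\mathcal{N}\}$, and let $G:\mathcal{N}\to\mathbb{V}^{m\times n}$ be the spectral operator with respect to $g$. Let $\overline{X}\in\mathcal{N}$ have the singular value decomposition $\overline{X}=\overline{U}\,[\Sigma(\overline{X})\ \ 0]\,\overline{V}^{\mathsf T}$, and assume that $g$ is locally Lipschitz continuous near $\overline{\sigma}=\sigma(\overline{X})$. Let $0<\rho\le 1$ be given. Then $G$ is $\rho$-order G-semismooth at $\overline{X}$ if and only if $g$ is $\rho$-order G-semismooth at $\overline{\sigma}$.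
   Context: $\mathbb{V}^{m\times n}$ is regarded as a real Euclidean vector space with the Frobenius norm $\|\cdot\|$ (inner product $\mathrm{Re}\,\mathrm{tr}(X^{\mathsf T}Y)$, where $^{\mathsf T}$ means transpose in the real case and conjugate transpose in the complex case); differentiability is over $\mathbb{R}$. For $X\in\mathbb{V}^{m\times n}$, $\sigma(X)=(\sigma_1(X),\ldots,\sigma_m(X))\in\mathbb{R}^m$ is the vector of singular values with $\sigma_1(X)\ge\cdots\ge\sigma_m(X)\ge 0$, $\Sigma(X)=\mathrm{Diag}(\sigma(X))$ is the $m\times m$ diagonal matrix with these entries, and $\mathbb{O}^{m,n}(X)$ is the set of all pairs $(U,V)$ of $m\times m$ and $n\times n$ orthogonal (unitary in the complex case) matrices with $X=U[\Sigma(X)\ \ 0]V^{\mathsf T}$; in the singular value decomposition of $\overline X$, $(\overline U,\overline V)\in\mathbb{O}^{m,n}(\overline X)$. Let $\pm\mathbb{P}^m$ be the set of $m\times m$ signed permutation matrices (exactly one nonzero entry, equal to $\pm1$, in each row and each column). The mapping $g:\mathbb{R}^m\to\mathbb{R}^m$ is absolutely symmetric (mixed symmetric with respect to $\pm\mathbb{P}^m$) on a set $\mathcal{D}\subseteq\mathbb{R}^m$ if $g(Qx)=Qg(x)$ for all $Q\in\pm\mathbb{P}^m$ and all $x\in\mathcal{D}$. The spectral operator $G:\mathcal{N}\to\mathbb{V}^{m\times n}$ with respect to $g$ is defined by $G(X)=U[\mathrm{Diag}(g(\sigma(X)))\ \ 0]V^{\mathsf T}$, $X\in\mathcal{N}$,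 where $(U,V)\in\mathbb{O}^{m,n}(X)$; by the absolute symmetry of $g$ this does not depend on the choice of $(U,V)$. When $g$ is locally Lipschitz continuous near $\sigma(\overline X)$, $G$ is locally Lipschitz continuous near $\overline X$, so the notion below applies to $G$ at $\overline X$. A map is locally Lipschitz continuous near a point if it is Lipschitz continuous on some open neighborhood of that point. Let $\mathcal{Z},\mathcal{Z}'$ be finite dimensional real Euclidean spaces, $\mathcal{O}\subseteq\mathcal{Z}$ open, and $F:\mathcal{O}\to\mathcal{Z}'$ locally Lipschitz continuous on $\mathcal{O}$ (for a map locally Lipschitz near a point, take $\mathcal{O}$ to be a suitable open neighborhood of that point). Let $\mathcal{D}_F\subseteq\mathcal{O}$ be the set of points where $F$ is Fréchet differentiable. The B-subdifferential of $F$ at $z\in\mathcal{O}$ is $\partial_BF(z)=\{\lim_{k\to\infty}F'(z^k)\mid z^k\in\mathcal{D}_F,\ z^k\to z\}$ (all existing limits), and the Clarke generalized Jacobian is $\partial F(z)=\mathrm{conv}\,\partial_BF(z)$. For $\rho>0$, $F$ is $\rho$-order G-semismooth at $z\in\mathcal{O}$ if for any $y\to z$ and $V\in\partial F(y)$, $F(y)-F(z)-V(y-z)=O(\|y-z\|^{1+\rho})$. *)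

(* Defs.v *)
From HB Require Import structures.
From mathcomp Require Import all_boot all_order all_algebra.
From mathcomp Require Import complex.
From mathcomp Require Import all_classical all_reals all_analysis.
From mathcomp Require Import ring lra.

Set Implicit Arguments.
Unset Strict Implicit.
Unset Printing Implicit Defensive.

Import Order.TTheory GRing.Theory Num.Theory.
Import numFieldNormedType.Exports.

Local Open Scope classical_set_scope.
Local Open Scope ring_scope.
Local Open Scope complex_scope.

Section InnerProductNorm.
Context {R : realType} {E : lmodType R}.
Variable ip : E -> E -> R.
Hypothesis ipC : forall x y, ip x y = ip y x.
Hypothesis ipD : forall x y z, ip (x + y) z = ip x z + ip y z.
Hypothesis ipZ : forall a x y, ip (a *: x) y = a * ip x y.
Hypothesis ip_ge0 : forall x, 0 <= ip x x.
Hypothesis ip_eq0 : forall x, ip x x = 0 -> x = 0.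

Definition ip_norm (x : E) : R := Num.sqrt (ip x x).

Lemma ip_cauchy_schwarz x y : ip x y ^+ 2 <= ip x x * ip y y.
Proof.
have [y0|y0] := ltrP 0 (ip y y); last first.
  have -> : y = 0 by apply: ip_eq0; apply/eqP; rewrite eq_le y0 ip_ge0.
  have ip0 z : ip 0 z = 0 by rewrite -(scale0r (0 : E)) ipZ mul0r.
  by rewrite ipC !ip0 expr0n mulr0.
have := ip_ge0 (ip y y *: x + (- ip x y) *: y).
have -> : ip (ip y y *: x + (- ip x y) *: y) (ip y y *: x + (- ip x y) *: y)
    = ip y y * (ip x x * ip y y - ip x y ^+ 2).
  rewrite ipD !ipZ ![ip _ (_ + _)]ipC !ipD !ipZ (ipC y x); ring.
by rewrite pmulr_rge0// subr_ge0.
Qed.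

Lemma ip_normD x y : ip_norm (x + y) <= ip_norm x + ip_norm y.
Proof.
have s0 : 0 <= ip_norm x + ip_norm y by rewrite addr_ge0// sqrtr_ge0.
rewrite -[leRHS]ger0_norm// -sqrtr_sqr ler_wsqrtr//.
have -> : ip (x + y) (x + y) = ip x x + ip y y + ip x y *+ 2.
  rewrite ipD ![ip _ (_ + _)]ipC !ipD (ipC y x); ring.
rewrite sqrrD !sqr_sqrtr// [leRHS]addrAC lerD2l lerMn2r /=.
apply: le_trans (ler_norm _) _.
by rewrite -sqrtrM// -sqrtr_sqr ler_wsqrtr// ip_cauchy_schwarz.
Qed.

Lemma ip_normZ a x : ip_norm (a *: x) = `|a| * ip_norm x.
Proof.
rewrite /ip_norm ipZ ipC ipZ mulrA -expr2 sqrtrM ?sqr_ge0//.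
by rewrite sqrtr_sqr.
Qed.

Lemma ip_norm0_eq0 (x : E) : ip_norm x = 0 -> x = 0.
Proof.
move=> /eqP; rewrite sqrtr_eq0 => x0; apply: ip_eq0.
by apply/eqP; rewrite eq_le x0 ip_ge0.
Qed.

End InnerProductNorm.

(* R^m with the Euclidean norm. An alias of 'cV[R]_m is needed because the     *)
(* library equips matrices with the maximum norm.                             *)
Definition rvec (R : realType) (m : nat) := 'cV[R]_m.

Section Rvec.
Context {R : realType} {m : nat}.

HB.instance Definition _ := GRing.Lmodule.copy (rvec R m) 'cV[R]_m.

Definition rvec_dot (x y : rvec R m) : R := \sum_i x i 0 * y i 0.

Lemma rvec_dotC x y : rvec_dot x y = rvec_dot y x.
Proof. by apply: eq_bigr => i _; rewrite mulrC. Qed.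

Lemma rvec_dotD x y z : rvec_dot (x + y) z = rvec_dot x z + rvec_dot y z.
Proof. by rewrite -big_split; apply: eq_bigr => i _; rewrite mxE mulrDl. Qed.

Lemma rvec_dotZ a x y : rvec_dot (a *: x) y = a * rvec_dot x y.
Proof. by rewrite mulr_sumr; apply: eq_bigr => i _; rewrite mxE mulrA. Qed.

Lemma rvec_dot_ge0 x : 0 <= rvec_dot x x.
Proof. by apply: sumr_ge0 => i _; rewrite -expr2 sqr_ge0. Qed.

Lemma rvec_dot_eq0 x : rvec_dot x x = 0 -> x = 0.
Proof.
move=> /eqP; rewrite psumr_eq0 => [/allP x0|i _]; last by rewrite -expr2 sqr_ge0.
apply/matrixP => i j; rewrite ord1 mxE.
by have := x0 i (mem_index_enum _); rewrite mulf_eq0 orbb => /eqP.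
Qed.

Let rvec_normD x y : ip_norm rvec_dot (x + y) <= ip_norm rvec_dot x + ip_norm rvec_dot y.
Proof.
exact: (ip_normD rvec_dotC rvec_dotD rvec_dotZ rvec_dot_ge0 rvec_dot_eq0).
Qed.

Let rvec_normZ (a : R) x : ip_norm rvec_dot (a *: x) = `|a| * ip_norm rvec_dot x.
Proof.
exact: (ip_normZ rvec_dotC rvec_dotZ).
Qed.

Let rvec_norm_eq0 x : ip_norm rvec_dot x = 0 -> x = 0.
Proof. exact: (ip_norm0_eq0 rvec_dot_ge0 rvec_dot_eq0). Qed.

HB.instance Definition _ := @Lmodule_isNormed.Build R (rvec R m)
  (ip_norm rvec_dot) rvec_normD rvec_normZ rvec_norm_eq0.

End Rvec.

Variant scalar_kind := RealScalars | ComplexScalars.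

Definition scalars (R : realType) (k : scalar_kind) : numFieldType :=
  match k with RealScalars => R | ComplexScalars => R[i] end.

Section Scalars.
Context {R : realType}.

Definition of_real {k : scalar_kind} : R -> scalars R k :=
  match k with RealScalars => id | ComplexScalars => fun x => x%:C end.

Definition re {k : scalar_kind} : scalars R k -> R :=
  match k with RealScalars => id | ComplexScalars => fun z => complex.Re z end.

Definition conj {k : scalar_kind} : scalars R k -> scalars R k :=
  match k with RealScalars => id | ComplexScalars => fun z => z^* end.

(* The transpose in the real case, the conjugate transpose in the complex one. *)
Definition ctr {k : scalar_kind} {p q : nat} (X : 'M[scalars R k]_(p, q)) :
  'M[scalars R k]_(q, p) := map_mx conj X^T.

Context {k : scalar_kind}.
Implicit Types (a b : R) (x y : scalars R k).

Lemma of_real1 : of_real 1 = 1 :> scalars R k. Proof. by case: k. Qed.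

Lemma of_realD a b : of_real (a + b) = of_real a + of_real b :> scalars R k.
Proof. by case: k => //=; rewrite rmorphD. Qed.

Lemma of_realM a b : of_real (a * b) = of_real a * of_real b :> scalars R k.
Proof. by case: k => //=; rewrite rmorphM. Qed.

Lemma re_sum (I : finType) (f : I -> scalars R k) :
  re (\sum_i f i) = \sum_i re (f i).
Proof. by apply: (big_morph re); case: k => // -[? ?] [? ?]. Qed.

Lemma reD x y : re (x + y) = re x + re y.
Proof. by case: k x y => // -[? ?] [? ?]. Qed.

Lemma re_conjC x y : re (conj x * y) = re (conj y * x).
Proof.
case: k x y => [x y|[a b] [c d]] /=; first by rewrite mulrC.
by rewrite !mulNr !opprK mulrC (mulrC b).
Qed.

Lemma re_conjD x y z : re (conj (x + y) * z) = re (conj x * z) + re (conj y * z).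
Proof. by case: k x y z => [x y z|[? ?] [? ?] [? ?]] /=; ring. Qed.

Lemma re_conjZ a x y : re (conj (of_real a * x) * y) = a * re (conj x * y).
Proof. by case: k x y => [x y|[? ?] [? ?]] /=; ring. Qed.

Lemma re_conj_ge0 x : 0 <= re (conj x * x).
Proof. by case: k x => [x|[? ?]] /=; nra. Qed.

Lemma re_conj_eq0 x : re (conj x * x) = 0 -> x = 0.
Proof.
case: k x => [x /eqP|[a b]] /=; first by rewrite mulf_eq0 orbb => /eqP.
by move=> h; congr (_ +i* _); nra.
Qed.

End Scalars.

(* The space of m x n matrices as a Euclidean space over R, also when the      *)
(* entries are complex.                                                       *)
Definition mat (R : realType) (k : scalar_kind) (m n : nat) :=
  'M[scalars R k]_(m, n).

Section Mat.
Context {R : realType} {k : scalar_kind} {m n : nat}.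
Implicit Types (a b : R) (X Y Z : mat R k m n).

HB.instance Definition _ :=
  GRing.Zmodule.copy (mat R k m n) 'M[scalars R k]_(m, n).

Definition mat_scale a X : mat R k m n :=
  @GRing.scale (scalars R k) 'M[scalars R k]_(m, n) (of_real a) X.

Lemma mat_scaleA a b X : mat_scale a (mat_scale b X) = mat_scale (a * b) X.
Proof. by rewrite /mat_scale of_realM scalerA. Qed.

Lemma mat_scale1 : left_id 1 mat_scale.
Proof. by move=> X; rewrite /mat_scale of_real1 scale1r. Qed.

Lemma mat_scaleDr : right_distributive mat_scale +%R.
Proof. by move=> a X Y; rewrite /mat_scale -scalerDr. Qed.

Lemma mat_scaleDl X : {morph mat_scale^~ X : a b / a + b}.
Proof. by move=> a b; rewrite /mat_scale of_realD scalerDl. Qed.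

HB.instance Definition _ := GRing.Zmodule_isLmodule.Build R (mat R k m n)
  mat_scaleA mat_scale1 mat_scaleDr mat_scaleDl.

Definition mat_dot X Y : R := re (\tr (ctr X *m Y)).

Lemma mat_dotE X Y : mat_dot X Y = \sum_j \sum_i re (conj (X i j) * Y i j).
Proof.
rewrite /mat_dot re_sum; apply: eq_bigr => j _; rewrite mxE re_sum.
by apply: eq_bigr => i _; rewrite !mxE.
Qed.

Lemma mat_dotC X Y : mat_dot X Y = mat_dot Y X.
Proof.
by rewrite !mat_dotE; do 2!apply: eq_bigr => ? _; rewrite re_conjC.
Qed.

Lemma mat_dotD X Y Z : mat_dot (X + Y) Z = mat_dot X Z + mat_dot Y Z.
Proof.
rewrite !mat_dotE -big_split; apply: eq_bigr => j _; rewrite -big_split.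
by apply: eq_bigr => i _; rewrite mxE re_conjD.
Qed.

Lemma mat_dotZ a X Y : mat_dot (a *: X) Y = a * mat_dot X Y.
Proof.
rewrite !mat_dotE mulr_sumr; apply: eq_bigr => j _; rewrite mulr_sumr.
by apply: eq_bigr => i _; rewrite mxE re_conjZ.
Qed.

Lemma mat_dot_ge0 X : 0 <= mat_dot X X.
Proof. by rewrite mat_dotE; do 2!apply: sumr_ge0 => ? _; exact: re_conj_ge0. Qed.

Lemma mat_dot_eq0 X : mat_dot X X = 0 -> X = 0.
Proof.
rewrite mat_dotE => /eqP; rewrite psumr_eq0 => [/allP X0|j _]; last first.
  by apply: sumr_ge0 => i _; exact: re_conj_ge0.
apply/matrixP => i j; rewrite mxE; apply: re_conj_eq0.
have := X0 j (mem_index_enum _); rewrite psumr_eq0 => [/allP Xj0|? _].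
  by apply/eqP/(Xj0 i (mem_index_enum _)).
exact: re_conj_ge0.
Qed.

Let mat_normD x y : ip_norm mat_dot (x + y) <= ip_norm mat_dot x + ip_norm mat_dot y.
Proof.
exact: (ip_normD mat_dotC mat_dotD mat_dotZ mat_dot_ge0 mat_dot_eq0).
Qed.

Let mat_normZ (a : R) x : ip_norm mat_dot (a *: x) = `|a| * ip_norm mat_dot x.
Proof.
exact: (ip_normZ mat_dotC mat_dotZ).
Qed.

Let mat_norm_eq0 x : ip_norm mat_dot x = 0 -> x = 0.
Proof. exact: (ip_norm0_eq0 mat_dot_ge0 mat_dot_eq0). Qed.

(* The Frobenius norm. *)
HB.instance Definition _ := @Lmodule_isNormed.Build R (mat R k m n)
  (ip_norm mat_dot) mat_normD mat_normZ mat_norm_eq0.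

End Mat.

Section SpectralOperators.
Context {R : realType} {k : scalar_kind} {m n : nat}.

Definition orthogonal_mx {p : nat} (U : 'M[scalars R k]_p) : Prop :=
  ctr U *m U = 1%:M.

(* The nonnegative square roots of the eigenvalues of X X^T, counted with      *)
(* multiplicity, in nonincreasing order.                                      *)
Definition is_singular_values (X : mat R k m n) (s : rvec R m) : Prop :=
  [/\ forall i j : 'I_m, (i <= j)%N -> s j 0 <= s i 0,
      forall i, 0 <= s i 0 &
      char_poly (X *m ctr X) = \prod_i ('X - (of_real (s i 0 ^+ 2))%:P)].

Definition sigma (X : mat R k m n) : rvec R m :=
  xget 0 [set s | is_singular_values X s].

(* The m x n matrix [Diag(s) 0]. *)
Definition diag0 (s : rvec R m) : mat R k m n :=
  \matrix_(i, j) if i == j :> nat then of_real (s i 0) else 0.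

Definition svd_pair (X : mat R k m n)
    (U : 'M[scalars R k]_m) (V : 'M[scalars R k]_n) : Prop :=
  [/\ orthogonal_mx U, orthogonal_mx V & X = U *m diag0 (sigma X) *m ctr V].

Definition signed_perm_mx (Q : 'M[R]_m) : Prop :=
  [/\ forall i j, [\/ Q i j = 0, Q i j = 1 | Q i j = -1],
      forall i, exists! j, Q i j != 0 &
      forall j, exists! i, Q i j != 0].

Definition absolutely_symmetric (g : rvec R m -> rvec R m) (D : set (rvec R m)) :=
  forall Q x, signed_perm_mx Q -> D x -> g (Q *m x) = Q *m g x.

(* "Some" rather than "every" pair (U, V): for an absolutely symmetric g the   *)
(* value does not depend on the pair.                                         *)
Definition spectral_operator (g : rvec R m -> rvec R m) (N : set (mat R k m n))
    (G : mat R k m n -> mat R k m n) : Prop :=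
  forall X, N X -> exists U V, svd_pair X U V /\
    G X = U *m diag0 (g (sigma X)) *m ctr V.

End SpectralOperators.

Definition convex_hull {R : realType} {E : lmodType R} (A : set E) : set E :=
  [set x | exists p (w : 'I_p -> R) (a : 'I_p -> E),
    [/\ forall i, 0 <= w i, \sum_i w i = 1, forall i, A (a i) &
        x = \sum_i w i *: a i]].

Section GSemismooth.
Context {R : realType} {Z Z' : normedModType R}.
Implicit Types (O : set Z) (F : Z -> Z') (z : Z) (L : Z -> Z').

Definition locally_lipschitz_near F z : Prop :=
  exists U, [/\ open U, U z & [lipschitz F x | x in U]].

(* Convergence in operator norm; the limit L is then linear as well. *)
Definition op_cvg (Lk : nat -> Z -> Z') L : Prop :=
  forall e : R, 0 < e ->
    \forall j \near \oo, forall h, `|Lk j h - L h| <= e * `|h|.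

Definition B_subdifferential O F z : set (Z -> Z') :=
  [set L | exists zk : nat -> Z,
    [/\ forall j, O (zk j) /\ differentiable F (zk j),
        zk @ \oo --> z &
        op_cvg (fun j => 'd F (zk j)) L]].

Definition clarke_jacobian O F z : set (Z -> Z') :=
  convex_hull (B_subdifferential O F z).

(* A map into Z' defined on the open set O is represented by a total F whose   *)
(* values outside O are irrelevant. Local Lipschitz continuity, a standing     *)
(* assumption in the definition of the notion, is part of it.                 *)
Definition G_semismooth_on O F z (rho : R) : Prop :=
  [/\ open O, O z, forall y, O y -> locally_lipschitz_near F y &
      exists C : R, \forall y \near z, forall L, clarke_jacobian O F y L ->
        `|F y - F z - L (y - z)| <= C * `|y - z| `^ (1 + rho)].

Definition G_semismooth F z (rho : R) : Prop :=
  exists O, G_semismooth_on O F z rho.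

End GSemismooth.

(* Main.v *)
(* Since the estimate defining G-semismoothness passes to limits and to convex
   combinations, it only has to be checked at points of differentiability.

   If X = U [Sigma 0] V^T and Y = U' [Sigma' 0] V'^T, the entries of P = U^T U' and
   Q = V^T V' satisfy |P + Q|_ij |s'_j - s_i| <= 2 |Y - X| and
   |P - Q|_ij |s'_j + s_i| <= 2 |Y - X|. This gives the Lipschitz continuity of the singular
   values, and with the symmetry of g that of G and its independence of the decomposition.

   From g to G: when X is close to Xbar, the same inequalities make P and Q, up to
   O(|X - Xbar|^2), the product of a map which is close to the identity and of a
   block-diagonal one that commutes with Sigma(Xbar) and with g(sigma(Xbar)). Hence X - Xbar is
   a diagonal increment plus a tangent vector A X - X B of the orbit of X (A, B skew), up
   to O(|X - Xbar|^2), and G X - G Xbar has the same form. Equivariance gives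
   G'(X)(A X - X B) = A G(X) - G(X) B, and on the diagonal increments G'(X) is g'(sigma(X)),
   so what is left is the semismoothness estimate of g.

   From G to g: restrict G to the matrices Ubar [Diag(s) 0] Vbar^T. This requires that G
   be differentiable where g is. By Hermite interpolation a polynomial spectral operator
   has the same 1-jet as g at s; the difference has a vanishing 1-jet, and is
   differentiable because sigma is Lipschitz continuous. *)
From HB Require Import structures.
Require Import Defs.
From mathcomp Require Import all_boot all_order all_algebra.
From mathcomp Require Import perm complex.
From mathcomp Require Import all_classical all_reals all_analysis.
From mathcomp Require Import ring lra.

Set Implicit Arguments.
Unset Strict Implicit.
Unset Printing Implicit Defensive.

Import Order.TTheory GRing.Theory Num.Theory.
Import numFieldNormedType.Exports.

Local Open Scope classical_set_scope.
Local Open Scope ring_scope.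

(** * Frechet derivatives and G-semismoothness *)

Section Frechet.
Context {R : realType} {Z Z' : normedModType R}.
Implicit Types (F : Z -> Z') (x y z : Z).

(** When singular values of Xbar are repeated or vanish, the factors U, V of a nearby X need not be
    close to Ubar, Vbar, and for n > m the last columns of V are free as well. So nothing is
    differentiated with respect to the factors: every estimate is uniform over all decompositions of
    X and goes through the overlaps P, Q. Absolute symmetry enters as the bounds of |g_i - g_j| by
    |s_i - s_j| and of |g_i + g_j| by |s_i + s_j|, which match the two overlap inequalities. G may
    fail to be differentiable at Xbar, so tangent vectors are taken at X; exchanging base points
    costs a product of two small factors. The remainder of X - Xbar is still hit by G'(X), which
    calls for a bound on G'(X) uniform in X: the Lipschitz constant of G. The bound rho <= 1 absorbs
    the second-order errors. In the converse, matrix polynomials serve because their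
    differentiability follows from that of products, whatever the multiplicities. The Jacobian of g
    is not diagonal, hence the coupling terms <X, E(X)> V(X) besides an odd polynomial in X. *)

Lemma near_distP x (P : Z -> Prop) :
  (\forall y \near x, P y) <-> exists2 d, 0 < d & forall y, `|y - x| < d -> P y.
Proof.
split=> [/nbhs_ballP[d /= d0 dP]|[d d0 dP]].
  by exists d => // y yx; apply: dP; rewrite -ball_normE /= distrC.
apply/nbhs_ballP; exists d => //= y; rewrite -ball_normE /= distrC; exact: dP.
Qed.

Lemma open_dist_lt x (d : R) : open [set y | `|y - x| < d].
Proof.
rewrite openE => y /= yx; apply/near_distP; exists (d - `|y - x|) => [|w wy].
  by rewrite subr_gt0.
rewrite /= -(subrKA y) (le_lt_trans (ler_normD _ _))// -ltrBrDr; exact: wy.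
Qed.

(** Linearity and boundedness of [L] are left out, so that a candidate derivative is tested by
    estimates alone. *)
Definition frechet F x (L : Z -> Z') :=
  forall e : R, 0 < e -> exists2 d, 0 < d & forall y, `|y - x| < d ->
    `|F y - F x - L (y - x)| <= e * `|y - x|.

Lemma differentiable_frechet F x : differentiable F x -> frechet F x ('d F x).
Proof.
move=> [[_ /eqaddoP Fx]] e e0.
have /= := Fx e e0; move=> /near_distP[d d0 dP].
exists d => // y /dP; rewrite norm_lim_id//=.
rewrite -[(_ - _ : Z -> Z') y]/(F y - (F x + 'd F x (y - x))).
by rewrite opprD addrA.
Qed.

Lemma frechet_differentiable F x (L : {linear Z -> Z'}) (C : R) :
  (forall h, `|L h| <= C * `|h|) -> frechet F x L ->
  differentiable F x /\ 'd F x = L :> (Z -> Z').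
Proof.
move=> LC FL.
have Lc : continuous L.
  move=> h; apply/cvgrPdist_le => e e0.
  have C1 : 0 < `|C| + 1 by rewrite ltr_wpDl.
  apply/near_distP; exists (e / (`|C| + 1)) => [|y yh]; first by rewrite divr_gt0.
  rewrite -linearB (le_trans (LC _))// distrC.
  apply: (@le_trans _ _ ((`|C| + 1) * `|y - h|)).
    by rewrite ler_wpM2r// (le_trans (ler_norm _))// lerDl.
  by rewrite mulrC -ler_pdivlMr// ltW.
have E : F \o shift x = cst (F x) + L +o_ 0 id.
  apply/eqaddoP => e e0; apply/near_distP.
  have [d d0 dP] := FL e e0; exists d => // y; rewrite subr0 => yd.
  rewrite -[X in `|X|]/(F (y + x) - (F x + L y)) opprD addrA.
  by have := dP (y + x); rewrite addrK; exact.
have D := diff_unique Lc E.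
by split=> //; apply/diff_locallyP; rewrite D.
Qed.

Lemma diff_bounded F x : differentiable F x ->
  exists2 C, 0 < C & forall h, `|'d F x h| <= C * `|h|.
Proof. by move=> Fx; apply: linear_lipschitz; exact: diff_continuous. Qed.

Lemma locally_lipschitzP F z : locally_lipschitz_near F z <->
  exists C d : R, [/\ 0 <= C, 0 < d & forall x y,
    `|x - z| < d -> `|y - z| < d -> `|F x - F y| <= C * `|x - y|].
Proof.
split=> [[U [Uo Uz [M [Mr ML]]]]|[C [d [C0 d0 Cd]]]].
  have /near_distP[d d0 dU] : \forall y \near z, U y by apply: open_nbhs_nbhs.
  exists (`|M| + 1), d; split=> // x y xz yz.
  have /= := ML (`|M| + 1).
  rewrite ltr_pwDr ?ler_norm// => /(_ isT (x, y)); apply; split; exact: dU.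
exists [set y | `|y - z| < d]; split; first exact: open_dist_lt.
  by rewrite /= subrr normr0.
exists C; split; first by rewrite realE C0.
move=> M CM [x y] /= [xz yz]; apply: (le_trans (Cd _ _ xz yz)).
by rewrite ler_wpM2r// ltW.
Qed.

(** The derivative is read off from one curve with velocity [H] whose image has velocity [K]. The
    curve need not be a line, so it can follow an orbit of the orthogonal groups. *)
Lemma frechet_curve F x (L : {linear Z -> Z'}) (C : R) (y : R -> Z) (H : Z) (K : Z') :
  (forall h, `|L h| <= C * `|h|) -> frechet F x L ->
  (forall e, 0 < e -> exists2 t0, 0 < t0 & forall t, 0 < t < t0 ->
    `|y t - x - t *: H| <= e * t /\ `|F (y t) - F x - t *: K| <= e * t) ->
  L H = K.
Proof.
move=> LC FL yHK; apply/eqP; rewrite -subr_eq0 -normr_le0; apply/ler_addgt0Pl => e e0.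
have C1 : 0 < `|C| + 1 by rewrite ltr_wpDl.
have H1 : 0 < `|H| + 1 by rewrite ltr_wpDl.
have [d d0 dP] := FL (e / 3 / (`|H| + 1)) (divr_gt0 (divr_gt0 e0 (ltr0Sn _ 2)) H1).
(* The bound by 1 keeps |y t - x| below (|H| + 1) t; the other two make the error of [F] along the
   curve and [L] of the error of the curve at most e t / 3 each. *)
pose e' := Num.min 1 (Num.min (e / 3) (e / 3 / (`|C| + 1))).
have e'0 : 0 < e' by rewrite !lt_min ltr01 !divr_gt0.
have [t0 t00 tP] := yHK e' e'0.
pose t := Num.min (t0 / 2) (d / (`|H| + 1) / 2).
have t_gt0 : 0 < t by rewrite lt_min !divr_gt0.
have tt0 : t < t0 by rewrite gt_min ltr_pdivrMr// ltr_pMr// ltr1n.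
have [|y1 y2] := tP t; first by rewrite t_gt0.
have y3 : `|y t - x| <= (`|H| + 1) * t.
  rewrite -(subrK (t *: H) (y t - x)) (le_trans (ler_normD _ _))// addrC mulrDl.
  rewrite normrZ gtr0_norm// mulrC lerD2l (le_trans y1)// (ler_wpM2r (ltW t_gt0))//.
  by rewrite /e' ge_min lexx.
have y4 : `|y t - x| < d.
  apply: (le_lt_trans y3); rewrite mulrC -ltr_pdivlMr//.
  rewrite /t gt_min; apply/orP; right.
  by rewrite ltr_pdivrMr// ltr_pMr ?ltr1n// divr_gt0.
have {}dP := dP _ y4.
rewrite addr0.
rewrite -(ler_pM2l t_gt0) -[t in leLHS]gtr0_norm// -normrZ scalerBr -linearZ /=.
have -> : L (t *: H) - t *: K = L (t *: H - (y t - x)) +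
    ((L (y t - x) - (F (y t) - F x)) + (F (y t) - F x - t *: K)).
  by rewrite addrA linearB !subrKA.
have -> : t * e = t * (e / 3) + (t * (e/3) + t * (e/3)) by field.
rewrite (le_trans (ler_normD _ _))// lerD//.
  rewrite (le_trans (LC _))// distrC.
  apply: (@le_trans _ _ ((`|C| + 1) * (e' * t))).
    apply: (@le_trans _ _ ((`|C| + 1) * `|y t - x - t *: H|)).
      by rewrite ler_wpM2r// (le_trans (ler_norm _))// lerDl.
    by rewrite ler_pM2l.
  rewrite mulrA mulrC (ler_wpM2l (ltW t_gt0))// mulrC -ler_pdivlMr//.
  by rewrite /e' !ge_min lexx !orbT.
rewrite (le_trans (ler_normD _ _))// lerD//; last first.
  rewrite (le_trans y2)// mulrC (ler_wpM2l (ltW t_gt0))//.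
  by rewrite /e' !ge_min lexx !orbT.
rewrite distrC (le_trans dP)//.
apply: (@le_trans _ _ (e / 3 / (`|H| + 1) * ((`|H| + 1) * t))).
  by apply: ler_wpM2l => //; rewrite !divr_ge0// ltW.
by rewrite mulrA divfK ?gt_eqF// mulrC.
Qed.

(** Homogeneity of [L'] is enough, since the curve tested in direction [h] is the line x + t h. *)
Lemma frechet_eq F x (L : {linear Z -> Z'}) (C : R) (L' : Z -> Z') :
  (forall h, `|L h| <= C * `|h|) -> frechet F x L -> frechet F x L' ->
  (forall (t : R) h, L' (t *: h) = t *: L' h) -> L' = L.
Proof.
move=> LC FL FL' L'Z; apply/funext => h; apply/esym.
apply: (@frechet_curve F x L C (fun t => x + t *: h)) => // e e0.
have h1 : 0 < `|h| + 1 by rewrite ltr_wpDl.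
have [d d0 dP] := FL' (e / (`|h| + 1)) (divr_gt0 e0 h1).
exists (d / (`|h| + 1)) => [|t /andP[t0 td]]; first by rewrite divr_gt0.
have E : x + t *: h - x = t *: h by rewrite addrC addKr.
split; first by rewrite E subrr normr0 mulr_ge0 ?ltW.
have := dP (x + t *: h); rewrite E L'Z normrZ gtr0_norm// => H.
apply: (le_trans (H _)).
  rewrite (@le_lt_trans _ _ (t * (`|h| + 1)))// -?ltr_pdivlMr//.
  by rewrite (ler_wpM2l (ltW t0))// ?lerDl.
apply: (@le_trans _ _ (e / (`|h| + 1) * ((`|h| + 1) * t))).
  apply: ler_wpM2l; first by rewrite divr_ge0// ltW.
  by rewrite mulrC (ler_wpM2r (ltW t0))// lerDl.
by rewrite mulrA divfK ?gt_eqF.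
Qed.

Lemma frechet_same_jet F F' x (L : Z -> Z') :
  F' x = F x -> frechet F x L -> frechet F' x L ->
  forall e : R, 0 < e -> exists2 d, 0 < d & forall y, `|y - x| < d ->
    `|F y - F' y| <= e * `|y - x|.
Proof.
move=> FF' FL F'L e e0; have e2 : 0 < e / 2 by rewrite divr_gt0.
have [d d0 Hd] := FL _ e2; have [d' d'0 Hd'] := F'L _ e2.
exists (Num.min d d') => [|y]; first by rewrite lt_min d0.
rewrite lt_min => /andP[/Hd H /Hd'].
rewrite FF' => H'.
have -> : F y - F' y = (F y - F x - L (y - x)) - (F' y - F x - L (y - x)).
  by rewrite opprB addrA subrK opprB addrA subrK.
by rewrite (le_trans (ler_normB _ _))// [e in leRHS]splitr mulrDl lerD.
Qed.

(** The derivative inherits the constant [C], not merely some bound depending on [x]; applied to G,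
    it makes G'(X) uniformly bounded for X near Xbar. *)
Lemma diff_lipschitz F x (C d : R) :
  differentiable F x -> 0 <= C -> 0 < d ->
  (forall y, `|y - x| < d -> `|F y - F x| <= C * `|y - x|) ->
  forall h, `|'d F x h| <= C * `|h|.
Proof.
move=> Fx C0 d0 CF h; apply/ler_addgt0Pl => e e0.
have h1 : 0 < `|h| + 1 by rewrite ltr_wpDl.
have [d' d'0 dP] := differentiable_frechet Fx (divr_gt0 e0 h1).
pose t := Num.min d d' / (`|h| + 1) / 2.
have t0 : 0 < t by rewrite !divr_gt0// lt_min d0.
have td : `|t *: h| < Num.min d d'.
  rewrite normrZ gtr0_norm//.
  apply: (@lt_le_trans _ _ (t * (`|h| + 1) * 2)).
    rewrite -mulrA ltr_pM2l// mulrDl; have := normr_ge0 h; lra.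
  by rewrite (_ : t * _ * 2 = Num.min d d') // /t; field; rewrite gt_eqF.
move: td; rewrite lt_min => /andP[t1 t2].
have E : t *: h + x - x = t *: h by rewrite addrK.
have := dP (t *: h + x); rewrite E => /(_ t2) H1.
have := CF (t *: h + x); rewrite E => /(_ t1) H2.
rewrite -(ler_pM2l t0) -[t in leLHS]gtr0_norm// -normrZ -linearZ.
set D := F _ - F x in H1 H2.
rewrite -(subKr D ('d F x (t *: h))) (le_trans (ler_normB _ _))// mulrDr addrC lerD//.
  apply: (le_trans H1); rewrite normrZ gtr0_norm//.
  rewrite mulrCA (ler_wpM2l (ltW t0))//.
  by rewrite mulrAC ler_pdivrMr// (ler_wpM2l (ltW e0))// lerDl.
by rewrite (le_trans H2)// normrZ gtr0_norm// mulrCA.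
Qed.

End Frechet.

(** * Reduction of G-semismoothness to points of differentiability *)

Section GSemismoothReduction.
Context {R : realType} {Z Z' : normedModType R}.
Implicit Types (F : Z -> Z') (x y z : Z).

Lemma powR_continuous (a p : R) : 0 < a -> {for a, continuous (@powR R ^~ p)}.
Proof.
move=> a0; apply/differentiable_continuous/derivable1_diffP.
by apply: derivable_powR; rewrite in_itv /= a0.
Qed.

(** F'(z_k)(z_k - z) is the sum of F'(z_k)(z_k - y), which tends to 0 because the F'(z_k) are
    uniformly bounded, and of F'(z_k)(y - z), which tends to L(y - z). The other terms pass to the
    limit by continuity. *)
Lemma B_subdifferential_estimate F O z y (C d p : R) (L : Z -> Z') :
  0 < d -> {for y, continuous F} -> `|y - z| < d ->
  (forall w, `|w - z| < d -> differentiable F w ->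
    `|F w - F z - 'd F w (w - z)| <= C * `|w - z| `^ p) ->
  B_subdifferential O F y L ->
  `|F y - F z - L (y - z)| <= `|C| * `|y - z| `^ p.
Proof.
move=> d0 Fc yz Hd [zk [zkO zky Lk]].
have LkL h : 'd F (zk j) h @[j --> \oo] --> L h.
  apply/cvgrPdist_le => e e0.
  have h1 : 0 < `|h| + 1 by rewrite ltr_wpDl.
  have := Lk _ (divr_gt0 e0 h1); apply: filterS => j /(_ h).
  rewrite distrC => /le_trans; apply; rewrite mulrAC ler_pdivrMr// (ler_wpM2l (ltW e0))//.
  by rewrite lerDl.
(* At y = z continuity of the power function at 0 is avoided: both increments vanish, and L 0 = 0 as
   a limit of linear maps. *)
have [zey|zney] := eqVneq y z.
  have L0 : L 0 = 0.
    have := LkL 0; under eq_fun do rewrite linear0.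
    by move=> /(cvg_unique (@norm_hausdorff _ _)); apply; exact: cvg_cst.
  by rewrite zey !subrr L0 subr0 normr0 mulr_ge0// powR_ge0.
have yz0 : 0 < `|y - z| by rewrite normr_gt0 subr_eq0.
have zkz : zk j - z @[j --> \oo] --> y - z by apply: cvgB => //; exact: cvg_cst.
have zkn : `|zk j - z| @[j --> \oo] --> `|y - z| by apply: cvg_norm.
have zkd : \forall j \near \oo, `|zk j - z| < d.
  by move/cvgr_lt : zkn => /(_ _ yz).
have [j0 _ /(_ _ (leqnn _)) Lj0] := Lk 1 ltr01.
have [B B0 HB] := diff_bounded (zkO j0).2.
have dLk : 'd F (zk j) (zk j - z) @[j --> \oo] --> L (y - z).
  have dk : 'd F (zk j) (zk j - y) @[j --> \oo] --> (0 : Z').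
    apply/cvgr0Pnorm_le => e e0.
    have BB : 0 < B + 2 by rewrite addr_gt0.
    have zk0 : zk j - y @[j --> \oo] --> (0 : Z).
      by rewrite -(subrr y); apply: cvgB => //; exact: cvg_cst.
    have /cvgr0Pnorm_le/(_ _ (divr_gt0 e0 BB)) zk0e := zk0.
    have [j1 _ Lj1] := Lk 1 ltr01.
    near=> j.
    (* Both F'(z_j) and F'(z_j0) are within |h| of L h for large j, and [B] bounds F'(z_j0); hence B
       + 2. *)
    have H1 : `|'d F (zk j) (zk j - y)| <= (B + 2) * `|zk j - y|.
      set h := zk j - y.
      have h1 : `|'d F (zk j) h - L h| <= 1 * `|h|.
        by apply: Lj1; near: j; exact: nbhs_infty_ge.
      rewrite -(subrK (L h) ('d F (zk j) h)) (le_trans (ler_normD _ _))//.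
      have := ler_normB ('d F (zk j0) h) ('d F (zk j0) h - L h).
      rewrite subKr; have := Lj0 h; have := HB h; lra.
    apply: (le_trans H1); rewrite mulrC -ler_pdivlMr//.
    by near: j; exact: zk0e.
  under eq_fun do rewrite -(subrKA y) linearD.
  by rewrite -[L _]add0r; exact: cvgD dk (LkL (y - z)).
have lhs : `|F (zk j) - F z - 'd F (zk j) (zk j - z)| @[j --> \oo]
    --> `|F y - F z - L (y - z)|.
  apply: cvg_norm; apply: cvgB => //; apply: cvgB; last exact: cvg_cst.
  by apply: continuous_cvg.
have rhs : `|C| * `|zk j - z| `^ p @[j --> \oo] --> `|C| * `|y - z| `^ p.
  apply: cvgM; first exact: cvg_cst.
  exact: (cvg_comp _ _ zkn (@powR_continuous _ p yz0)).
apply: (ler_cvg_to lhs rhs); near=> j.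
have H : `|zk j - z| < d by near: j.
apply: (le_trans (Hd _ H (zkO j).2)).
by rewrite ler_wpM2r ?powR_ge0// ler_norm.
Unshelve. all: by end_near. Qed.

(* An element of the Clarke Jacobian is a convex combination of limits of derivatives,
   and the estimate passes to limits and to convex combinations. *)
Lemma G_semismoothP F z (rho : R) : G_semismooth F z rho <->
  locally_lipschitz_near F z /\
  exists C d : R, [/\ 0 <= C, 0 < d & forall y, `|y - z| < d -> differentiable F y ->
    `|F y - F z - 'd F y (y - z)| <= C * `|y - z| `^ (1 + rho)].
Proof.
split.
  move=> [U [Oo Oz OL [C]]].
  have /near_distP[d1 d10 Od1] : \forall y \near z, U y by apply: open_nbhs_nbhs.
  move=> /near_distP[d2 d20 Cd2].
  split; first exact: OL.
  exists `|C|, (Num.min d1 d2); split=> //; first by rewrite lt_min d10.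
  move=> y; rewrite lt_min => /andP[y1 y2] Fy.
  apply: (@le_trans _ _ (C * `|y - z| `^ (1 + rho))); last first.
    by rewrite ler_wpM2r ?powR_ge0// ler_norm.
  (* A derivative belongs to the Clarke Jacobian through the constant sequence and a convex
     combination of one term. *)
  apply: Cd2 => //; exists 1, (fun=> 1), (fun=> ('d F y : Z -> Z')); split=> //.
  - by rewrite big_ord1.
  - move=> _; exists (fun=> y); split=> //.
    + by move=> _; split=> //; exact: Od1.
    + exact: cvg_cst.
    + by move=> e e0; apply: nearW => j h; rewrite subrr normr0 mulr_ge0// ltW.
  - by rewrite big_ord1 scale1r.
move=> [/locally_lipschitzP[K [r [K0 r0 KF]]] [C [d [C0 d0 Cd]]]].
have LF y : `|y - z| < r -> locally_lipschitz_near F y.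
  move=> yz; exists [set w | `|w - z| < r]; split=> //; first exact: open_dist_lt.
  exists K; split; first by rewrite realE K0.
  move=> M KM [x w] /= [xz wz]; apply: (le_trans (KF _ _ xz wz)).
  by rewrite ler_wpM2r// ltW.
exists [set y | `|y - z| < r]; split; first exact: open_dist_lt.
- by rewrite /= subrr normr0.
- by move=> y; exact: LF.
exists C; apply/near_distP; exists (Num.min r d); first by rewrite lt_min r0.
move=> y; rewrite lt_min => /andP[yr yd] L [p [w [a [w0 w1 aL ->]]]].
have Fc : {for y, continuous F}.
  apply/cvgrPdist_le => e e0; apply/near_distP.
  have K1 : 0 < K + 1 by rewrite ltr_wpDl.
  exists (Num.min (r - `|y - z|) (e / (K + 1))) => [|x].
    by rewrite lt_min subr_gt0 yr divr_gt0.
  rewrite lt_min => /andP[x1 x2]; apply: (le_trans (KF _ _ yr _)).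
    by rewrite -(subrKA y) (le_lt_trans (ler_normD _ _))// -ltrBrDr.
  rewrite distrC (@le_trans _ _ ((K + 1) * `|x - y|))//.
    by rewrite ler_wpM2r// lerDl.
  by rewrite mulrC -ler_pdivlMr// ltW.
have -> : F y - F z - (\sum_i w i *: a i) (y - z) =
    \sum_i w i *: (F y - F z - a i (y - z)).
  under [RHS]eq_bigr do rewrite scalerBr.
  rewrite sumrB -scaler_suml w1 scale1r; congr (_ - _).
  by rewrite fct_sumE.
apply: (le_trans (ler_norm_sum _ _ _)).
apply: (@le_trans _ _ (\sum_(i < p) w i * (C * `|y - z| `^ (1 + rho)))).
  apply: ler_sum => i _; rewrite normrZ ger0_norm// ler_wpM2l// -(ger0_norm C0).
  exact: (B_subdifferential_estimate d0 Fc yd Cd (aL i)).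
by rewrite -mulr_suml w1 mul1r.
Qed.

End GSemismoothReduction.

(** * The Frobenius norm *)

Section ScalarMorphisms.
Context {R : realType} {k : scalar_kind}.
Implicit Types (a b : R) (x y : scalars R k).

Fact conj_is_zmod_morphism : zmod_morphism (@conj R k).
Proof. by case: k => // -[? ?] [? ?] /=; congr (_ +i* _)%C; rewrite opprB addrC ?opprK. Qed.

HB.instance Definition _ :=
  GRing.isZmodMorphism.Build (scalars R k) (scalars R k) conj conj_is_zmod_morphism.

Fact conj_is_monoid_morphism : monoid_morphism (@conj R k).
Proof.
case: k => //; split=> [|[a b] [c d]] /=; congr (_ +i* _)%C; first by rewrite oppr0.
  by rewrite mulrNN.
by rewrite mulrN mulNr opprD.
Qed.

HB.instance Definition _ :=
  GRing.isMonoidMorphism.Build (scalars R k) (scalars R k) conj conj_is_monoid_morphism.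

Fact of_real_is_zmod_morphism : zmod_morphism (@of_real R k).
Proof. by case: k => // a b /=; rewrite rmorphB. Qed.

HB.instance Definition _ :=
  GRing.isZmodMorphism.Build R (scalars R k) of_real of_real_is_zmod_morphism.

Fact of_real_is_monoid_morphism : monoid_morphism (@of_real R k).
Proof. by split=> [|a b]; rewrite ?of_real1 ?of_realM. Qed.

HB.instance Definition _ :=
  GRing.isMonoidMorphism.Build R (scalars R k) of_real of_real_is_monoid_morphism.

Fact re_is_zmod_morphism : zmod_morphism (@re R k).
Proof. by case: k => // -[? ?] [? ?]. Qed.

HB.instance Definition _ :=
  GRing.isZmodMorphism.Build (scalars R k) R re re_is_zmod_morphism.

Lemma conjK : involutive (@conj R k).
Proof. by case: k => // -[a b] /=; rewrite opprK. Qed.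

Lemma conj_of_real a : conj (of_real a) = of_real a :> scalars R k.
Proof. by case: k => //=; rewrite oppr0. Qed.

Lemma of_realK : cancel (@of_real R k) re. Proof. by case: k. Qed.

Lemma of_real_inj : injective (@of_real R k).
Proof. exact: can_inj of_realK. Qed.

Lemma re_of_realM a x : re (of_real a * x) = a * re x.
Proof. by case: k x => //= -[b c] /=; rewrite mul0r subr0. Qed.

(** Takes its values in [R] for both kinds of scalars, whereas the norm of a complex number is again
    a complex number. *)
Definition modulus x : R := Num.sqrt (re (conj x * x)).

Lemma modulus_ge0 x : 0 <= modulus x. Proof. exact: sqrtr_ge0. Qed.

Lemma sqr_modulus x : modulus x ^+ 2 = re (conj x * x).
Proof. by rewrite sqr_sqrtr// re_conj_ge0. Qed.

Lemma conj_mul_self x : conj x * x = of_real (modulus x ^+ 2).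
Proof.
rewrite sqr_modulus; case: k x => //= -[a b] /=; congr (_ +i* _)%C.
by rewrite mulrC mulNr subrr.
Qed.

Lemma modulus0 : modulus 0 = 0.
Proof. by rewrite /modulus mulr0 raddf0 sqrtr0. Qed.

Lemma modulusM x y : modulus (x * y) = modulus x * modulus y.
Proof.
apply/eqP; rewrite -(@eqrXn2 _ 2%N)// ?mulr_ge0 ?modulus_ge0//.
by rewrite exprMn sqr_modulus rmorphM mulrACA !conj_mul_self -rmorphM /= of_realK.
Qed.

Lemma modulus_real a : modulus (of_real a) = `|a|.
Proof. by rewrite /modulus conj_of_real -rmorphM /= of_realK -expr2 sqrtr_sqr. Qed.

Lemma modulusN x : modulus (- x) = modulus x.
Proof. by rewrite /modulus rmorphN mulrNN. Qed.

Lemma modulus_conj x : modulus (conj x) = modulus x.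
Proof. by rewrite /modulus conjK mulrC. Qed.

Lemma le_re_modulus x : `|re x| <= modulus x.
Proof.
rewrite -sqrtr_sqr ler_wsqrtr//; case: k x => //= -[a b] /=.
by rewrite mulNr opprK -!expr2 lerDl sqr_ge0.
Qed.

Lemma modulusD x y : modulus (x + y) <= modulus x + modulus y.
Proof.
rewrite -(@ler_pXn2r _ 2%N)// ?nnegrE ?addr_ge0 ?modulus_ge0//.
rewrite sqr_modulus rmorphD mulrDl !mulrDr !raddfD /= -!sqr_modulus sqrrD -!addrA lerD2l.
rewrite !addrA lerD2r (re_conjC y) -mulr2n lerMn2r/=.
apply: le_trans (ler_norm _) _; apply: le_trans (le_re_modulus _) _.
by rewrite modulusM modulus_conj.
Qed.

Lemma modulusB x y : modulus (x - y) <= modulus x + modulus y.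
Proof. by rewrite -(modulusN y) modulusD. Qed.

Lemma modulus_sum (I : Type) (r : seq I) (P : pred I) (f : I -> scalars R k) :
  modulus (\sum_(i <- r | P i) f i) <= \sum_(i <- r | P i) modulus (f i).
Proof.
elim/big_ind2 : _ => [|x a y b xa yb|//]; first by rewrite modulus0.
by apply: le_trans (modulusD _ _) _; exact: lerD.
Qed.

End ScalarMorphisms.

Section FrobeniusNorm.
Context {R : realType} {k : scalar_kind}.
Local Notation K := (scalars R k).

Lemma ctrE p q (A : 'M[K]_(p, q)) i j : ctr A i j = conj (A j i).
Proof. by rewrite !mxE. Qed.

Lemma mxBE p q (A B : 'M[K]_(p, q)) i j : (A - B) i j = A i j - B i j.
Proof. by rewrite !mxE. Qed.

Lemma ctrM p q r (A : 'M[K]_(p, q)) (B : 'M[K]_(q, r)) : ctr (A *m B) = ctr B *m ctr A.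
Proof. by rewrite /ctr trmx_mul map_mxM. Qed.

Lemma ctrK p q (A : 'M[K]_(p, q)) : ctr (ctr A) = A.
Proof. by apply/matrixP => i j; rewrite !mxE conjK. Qed.

Lemma ctrD p q (A B : 'M[K]_(p, q)) : ctr (A + B) = ctr A + ctr B.
Proof. by apply/matrixP => i j; rewrite !mxE rmorphD. Qed.

Lemma ctrN p q (A : 'M[K]_(p, q)) : ctr (- A) = - ctr A.
Proof. by apply/matrixP => i j; rewrite !mxE rmorphN. Qed.

Lemma ctrB p q (A B : 'M[K]_(p, q)) : ctr (A - B) = ctr A - ctr B.
Proof. by rewrite ctrD ctrN. Qed.

Lemma ctrZ p q (a : R) (A : 'M[K]_(p, q)) : ctr (of_real a *: A) = of_real a *: ctr A.
Proof. by apply/matrixP => i j; rewrite !mxE rmorphM /= conj_of_real. Qed.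

Lemma ctr1 p : ctr (1%:M : 'M[K]_p) = 1%:M.
Proof. by rewrite /ctr tr_scalar_mx map_scalar_mx rmorph1. Qed.

Lemma orthogonal_mxC p (U : 'M[K]_p) : orthogonal_mx U -> U *m ctr U = 1%:M.
Proof. exact: mulmx1C. Qed.

Lemma orthogonal_mx_ctr p (U : 'M[K]_p) : orthogonal_mx U -> orthogonal_mx (ctr U).
Proof. by move=> /orthogonal_mxC; rewrite /orthogonal_mx ctrK. Qed.

Lemma orthogonal_mxM p (U V : 'M[K]_p) :
  orthogonal_mx U -> orthogonal_mx V -> orthogonal_mx (U *m V).
Proof.
by rewrite /orthogonal_mx => U1 V1; rewrite ctrM -mulmxA (mulmxA _ U) U1 mul1mx.
Qed.

(** Gives plain matrices, on which products are defined, the Frobenius norm of [mat] instead of the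
    maximum norm. *)
Definition fnorm {p q} (A : 'M[K]_(p, q)) : R := `|A : mat R k p q|.

Lemma fnorm_ge0 p q (A : 'M[K]_(p, q)) : 0 <= fnorm A.
Proof. exact: normr_ge0. Qed.

Lemma fnorm0 p q : fnorm (0 : 'M[K]_(p, q)) = 0.
Proof. exact: normr0. Qed.

Lemma fnormN p q (A : 'M[K]_(p, q)) : fnorm (- A) = fnorm A.
Proof. exact: normrN. Qed.

Lemma fnormD p q (A B : 'M[K]_(p, q)) : fnorm (A + B) <= fnorm A + fnorm B.
Proof. exact: ler_normD. Qed.

Lemma fnormZ p q (a : R) (A : 'M[K]_(p, q)) : fnorm (of_real a *: A) = `|a| * fnorm A.
Proof. exact: (@normrZ _ (mat R k p q)). Qed.

Lemma sqr_fnorm_dot p q (A : 'M[K]_(p, q)) : fnorm A ^+ 2 = mat_dot A A.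
Proof. by rewrite sqr_sqrtr// mat_dot_ge0. Qed.

Lemma sqr_fnorm p q (A : 'M[K]_(p, q)) : fnorm A ^+ 2 = \sum_j \sum_i modulus (A i j) ^+ 2.
Proof.
rewrite sqr_fnorm_dot mat_dotE.
by apply: eq_bigr => j _; apply: eq_bigr => i _; rewrite sqr_modulus.
Qed.

Lemma fnorm_mull p q r (U : 'M[K]_(p, q)) (A : 'M[K]_(q, r)) :
  ctr U *m U = 1%:M -> fnorm (U *m A) = fnorm A.
Proof.
move=> U1; apply/eqP; rewrite -(@eqrXn2 _ 2%N)// ?fnorm_ge0//.
by rewrite !sqr_fnorm_dot /mat_dot ctrM -mulmxA (mulmxA _ U) U1 mul1mx.
Qed.

Lemma fnorm_ctr p q (A : 'M[K]_(p, q)) : fnorm (ctr A) = fnorm A.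
Proof.
apply/eqP; rewrite -(@eqrXn2 _ 2%N)// ?fnorm_ge0// !sqr_fnorm exchange_big /=.
by apply/eqP; do 2!(apply: eq_bigr => ? _); rewrite !mxE modulus_conj.
Qed.

Lemma fnorm_mulr p q r (V : 'M[K]_(q, r)) (A : 'M[K]_(p, q)) :
  V *m ctr V = 1%:M -> fnorm (A *m V) = fnorm A.
Proof. by move=> V1; rewrite -fnorm_ctr ctrM fnorm_mull ?ctrK// fnorm_ctr. Qed.

Lemma le_modulus_fnorm p q (A : 'M[K]_(p, q)) i j : modulus (A i j) <= fnorm A.
Proof.
rewrite -(@ler_pXn2r _ 2%N)// ?nnegrE ?fnorm_ge0 ?modulus_ge0// sqr_fnorm.
rewrite (bigD1 j)//= (bigD1 i)//= -addrA lerDl addr_ge0//.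
  by apply: sumr_ge0 => ? _; rewrite sqr_ge0.
by do 2!(apply: sumr_ge0 => ? _); rewrite sqr_ge0.
Qed.

Lemma fnorm_le_entries p q (A : 'M[K]_(p, q)) (c : R) :
  0 <= c -> (forall i j, modulus (A i j) <= c) -> fnorm A <= (p * q)%:R * c.
Proof.
move=> c0 Ac; have pqc : 0 <= (p * q)%:R * c by rewrite mulr_ge0.
rewrite -(@ler_pXn2r _ 2%N)// ?nnegrE ?fnorm_ge0// sqr_fnorm.
apply: (@le_trans _ _ ((p * q)%:R * c ^+ 2)).
  rewrite mulrC mulr_natr mulrnA -[in leRHS](card_ord q) -sumr_const.
  apply: ler_sum => j _; rewrite -[in leRHS](card_ord p) -sumr_const.
  by apply: ler_sum => i _; rewrite ler_pXn2r// nnegrE modulus_ge0.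
rewrite exprMn ler_wpM2r ?sqr_ge0// -natrX ler_nat.
by case: (p * q)%N => // a; rewrite expnS expn1 leq_pmulr.
Qed.

Lemma fnormM p q r (A : 'M[K]_(p, q)) (B : 'M[K]_(q, r)) :
  fnorm (A *m B) <= (p * r * q)%:R * (fnorm A * fnorm B).
Proof.
rewrite natrM -mulrA; apply: fnorm_le_entries => [|i j].
  by rewrite !mulr_ge0 ?fnorm_ge0.
rewrite mxE; apply: le_trans (modulus_sum _ _ _) _.
rewrite mulr_natl -[X in _ *+ X](card_ord q) -sumr_const; apply: ler_sum => l _.
by rewrite modulusM ler_pM ?modulus_ge0 ?le_modulus_fnorm.
Qed.

Lemma modulus_orthogonal_le1 p (U : 'M[K]_p) i j : orthogonal_mx U -> modulus (U i j) <= 1.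
Proof.
move=> U1; rewrite -(@ler_pXn2r _ 2%N)// ?nnegrE ?modulus_ge0// expr1n.
have : (ctr U *m U) j j = 1 by rewrite U1 mxE eqxx.
rewrite mxE; under eq_bigr do rewrite !mxE conj_mul_self.
rewrite -rmorph_sum -(rmorph1 (@of_real R k)) => /of_real_inj <-.
by rewrite (bigD1 i)//= lerDl sumr_ge0// => ? _; rewrite sqr_ge0.
Qed.

Lemma sum_modulus_col p (U : 'M[K]_p) j : orthogonal_mx U ->
  \sum_i modulus (U i j) ^+ 2 = 1.
Proof.
move=> U1; have : (ctr U *m U) j j = 1 by rewrite U1 mxE eqxx.
rewrite mxE; under eq_bigr do rewrite !mxE conj_mul_self.
by rewrite -rmorph_sum -(rmorph1 (@of_real R k)) => /of_real_inj.
Qed.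

End FrobeniusNorm.

Section Rvec.
Context {R : realType} {m : nat}.
Implicit Types s : rvec R m.

Lemma sqr_rvec_norm s : `|s| ^+ 2 = \sum_i s i 0 ^+ 2.
Proof. by rewrite sqr_sqrtr// rvec_dot_ge0. Qed.

Lemma le_rvec_norm s i : `|s i 0| <= `|s|.
Proof.
rewrite -(@ler_pXn2r _ 2%N)// ?nnegrE// sqr_rvec_norm real_normK ?num_real//.
by rewrite (bigD1 i)//= lerDl sumr_ge0// => ? _; rewrite sqr_ge0.
Qed.

Lemma rvec_norm_le s c : 0 <= c -> (forall i, `|s i 0| <= c) -> `|s| <= m%:R * c.
Proof.
move=> c0 sc; have mc : 0 <= m%:R * c by rewrite mulr_ge0.
rewrite -(@ler_pXn2r _ 2%N)// ?nnegrE// sqr_rvec_norm.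
apply: (@le_trans _ _ (m%:R * c ^+ 2)).
  rewrite mulr_natl -[in leRHS](card_ord m) -sumr_const; apply: ler_sum => i _.
  by rewrite -(real_normK (num_real (s i 0))) ler_pXn2r// nnegrE.
rewrite exprMn ler_wpM2r ?sqr_ge0// -natrX ler_nat.
by case: (m)%N => // a; rewrite expnS expn1 leq_pmulr.
Qed.

End Rvec.

(** * Singular values *)

Section Diag0.
Context {R : realType} {k : scalar_kind} {m n : nat}.
Hypothesis le_mn : (m <= n)%N.
Local Notation K := (scalars R k).
Local Notation w := (widen_ord le_mn).
Implicit Types s : rvec R m.
Local Notation D := (@diag0 R k m n).

Lemma widen_ordVge (j : 'I_n) : {j' | j = w j'} + {(m <= j)%N}.
Proof.
case: (ltnP j m) => [jm|]; [left|by right].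
by exists (Ordinal jm); apply: val_inj.
Qed.

Lemma diag0D s t : D (s + t) = D s + D t :> 'M[K]_(m, n).
Proof.
apply/matrixP => i j; rewrite !mxE.
by case: ifP => _; rewrite ?rmorphD ?addr0.
Qed.

Lemma diag0Z (a : R) s : D (a *: s) = of_real a *: D s :> 'M[K]_(m, n).
Proof.
apply/matrixP => i j; rewrite !mxE.
by case: ifP => _; rewrite ?rmorphM ?mulr0.
Qed.

Lemma diag0B s t : D (s - t) = D s - D t :> 'M[K]_(m, n).
Proof. by rewrite -scaleN1r diag0D diag0Z rmorphN1 scaleN1r. Qed.

Lemma mulmx_diag0 p (A : 'M[K]_(p, m)) s i j :
  (A *m D s) i (w j) = A i j * of_real (s j 0).
Proof.
rewrite mxE (bigD1 j)//= mxE eqxx big1 ?addr0// => l lj.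
by rewrite mxE ifN ?mulr0.
Qed.

Lemma mulmx_diag0_ge p (A : 'M[K]_(p, m)) s i (j : 'I_n) : (m <= j)%N ->
  (A *m D s) i j = 0.
Proof.
move=> mj; rewrite mxE big1 // => l _.
by rewrite mxE ltn_eqF ?mulr0// (leq_trans _ mj).
Qed.

Lemma diag0_mulmx p (A : 'M[K]_(n, p)) s i j :
  (D s *m A) i j = of_real (s i 0) * A (w i) j.
Proof.
rewrite mxE (bigD1 (w i))//= mxE eqxx big1 ?addr0// => l lj.
rewrite mxE ifN ?mul0r//; apply: contra lj => /eqP il.
by apply/eqP/val_inj.
Qed.

Lemma mulmx_ctr_diag0 p (A : 'M[K]_(p, n)) s i j :
  (A *m ctr (D s)) i j = A i (w j) * of_real (s j 0).
Proof.
by rewrite -[A]ctrK -ctrM !ctrE diag0_mulmx rmorphM /= conj_of_real ctrE mulrC.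
Qed.

Lemma ctr_diag0_mulmx p (A : 'M[K]_(m, p)) s i j :
  (ctr (D s) *m A) (w i) j = of_real (s i 0) * A i j.
Proof.
by rewrite -[A]ctrK -ctrM !ctrE mulmx_diag0 rmorphM /= conj_of_real ctrE mulrC.
Qed.

Lemma fnorm_diag0 s : fnorm (D s) = `|s|.
Proof.
apply/eqP; rewrite -(@eqrXn2 _ 2%N)// ?fnorm_ge0// sqr_rvec_norm sqr_fnorm.
rewrite exchange_big /=; apply/eqP; apply: eq_bigr => i _.
rewrite (bigD1 (w i))//= mxE eqxx big1 ?addr0; last first.
  move=> j ji; rewrite mxE ifN ?modulus0 ?expr0n//; apply: contra ji => /eqP ij.
  by apply/eqP/val_inj.
by rewrite modulus_real real_normK ?num_real.
Qed.

Lemma diag0_mul_ctr s :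
  D s *m ctr (D s) = diag_mx (\row_j of_real (s j 0 ^+ 2)) :> 'M[K]_m.
Proof.
apply/matrixP => i j; rewrite mulmx_ctr_diag0 !mxE /=.
have [->|ij] := eqVneq i j; first by rewrite eqxx mulr1n rmorphXn expr2.
by rewrite ifN ?mul0r.
Qed.

Section CharPoly.
Variables (X : 'M[K]_(m, n)) (U : 'M[K]_m) (V : 'M[K]_n) (s : rvec R m).
Hypotheses (Uo : orthogonal_mx U) (Vo : orthogonal_mx V) (XE : X = U *m D s *m ctr V).

(** X ctr(X) = U diag(s^2) ctr(U), and conjugation by [U] preserves the characteristic polynomial.
    No sign or order of [s] is involved. *)
Lemma char_poly_svd :
  char_poly (X *m ctr X) = \prod_i ('X - (of_real (s i 0 ^+ 2) : K)%:P).
Proof.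
have -> : X *m ctr X = U *m diag_mx (\row_j of_real (s j 0 ^+ 2)) *m ctr U.
  rewrite XE !ctrM ctrK -diag0_mul_ctr !mulmxA -(mulmxA _ (ctr V)) (_ : ctr V *m V = 1%:M)//.
  by rewrite mulmx1.
set d := diag_mx _.
have -> : char_poly (U *m d *m ctr U) = char_poly d.
  rewrite /char_poly.
  have -> : char_poly_mx (U *m d *m ctr U) =
     map_mx polyC U *m char_poly_mx d *m map_mx polyC (ctr U).
    rewrite /char_poly_mx mulmxBr mulmxBl !map_mxM; congr (_ - _).
    by rewrite scalar_mxC -mulmxA -map_mxM orthogonal_mxC// map_mx1 mulmx1.
  rewrite !det_mulmx mulrAC -det_mulmx -map_mxM orthogonal_mxC// map_mx1 det1.
  by rewrite mul1r.
rewrite char_poly_trig; last by apply: diag_mx_is_trig.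
by apply: eq_bigr => i _; rewrite !mxE eqxx mulr1n.
Qed.

End CharPoly.

(** The linear factors of the characteristic polynomial determine the multiset of the squares;
    nonnegativity recovers the entries and monotonicity their order. *)
Lemma singular_values_inj (X : 'M[K]_(m, n)) s t :
  is_singular_values X s -> is_singular_values X t -> s = t.
Proof.
move=> [s1 s2 s3] [t1 t2 t3].
pose f (s : rvec R m) := [seq of_real (s i 0 ^+ 2) : K | i <- enum 'I_m].
have /prod_XsubC_eq st : \prod_(x <- f s) ('X - x%:P) = \prod_(x <- f t) ('X - x%:P).
  by rewrite /f !big_map; exact: etrans (esym s3) t3.
pose h (s : rvec R m) := [seq s i 0 | i <- enum 'I_m].
pose q (x : K) := Num.sqrt (re x).
have hE (u : rvec R m) : (forall i, 0 <= u i 0) -> h u = map q (f u).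
  move=> u0; rewrite -map_comp; apply: eq_map => i.
  by rewrite /q/= of_realK sqrtr_sqr ger0_norm.
have hs (u : rvec R m) : (forall i j : 'I_m, (i <= j)%N -> u j 0 <= u i 0) -> sorted >=%R (h u).
  move=> u1; rewrite sorted_map.
  have : sorted leq (map val (enum 'I_m)) by rewrite val_enum_ord iota_sorted.
  rewrite sorted_map; apply: sub_sorted => i j /=; exact: u1.
have E : h s = h t.
  apply: (sorted_eq (leT := >=%R)) => //.
  - by move=> x y z /= yx zy; apply: le_trans zy yx.
  - by move=> x y /= /andP[a b]; apply/eqP; rewrite eq_le a b.
  - exact: hs.
  - exact: hs.
  - by rewrite hE// [h t]hE//; exact: perm_map.
apply/matrixP => i j; rewrite ord1.
have hi (u : rvec R m) : nth 0 (h u) i = u i 0.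
  by rewrite (nth_map i) ?size_enum_ord// nth_ord_enum.
by rewrite -(hi s) E hi.
Qed.

Definition sact (e : 'I_m -> R) (p : {perm 'I_m}) s : rvec R m := \col_i (e i * s (p i) 0).

Lemma signed_sort s : exists e p t,
  [/\ forall i, e i = 1 \/ e i = -1, s = sact e p t,
      forall i j : 'I_m, (i <= j)%N -> t j 0 <= t i 0 & forall i, 0 <= t i 0].
Proof.
pose a := [tuple `|s i 0| | i < m].
pose b := [tuple of sort >=%R a].
have /tuple_permP[p ap] : perm_eq a b by rewrite perm_sym perm_sort.
pose t : rvec R m := \col_i tnth b i.
exists (fun i => if 0 <= s i 0 then 1 else -1), p, t; split.
- by move=> i; case: ifP; [left|right].
- apply/matrixP => i j; rewrite ord1 !mxE.
  have <- : tnth a i = tnth b (p i).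
    have {}ap : a = [tuple tnth b (p i) | i < m] by apply: val_inj.
    by rewrite {1}ap tnth_mktuple.
  rewrite tnth_mktuple; case: ifPn => s0; first by rewrite ger0_norm ?mul1r.
  by rewrite ltr0_norm ?mulN1r ?opprK// ltNge.
- move=> i j ij; rewrite !mxE !(tnth_nth 0).
  apply: (sorted_leq_nth (leT := >=%R)) => //.
  - by move=> x y z /= yx zy; apply: le_trans zy yx.
  - by move=> x /=.
  - by apply: sort_sorted => x y; exact: le_total.
  - by rewrite inE size_tuple.
  - by rewrite inE size_tuple.
- move=> i; rewrite mxE; have := mem_tnth i b; rewrite mem_sort.
  by move=> /tnthP[j ->]; rewrite tnth_mktuple.
Qed.

Lemma sigma_svd (X : 'M[K]_(m, n)) U V e p t :
  orthogonal_mx U -> orthogonal_mx V -> X = U *m D (sact e p t) *m ctr V ->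
  (forall i, e i = 1 \/ e i = -1) ->
  (forall i j : 'I_m, (i <= j)%N -> t j 0 <= t i 0) -> (forall i, 0 <= t i 0) ->
  sigma X = t.
Proof.
move=> Uo Vo XE e1 t1 t0.
have tX : is_singular_values X t.
  split=> //; rewrite (char_poly_svd Uo Vo XE).
  rewrite [RHS](reindex_inj (@perm_inj _ p)) /=; apply: eq_bigr => i _.
  by rewrite mxE exprMn; case: (e1 i) => ->; rewrite ?sqrrN expr1n mul1r.
by apply: (singular_values_inj _ tX); rewrite /sigma; apply: xgetPex; exists t.
Qed.

(** [sigma X] comes from a choice operator with a default value, so its defining property needs a
    witness. Sorting the absolute values of the diagonal of a decomposition provides one, and
    uniqueness identifies it with [sigma X]. *)
Lemma svd_singular_values (X : 'M[K]_(m, n)) U V :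
  svd_pair X U V -> is_singular_values X (sigma X).
Proof.
move=> [Uo Vo XE].
have [e [p [t [e1 st t1 t0]]]] := signed_sort (sigma X).
have sE := sigma_svd Uo Vo (etrans XE (congr1 (fun s => U *m D s *m ctr V) st)) e1 t1 t0.
rewrite sE; split=> //; rewrite (char_poly_svd Uo Vo XE).
by apply: eq_bigr => i _; rewrite sE.
Qed.

End Diag0.

(* Conversion must not try to evaluate the choice operator behind [sigma]. *)
Local Opaque sigma.

(** * Overlaps of two singular value decompositions *)

Section TwoDecompositions.
Context {R : realType} {k : scalar_kind} {m n : nat}.
Hypothesis le_mn : (m <= n)%N.
Local Notation K := (scalars R k).
Local Notation w := (widen_ord le_mn).
Local Notation D := (@diag0 R k m n).
Variables (U U' : 'M[K]_m) (V V' : 'M[K]_n) (s s' : rvec R m).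
Hypotheses (Uo : orthogonal_mx U) (U'o : orthogonal_mx U').
Hypotheses (Vo : orthogonal_mx V) (V'o : orthogonal_mx V').
Variables X Y : 'M[K]_(m, n).
Hypotheses (XE : X = U *m D s *m ctr V) (YE : Y = U' *m D s' *m ctr V').
Local Notation P := (ctr U *m U').
Local Notation Q := (ctr V *m V').

Lemma overlap_l : ctr U *m (Y - X) *m V' = P *m D s' - D s *m Q.
Proof.
rewrite XE YE mulmxBr mulmxBl !mulmxA Uo mul1mx; congr (_ - _).
by rewrite -mulmxA (V'o : ctr V' *m V' = _) mulmx1.
Qed.

Lemma overlap_r : ctr V *m ctr (Y - X) *m U' = Q *m ctr (D s') - ctr (D s) *m P.
Proof.
rewrite XE YE ctrB mulmxBr mulmxBl !ctrM !ctrK !mulmxA Vo mul1mx; congr (_ - _).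
by rewrite -mulmxA (U'o : ctr U' *m U' = _) mulmx1.
Qed.

Let P_le i j : modulus ((P *m D s' - D s *m Q) i j) <= fnorm (Y - X).
Proof.
rewrite -overlap_l (le_trans (le_modulus_fnorm _ _ _))//.
by rewrite fnorm_mulr ?orthogonal_mxC// fnorm_mull// ctrK orthogonal_mxC.
Qed.

Let Q_le i j : modulus ((Q *m ctr (D s') - ctr (D s) *m P) i j) <= fnorm (Y - X).
Proof.
rewrite -overlap_r (le_trans (le_modulus_fnorm _ _ _))//.
by rewrite fnorm_mulr ?orthogonal_mxC// fnorm_mull ?fnorm_ctr// ctrK orthogonal_mxC.
Qed.

Let PQ1 i j : (P *m D s' - D s *m Q) i (w j) =
  P i j * of_real (s' j 0) - of_real (s i 0) * Q (w i) (w j).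
Proof. by rewrite mxBE (mulmx_diag0 le_mn) (diag0_mulmx le_mn). Qed.

Let PQ2 i j : (Q *m ctr (D s') - ctr (D s) *m P) (w i) j =
  Q (w i) (w j) * of_real (s' j 0) - of_real (s i 0) * P i j.
Proof.
by rewrite mxBE (mulmx_ctr_diag0 le_mn) (ctr_diag0_mulmx le_mn).
Qed.

(** Adding the entries of [overlap_l] and [overlap_r] factors out s'_j - s_i; subtracting them, as
    in [overlap_diff], factors out s'_j + s_i. Each entry is bounded by the norm of an isometric
    image of Y - X, hence the factor 2. *)
Lemma overlap_sum i j :
  modulus (P i j + Q (w i) (w j)) * `|s' j 0 - s i 0| <= 2 * fnorm (Y - X).
Proof.
rewrite -(modulus_real (k := k)) -modulusM mulr_natl mulr2n.
have -> : (P i j + Q (w i) (w j)) * of_real (s' j 0 - s i 0) =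
    (P i j * of_real (s' j 0) - of_real (s i 0) * Q (w i) (w j)) +
    (Q (w i) (w j) * of_real (s' j 0) - of_real (s i 0) * P i j).
  by rewrite rmorphB /=; ring.
by rewrite (le_trans (modulusD _ _))// -PQ1 -PQ2 lerD.
Qed.

Lemma overlap_diff i j :
  modulus (P i j - Q (w i) (w j)) * `|s' j 0 + s i 0| <= 2 * fnorm (Y - X).
Proof.
rewrite -(modulus_real (k := k)) -modulusM mulr_natl mulr2n.
have -> : (P i j - Q (w i) (w j)) * of_real (s' j 0 + s i 0) =
    (P i j * of_real (s' j 0) - of_real (s i 0) * Q (w i) (w j)) -
    (Q (w i) (w j) * of_real (s' j 0) - of_real (s i 0) * P i j).
  by rewrite rmorphD /=; ring.
by rewrite (le_trans (modulusB _ _))// -PQ1 -PQ2 lerD.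
Qed.

(** In a column beyond the square part P D(s') vanishes, and D(s) Q remains alone. *)
Lemma overlap_ge i (j : 'I_n) : (m <= j)%N ->
  modulus (Q (w i) j) * `|s i 0| <= fnorm (Y - X).
Proof.
move=> mj; rewrite -(modulus_real (k := k)) -modulusM mulrC -modulusN.
rewrite (le_trans _ (P_le i j))//.
by rewrite mxBE mulmx_diag0_ge// (diag0_mulmx le_mn) add0r mulrC.
Qed.

Let P_le1 i j : modulus (P i j) <= 1.
Proof. by apply: modulus_orthogonal_le1; apply: orthogonal_mxM => //; exact: orthogonal_mx_ctr. Qed.

Let Q_le1 i j : modulus (Q i j) <= 1.
Proof. by apply: modulus_orthogonal_le1; apply: orthogonal_mxM => //; exact: orthogonal_mx_ctr. Qed.

(* 2 (P_ij f'_j - f_i Q_ij) = (P + Q)_ij (f'_j - f_i) +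
   (P - Q)_ij (f'_j + f_i), and the same identity holds for [s] in place of [f]. *)
Lemma svd_comparison (f f' : rvec R m) (C d : R) : 0 <= C -> 0 <= d ->
  (forall i j, `|f' j 0 - f i 0| <= C * (`|s' j 0 - s i 0| + d)) ->
  (forall i j, `|f' j 0 + f i 0| <= C * (`|s' j 0 + s i 0| + d)) ->
  (forall i, `|f i 0| <= C * (`|s i 0| + d)) ->
  fnorm (U' *m D f' *m ctr V' - U *m D f *m ctr V) <=
    (m * n)%:R * (2 * C * (fnorm (Y - X) + d)).
Proof.
move=> C0 d0 H1 H2 H3.
(* Isometric passage to the bases [U] and [V']. The slack [d] is 0 when a matrix is compared with
   itself, and |sigma Y - sigma X| when two matrices are compared. *)
have -> : fnorm (U' *m D f' *m ctr V' - U *m D f *m ctr V) =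
    fnorm (P *m D f' - D f *m Q).
  have -> : P *m D f' - D f *m Q =
      ctr U *m (U' *m D f' *m ctr V' - U *m D f *m ctr V) *m V'.
    rewrite mulmxBr mulmxBl !mulmxA Uo mul1mx -(mulmxA _ (ctr V') V').
    by rewrite (V'o : ctr V' *m V' = _) mulmx1.
  by rewrite fnorm_mulr ?orthogonal_mxC// fnorm_mull// ctrK orthogonal_mxC.
have h0 : 0 <= fnorm (Y - X) by exact: fnorm_ge0.
apply: fnorm_le_entries; first by rewrite !mulr_ge0 ?addr_ge0.
move=> i j; have [[{}j ->]|mj] := widen_ordVge le_mn j; last first.
  rewrite mxBE mulmx_diag0_ge// (diag0_mulmx le_mn) add0r modulusN modulusM.
  rewrite modulus_real.
  apply: (@le_trans _ _ (C * (`|s i 0| + d) * modulus (Q (w i) j))).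
    by rewrite ler_wpM2r ?modulus_ge0.
  rewrite -mulrA mulrDl; have := overlap_ge i mj; have := Q_le1 (w i) j.
  have := modulus_ge0 (Q (w i) j); set q := modulus _ => q0 q1 q2.
  rewrite mulrC in q2.
  rewrite mulrAC (@le_trans _ _ (C * (fnorm (Y - X) + d)))//.
    by rewrite ler_wpM2l// lerD// ler_piMr.
  have := mulr_ge0 C0 (addr_ge0 h0 d0); lra.
have -> : (P *m D f' - D f *m Q) i (w j) = of_real 2^-1 *
   ((P i j + Q (w i) (w j)) * of_real (f' j 0 - f i 0) +
    (P i j - Q (w i) (w j)) * of_real (f' j 0 + f i 0)).
  rewrite mxBE (mulmx_diag0 le_mn) (diag0_mulmx le_mn).
  by rewrite fmorphV rmorph_nat rmorphB rmorphD /=; field.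
rewrite modulusM modulus_real ger0_norm ?invr_ge0// ler_pdivrMl//.
rewrite (le_trans (modulusD _ _))// !modulusM !modulus_real.
have a1 := H1 i j; have a2 := H2 i j.
have b1 := overlap_sum i j; have b2 := overlap_diff i j.
have : modulus (P i j + Q (w i) (w j)) <= 2.
  by rewrite (le_trans (modulusD _ _))// (@natrD _ 1 1) lerD.
have : modulus (P i j - Q (w i) (w j)) <= 2.
  by rewrite (le_trans (modulusB _ _))// (@natrD _ 1 1) lerD.
move: b1 b2 a1 a2 (modulus_ge0 (P i j + Q (w i) (w j))) (modulus_ge0 (P i j - Q (w i) (w j))).
set p := modulus _; set q := modulus _ => b1 b2 a1 a2 p0 q0 q2 p2.
have c1 : p * `|f' j 0 - f i 0| <= C * (2 * fnorm (Y - X) + 2 * d).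
  apply: (le_trans (ler_wpM2l p0 a1)); rewrite mulrCA ler_wpM2l// mulrDr.
  by rewrite lerD// ler_wpM2r.
have c2 : q * `|f' j 0 + f i 0| <= C * (2 * fnorm (Y - X) + 2 * d).
  apply: (le_trans (ler_wpM2l q0 a2)); rewrite mulrCA ler_wpM2l// mulrDr.
  by rewrite lerD// ler_wpM2r.
apply: (le_trans (lerD c1 c2)); lra.
Qed.

End TwoDecompositions.

(** * Lipschitz continuity of the singular values *)

Section SigmaLipschitz.
Context {R : realType} {k : scalar_kind} {m n : nat}.
Hypothesis le_mn : (m <= n)%N.
Local Notation K := (scalars R k).
Local Notation w := (widen_ord le_mn).
Local Notation D := (@diag0 R k m n).

(* [i.+1] orthonormal rows do not fit in the first [i] columns. *)
Lemma orthogonal_corner (P : 'M[K]_m) (i : 'I_m) : orthogonal_mx P ->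
  1 <= \sum_(a < m | (a <= i)%N) \sum_(b < m | (i <= b)%N) modulus (P a b) ^+ 2.
Proof.
move=> Po.
have H1 : \sum_(a < m | (a <= i)%N) \sum_b modulus (P a b) ^+ 2 =
    1 + \sum_(a < m | (a < i)%N) (1 : R).
  rewrite (bigD1 i)//=; congr (_ + _); last first.
    apply: eq_big => [a|a _]; first by rewrite ltn_neqAle andbC.
    rewrite -(sum_modulus_col a (orthogonal_mx_ctr Po)).
    by apply: eq_bigr => b _; rewrite ctrE modulus_conj.
  rewrite -(sum_modulus_col i (orthogonal_mx_ctr Po)).
  by apply: eq_bigr => b _; rewrite ctrE modulus_conj.
have H2 : \sum_(a < m | (a <= i)%N) \sum_(b < m | (b < i)%N) modulus (P a b) ^+ 2 <=
    \sum_(b < m | (b < i)%N) (1 : R).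
  rewrite exchange_big /=; apply: ler_sum => b _.
  rewrite -(sum_modulus_col b Po) [leRHS](bigID (fun a : 'I_m => (a <= i)%N))/= lerDl.
  by apply: sumr_ge0 => a _; rewrite sqr_ge0.
have : \sum_(a < m | (a <= i)%N) \sum_b modulus (P a b) ^+ 2 =
    \sum_(a < m | (a <= i)%N) \sum_(b < m | (b < i)%N) modulus (P a b) ^+ 2 +
    \sum_(a < m | (a <= i)%N) \sum_(b < m | (i <= b)%N) modulus (P a b) ^+ 2.
  rewrite -big_split; apply: eq_bigr => a _.
  rewrite (bigID (fun b : 'I_m => (b < i)%N))/=; congr (_ + _).
  by apply: eq_bigl => b; rewrite -leqNgt.
lra.
Qed.

(** Let d be the left-hand side. If a <= i <= b, monotonicity gives sigma_a(X) - sigma_b(Y) >= d,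
    and the overlap inequalities yield d |P_ab| <= 2 |Y - X|. Over this corner the |P_ab|^2 sum to
    at least 1, and there are at most m^2 of them. *)
Lemma sigma_coord_le (X Y : 'M[K]_(m, n)) U U' V V' i :
  svd_pair X U V -> svd_pair Y U' V' ->
  sigma X i 0 - sigma Y i 0 <= 2 * m%:R * fnorm (Y - X).
Proof.
have sumE (h : R) : \sum_(a < m) \sum_(b < m) (2 * h) ^+ 2 = (2 * m%:R * h) ^+ 2.
  have sumc (c : R) : \sum_(a < m) c = c * m%:R.
    by rewrite sumr_const card_ord mulr_natr.
  rewrite (eq_bigr (fun=> (2 * h) ^+ 2 * m%:R)) => [|a _]; last exact: sumc.
  by rewrite sumc; move: m%:R => c; ring.
move=> XUV YUV; have [sX sX0 _] := svd_singular_values le_mn XUV.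
have [sY sY0 _] := svd_singular_values le_mn YUV.
move: XUV YUV => [Uo Vo XE] [U'o V'o YE].
have h0 : 0 <= fnorm (Y - X) by exact: fnorm_ge0.
have [d0|d0] := lerP (sigma X i 0 - sigma Y i 0) 0.
  by rewrite (le_trans d0)// !mulr_ge0.
set d := _ - _ in d0 *; pose P := ctr U *m U'.
rewrite -(@ler_pXn2r _ 2%N)// ?nnegrE ?mulr_ge0 ?(ltW d0)//.
have Po : orthogonal_mx P by apply: orthogonal_mxM => //; exact: orthogonal_mx_ctr.
have /(ler_wpM2l (sqr_ge0 d)) := orthogonal_corner i Po; rewrite mulr1 => /le_trans; apply.
have H (a b : 'I_m) : (a <= i)%N -> (i <= b)%N ->
    d ^+ 2 * modulus (P a b) ^+ 2 <= (2 * fnorm (Y - X)) ^+ 2.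
  move=> ai ib; rewrite -exprMn ler_pXn2r// ?nnegrE ?mulr_ge0 ?modulus_ge0 ?(ltW d0)//.
  have := overlap_sum le_mn Uo U'o Vo V'o XE YE a b.
  have := overlap_diff le_mn Uo U'o Vo V'o XE YE a b.
  rewrite -/P; set Q := (ctr V *m V') _ _.
  have dab : d <= sigma X a 0 - sigma Y b 0 by apply: lerB; [exact: sX|exact: sY].
  have sYb := sY0 b.
  rewrite [`|_ + _|]ger0_norm ?addr_ge0// distrC [`|_ - _|]ger0_norm ?(le_trans (ltW d0))//.
  move=> h1 h2.
  have {}h1 : modulus (P a b - Q) * d <= 2 * fnorm (Y - X).
    by rewrite (le_trans _ h1)// ler_wpM2l ?modulus_ge0//; lra.
  have {}h2 : modulus (P a b + Q) * d <= 2 * fnorm (Y - X).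
    by rewrite (le_trans _ h2)// ler_wpM2l ?modulus_ge0//; lra.
  have h3 : 2 * modulus (P a b) <= modulus (P a b + Q) + modulus (P a b - Q).
    have -> : 2 * modulus (P a b) = modulus (of_real 2 * P a b).
      by rewrite modulusM modulus_real ger0_norm.
    have -> : of_real 2 * P a b = (P a b + Q) + (P a b - Q).
      by rewrite rmorph_nat; ring.
    exact: modulusD.
  have := ler_wpM2l (ltW d0) h3; lra.
rewrite mulr_sumr.
apply: (@le_trans _ _ (\sum_(a < m) \sum_(b < m) (2 * fnorm (Y - X)) ^+ 2)).
  rewrite [leRHS](bigID (fun a : 'I_m => (a <= i)%N))/= -[leLHS]addr0 lerD//; last first.
    by do 2!(apply: sumr_ge0 => ? _); rewrite sqr_ge0.
  apply: ler_sum => a ai; rewrite mulr_sumr.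
  rewrite [leRHS](bigID (fun b : 'I_m => (i <= b)%N))/= -[leLHS]addr0 lerD//; last first.
    by apply: sumr_ge0 => ? _; rewrite sqr_ge0.
  by apply: ler_sum => b ib; exact: H.
by rewrite sumE.
Qed.

Lemma sigma_lipschitz (X Y : 'M[K]_(m, n)) U U' V V' :
  svd_pair X U V -> svd_pair Y U' V' ->
  `|sigma X - sigma Y| <= m%:R * (2 * m%:R * fnorm (X - Y)).
Proof.
move=> XE YE; apply: rvec_norm_le => [|i]; first by rewrite !mulr_ge0 ?fnorm_ge0.
have := sigma_coord_le i XE YE; have := sigma_coord_le i YE XE.
have -> : fnorm (Y - X) = fnorm (X - Y) by rewrite -fnormN opprB.
rewrite !mxE; move: (sigma X i 0) (sigma Y i 0) (_ * _) => a b c H1 H2.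
by rewrite ler_norml H2 andbT lerNl opprB.
Qed.

End SigmaLipschitz.

(** * Lipschitz continuity of spectral operators *)

Section SignedPermutations.
Context {R : realType} {m : nat}.
Implicit Types (e : 'I_m -> R) (p : {perm 'I_m}) (x y : rvec R m).

Lemma sign_norm (a : R) : a = 1 \/ a = -1 -> `|a| = 1.
Proof. by move=> [->|->]; rewrite ?normrN normr1. Qed.

Lemma sign_mulK (a b : R) : a = 1 \/ a = -1 -> a * (a * b) = b.
Proof. by move=> [->|->]; rewrite ?mul1r// !mulN1r opprK. Qed.

Definition sperm_mx e p : 'M[R]_m := \matrix_(i, j) if p i == j then e i else 0.

Lemma sperm_mxP e p : (forall i, e i = 1 \/ e i = -1) -> signed_perm_mx (sperm_mx e p).
Proof.
move=> e1; have e0 i : e i != 0.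
  by rewrite -normr_eq0 (sign_norm (e1 i)) oner_eq0.
split=> [i j|i|j].
- rewrite mxE; case: ifP => _; last exact: Or31.
  by case: (e1 i) => ->; [exact: Or32|exact: Or33].
- exists (p i); split; first by rewrite mxE eqxx e0.
  by move=> j; rewrite mxE; case: (p i =P j) => // _; rewrite eqxx.
- exists (perm_inv p j); split; first by rewrite mxE permKV eqxx e0.
  by move=> i; rewrite mxE; case: (p i =P j) => [<-|_]; rewrite ?permK ?eqxx.
Qed.

Lemma mul_sperm_mx e p x : sperm_mx e p *m x = sact e p x.
Proof.
apply/matrixP => i j; rewrite ord1 !mxE (bigD1 (p i))//= mxE eqxx big1 ?addr0//.
by move=> l lp; rewrite mxE eq_sym (negPf lp) mul0r.
Qed.

Lemma sactD e p x y : sact e p (x + y) = sact e p x + sact e p y.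
Proof. by apply/matrixP => i j; rewrite !mxE mulrDr. Qed.

Lemma sactN e p x : sact e p (- x) = - sact e p x.
Proof. by apply/matrixP => i j; rewrite !mxE mulrN. Qed.

Lemma sactZ e p (a : R) x : sact e p (a *: x) = a *: sact e p x.
Proof. by apply/matrixP => i j; rewrite !mxE mulrCA. Qed.

Lemma sact_norm e p x : (forall i, e i = 1 \/ e i = -1) -> `|sact e p x| = `|x|.
Proof.
move=> e1; apply/eqP; rewrite -(@eqrXn2 _ 2%N)// !sqr_rvec_norm.
rewrite [X in _ == X](reindex_inj (@perm_inj _ p)) /=; apply/eqP/eq_bigr => i _.
by rewrite mxE exprMn -(real_normK (num_real (e i))) (sign_norm (e1 i)) expr1n mul1r.
Qed.

Lemma sym_sact (g : rvec R m -> rvec R m) (A : set (rvec R m)) e p x :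
  absolutely_symmetric g A -> A x -> (forall i, e i = 1 \/ e i = -1) ->
  g (sact e p x) = sact e p (g x).
Proof. by move=> gA Ax e1; rewrite -!mul_sperm_mx gA//; exact: sperm_mxP. Qed.

(* When [i = j] and [a = -1], this flips the sign of the coordinate [i]. *)
Definition sswap (a : R) (i j : 'I_m) : rvec R m -> rvec R m :=
  sact (fun l => if (l == i) || (l == j) then a else 1) (tperm i j).

Lemma sswap_sign (a : R) (i j l : 'I_m) : a = 1 \/ a = -1 ->
  (if (l == i) || (l == j) then a else 1) = 1 \/ (if (l == i) || (l == j) then a else 1) = -1.
Proof. by move=> ?; case: ifP => // _; left. Qed.

Lemma sswapL (a : R) i j x : sswap a i j x i 0 = a * x j 0.
Proof. by rewrite mxE eqxx tpermL. Qed.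

Lemma sswapR (a : R) i j x : sswap a i j x j 0 = a * x i 0.
Proof. by rewrite mxE eqxx orbT tpermR. Qed.

Lemma sswapD (a : R) i j l x : l != i -> l != j -> sswap a i j x l 0 = x l 0.
Proof. by move=> li lj; rewrite mxE (negPf li) (negPf lj) tpermD 1?eq_sym// mul1r. Qed.

Lemma sswap_fix (a : R) i j x : a = 1 \/ a = -1 -> x i 0 = a * x j 0 ->
  sswap a i j x = x.
Proof.
move=> a1 xij; apply/matrixP => l c; rewrite {c}ord1.
have [->|li] := eqVneq l i; first by rewrite sswapL.
have [->|lj] := eqVneq l j; first by rewrite sswapR xij sign_mulK.
exact: sswapD.
Qed.

Lemma sym_sswap (g : rvec R m -> rvec R m) (A : set (rvec R m)) (a : R) i j x :
  absolutely_symmetric g A -> A x -> a = 1 \/ a = -1 ->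
  g (sswap a i j x) = sswap a i j (g x).
Proof. by move=> gA Ax a1; apply: (sym_sact _ gA Ax) => l; exact: sswap_sign. Qed.

(** [x] is fixed by a signed permutation, hence so is [g x]. With i = j and a = -1 this makes [g x]
    vanish where [x] does. *)
Lemma sym_fix (g : rvec R m -> rvec R m) (A : set (rvec R m)) (a : R) i j x :
  absolutely_symmetric g A -> A x -> a = 1 \/ a = -1 ->
  x i 0 = a * x j 0 -> g x i 0 = a * g x j 0.
Proof.
by move=> gA Ax a1 xij; rewrite -{1}(sswap_fix a1 xij) (sym_sswap _ _ gA Ax a1) sswapL.
Qed.

Lemma sym_fix0 (g : rvec R m -> rvec R m) (A : set (rvec R m)) i x :
  absolutely_symmetric g A -> A x -> x i 0 = 0 -> g x i 0 = 0.
Proof.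
move=> gA Ax x0; have := @sym_fix g A (-1) i i x gA Ax (or_intror erefl).
rewrite x0 mulr0 => /(_ erefl); lra.
Qed.

(** On a finite index set an inclusion of zero sets is already a linear bound. This turns the exact
    relations given by symmetry into hypotheses of [svd_comparison]. *)
Lemma finite_ratio_bound (I : finType) (a b : I -> R) : (forall i, b i = 0 -> a i = 0) ->
  exists2 C, 0 <= C & forall i, `|a i| <= C * `|b i|.
Proof.
move=> ab; exists (\sum_i `|a i| / `|b i|).
  by apply: sumr_ge0 => i _; rewrite divr_ge0.
move=> i; have [b0|b0] := eqVneq (b i) 0.
  by rewrite ab// normr0 mulr_ge0// sumr_ge0// => j _; rewrite divr_ge0.
rewrite -ler_pdivrMr ?normr_gt0// (bigD1 i)//= lerDl.
by apply: sumr_ge0 => j _; rewrite divr_ge0.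
Qed.

(** Finitely many numbers: [finite_ratio_bound], applied to the indicator of f != 0, bounds the
    nonzero ones away from 0. *)
Lemma sign_gap x : exists2 d : R, 0 < d & forall a i j, a = 1 \/ a = -1 ->
  x i 0 = a * x j 0 \/ d <= `|x i 0 - a * x j 0|.
Proof.
pose f (t : 'I_m * 'I_m * bool) := x t.1.1 0 - (-1) ^+ t.2 * x t.1.2 0.
have [|C C0 HC] := @finite_ratio_bound _ (fun t => (f t != 0)%:R) f.
  by move=> t ->; rewrite eqxx.
exists (C + 1)^-1 => [|a i j a1]; first by rewrite invr_gt0 ltr_wpDl.
have [b ->] : exists b : bool, a = (-1) ^+ b.
  by case: a1 => ->; [exists false|exists true]; rewrite ?expr0 ?expr1.
have := HC (i, j, b); rewrite /f /=.
case: eqVneq => [/eqP|f0]; first by rewrite subr_eq0 => /eqP; left.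
rewrite /= normr1 => H; right.
rewrite -div1r ler_pdivrMr ?ltr_wpDl// (le_trans H)// mulrC ler_wpM2l//.
by rewrite lerDl.
Qed.

(** If x_i = a x_j, then [sswap] fixes x, keeps y near x and moves only its coordinates i and j, by
    |y_i - a y_j|; the Lipschitz bound applies to y and its image. Otherwise |y_i - a y_j| stays
    away from 0 near x, and boundedness of [g] suffices. *)
Lemma sym_lipschitz (g : rvec R m -> rvec R m) (A : set (rvec R m)) (x : rvec R m) (L d : R) :
  absolutely_symmetric g A -> 0 <= L -> 0 < d ->
  (forall y, `|y - x| < d -> A y) ->
  (forall y z, `|y - x| < d -> `|z - x| < d -> `|g y - g z| <= L * `|y - z|) ->
  exists C r, [/\ 0 <= C, 0 < r, r <= d & forall y a i j, `|y - x| < r -> a = 1 \/ a = -1 ->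
    `|g y i 0 - a * g y j 0| <= C * `|y i 0 - a * y j 0|].
Proof.
move=> gA L0 d0 dA gL; have [e e0 He] := sign_gap x.
(* [M] bounds the coordinates of [g] on the ball, so the left side is at most 2 M. Coordinates move
   by at most e / 4, which leaves |y_i - a y_j| >= e / 2; the quotient is [C2]. *)
pose M := `|g x| + L * d.
have M0 : 0 <= M by rewrite addr_ge0 ?mulr_ge0// ltW.
pose C2 := 4 * M / e.
have C20 : 0 <= C2 by rewrite divr_ge0 ?mulr_ge0// ltW.
exists (L * m%:R + C2), (Num.min d (e / 4)); split.
- by apply: addr_ge0 => //; exact: mulr_ge0.
- by rewrite lt_min d0 divr_gt0.
- by rewrite ge_min lexx.
move=> y a i j; rewrite lt_min => /andP[yd ye] a1.
have [xij|xij] := He a i j a1.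
  apply: (@le_trans _ _ (L * m%:R * `|y i 0 - a * y j 0|)); last first.
    by rewrite ler_wpM2r// lerDl.
  have Ay : A y by exact: dA.
  have yx : `|sswap a i j y - x| < d.
    rewrite -{1}(sswap_fix a1 xij) -sactN -sactD sact_norm// => l.
    exact: sswap_sign.
  have := gL _ _ yd yx; rewrite (sym_sswap _ _ gA Ay a1) => H.
  have := le_rvec_norm (g y - sswap a i j (g y)) i.
  rewrite mxE [X in _ + X]mxE sswapL => /le_trans; apply; apply: (le_trans H).
  rewrite -mulrA ler_wpM2l//; apply: rvec_norm_le => // l.
  rewrite mxE [X in _ + X]mxE.
  have [->|li] := eqVneq l i; first by rewrite sswapL.
  have [->|lj] := eqVneq l j; last by rewrite sswapD// subrr normr0.
  rewrite sswapR -[X in `|X - _|](sign_mulK _ a1) -mulrBr normrM (sign_norm a1) mul1r.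
  by rewrite distrC.
apply: (@le_trans _ _ (C2 * `|y i 0 - a * y j 0|)); last first.
  by rewrite ler_wpM2r// lerDr mulr_ge0.
have gyM l : `|g y l 0| <= M.
  apply: (le_trans (le_rvec_norm _ _)); rewrite -(subrK (g x) (g y)).
  rewrite (le_trans (ler_normD _ _))// addrC lerD2l (le_trans (gL _ _ yd _))//.
    by rewrite subrr normr0.
  by rewrite ler_wpM2l// ltW.
apply: (@le_trans _ _ (2 * M)).
  rewrite (le_trans (ler_normB _ _))// normrM (sign_norm a1) mul1r mulrDl mul1r.
  by rewrite lerD.
have yxl l : `|y l 0 - x l 0| <= e / 4.
  by have := le_rvec_norm (y - x) l; rewrite !mxE => /le_trans; apply; exact: ltW.
have : e / 2 <= `|y i 0 - a * y j 0|.
  have : `|x i 0 - a * x j 0| <= `|y i 0 - a * y j 0| + (`|y i 0 - x i 0| + `|y j 0 - x j 0|).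
    have -> : x i 0 - a * x j 0 = (y i 0 - a * y j 0) -
        ((y i 0 - x i 0) - a * (y j 0 - x j 0)) by ring.
    rewrite (le_trans (ler_normB _ _))// lerD2l (le_trans (ler_normB _ _))//.
    by rewrite normrM (sign_norm a1) mul1r.
  have := yxl i; have := yxl j; move: xij; lra.
move=> /(ler_wpM2l C20); apply: le_trans.
by rewrite /C2 le_eqVlt; apply/orP; left; apply/eqP; field; rewrite gt_eqF.
Qed.

(** Reads the case i = j, a = -1 of [sym_lipschitz] as a bound of each coordinate of the value by
    that of the argument. *)
Lemma double_bound (C x y : R) : `|x - -1 * x| <= C * `|y - -1 * y| -> `|x| <= C * `|y|.
Proof.
have E z : `|z - -1 * z| = 2 * `|z| by rewrite -[2]ger0_norm// -normrM; congr `|_|; ring.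
by rewrite !E; lra.
Qed.

(** From coordinates of one vector to coordinates of two: [u], [h] are a coordinate of the first
    vector and of its image, [t], [g] the same coordinate for the second vector, at distance at most
    [d]. *)
Lemma change_point_bound (C L d a f g h s t u : R) : 0 <= C -> 0 <= L -> `|a| = 1 ->
  `|h - g| <= L * d -> `|u - t| <= d -> `|f - a * h| <= C * `|s - a * u| ->
  `|f - a * g| <= (C + L) * (`|s - a * t| + d).
Proof.
move=> C0 L0 a1 hg ut fh.
have -> : f - a * g = (f - a * h) + a * (h - g) by ring.
rewrite (le_trans (ler_normD _ _))// normrM a1 mul1r.
have : `|s - a * u| <= `|s - a * t| + d.
  have -> : s - a * u = (s - a * t) - a * (u - t) by ring.
  by rewrite (le_trans (ler_normB _ _))// normrM a1 mul1r lerD2l.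
move=> /(ler_wpM2l C0); have := mulr_ge0 L0 (normr_ge0 (s - a * t)); lra.
Qed.

End SignedPermutations.

Section SpectralOperatorLipschitz.
Context {R : realType} {k : scalar_kind} {m n : nat}.
Hypothesis le_mn : (m <= n)%N.
Local Notation K := (scalars R k).
Local Notation D := (@diag0 R k m n).
Variables (N : set (mat R k m n)) (N_open : open N).
Variables (g : rvec R m -> rvec R m) (sigmaN : set (rvec R m)) (sigmaN_open : open sigmaN).
Hypothesis sub_sigmaN : [set sigma X | X in N] `<=` sigmaN.
Hypothesis g_sym : absolutely_symmetric g sigmaN.
Variables (G : mat R k m n -> mat R k m n) (G_spec : spectral_operator g N G).

Let sigmaN_sigma X : N X -> sigmaN (sigma X).
Proof. by move=> NX; apply: sub_sigmaN; exists X. Qed.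

(** [svd_comparison] of X with itself and d = 0 forces equality. Its linear bounds need only zero
    sets: [s] is a signed permutation of [sigma X], so coincidences up to sign between their
    coordinates persist after [g]. No order or sign of [s] is required. *)
Lemma spectral_operatorE (X : 'M[K]_(m, n)) (U : 'M[K]_m) (V : 'M[K]_n) s :
  N X -> orthogonal_mx U -> orthogonal_mx V -> X = U *m D s *m ctr V ->
  G X = U *m D (g s) *m ctr V.
Proof.
move=> NX Uo Vo XE; have [U0 [V0 [[U0o V0o X0E] ->]]] := G_spec NX.
have [e [p [t [e1 st t1 t0]]]] := signed_sort s.
have sX : sigma X = t.
  exact: (sigma_svd le_mn Uo Vo (etrans XE (congr1 (fun s => U *m D s *m ctr V) st)) e1 t1 t0).
have At : sigmaN t by rewrite -sX; exact: sigmaN_sigma.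
have gsE : g s = sact e p (g t) by rewrite st (sym_sact _ g_sym At e1).
have siE i : s i 0 = e i * t (p i) 0 by rewrite st mxE.
have gsiE i : g s i 0 = e i * g t (p i) 0 by rewrite gsE mxE.
have eN1 i : - e i = 1 \/ - e i = -1.
  by case: (e1 i) => ->; rewrite ?opprK; [right|left].
rewrite sX in X0E *.
have [|C1 C10 H1] := @finite_ratio_bound R _ (fun ij : 'I_m * 'I_m => g t ij.2 0 - g s ij.1 0)
  (fun ij => t ij.2 0 - s ij.1 0).
  move=> [i j] /= /eqP; rewrite subr_eq0 siE => /eqP tij; apply/eqP; rewrite subr_eq0 gsiE.
  by apply/eqP; exact: (sym_fix g_sym At (e1 i) tij).
have [|C2 C20 H2] := @finite_ratio_bound R _ (fun ij : 'I_m * 'I_m => g t ij.2 0 + g s ij.1 0)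
  (fun ij => t ij.2 0 + s ij.1 0).
  move=> [i j] /= /eqP; rewrite addr_eq0 siE -mulNr => /eqP tij; apply/eqP.
  by rewrite addr_eq0 gsiE -mulNr (sym_fix g_sym At (eN1 i) tij).
have [|C3 C30 H3] := @finite_ratio_bound R _ (fun i => g s i 0) (fun i => s i 0).
  move=> i; rewrite siE gsiE => /eqP; rewrite mulf_eq0 => /orP[/eqP->|/eqP tp].
    by rewrite mul0r.
  by rewrite (sym_fix0 g_sym At tp) mulr0.
have CC : 0 <= C1 + C2 + C3 by rewrite !addr_ge0.
have := @svd_comparison R k m n le_mn U U0 V V0 s t Uo U0o Vo V0o X X XE X0E
  (g s) (g t) (C1 + C2 + C3) 0 CC (lexx _).
have -> : fnorm (X - X) + 0 = 0 by rewrite subrr fnorm0 addr0.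
rewrite !mulr0 => H; apply/eqP; rewrite -subr_eq0 -normr_le0; apply: H.
- move=> i j; rewrite addr0; apply: (le_trans (H1 (i, j))).
  by rewrite ler_wpM2r// -addrA lerDl addr_ge0.
- move=> i j; rewrite addr0; apply: (le_trans (H2 (i, j))).
  by rewrite ler_wpM2r// addrAC lerDr addr_ge0.
- move=> i; rewrite addr0; apply: (le_trans (H3 i)).
  by rewrite ler_wpM2r// lerDr addr_ge0.
Qed.

Lemma spectral_operator_lipschitz Xbar : N Xbar ->
  locally_lipschitz_near g (sigma Xbar) -> locally_lipschitz_near G Xbar.
Proof.
move=> NX /locally_lipschitzP[L [d1 [L0 d10 gL]]].
have /near_distP[d2 d20 Hd2] : \forall y \near sigma Xbar, sigmaN y.
  by apply: open_nbhs_nbhs; split=> //; exact: sigmaN_sigma.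
have /near_distP[d3 d30 Hd3] : \forall y \near Xbar, N y by apply: open_nbhs_nbhs.
have d12 : 0 < Num.min d1 d2 by rewrite lt_min d10.
have [||C [r [C0 r0 rd HC]]] := sym_lipschitz (x := sigma Xbar) g_sym L0 d12.
- by move=> y; rewrite lt_min => /andP[_]; exact: Hd2.
- move=> y z; rewrite !lt_min => /andP[y1 _] /andP[z1 _]; exact: gL.
have rd1 : r <= d1 by rewrite (le_trans rd)// ge_min lexx.
pose c := m%:R * (2 * m%:R) : R.
have c0 : 0 <= c by rewrite !mulr_ge0.
have sc (X Y : mat R k m n) : N X -> N Y -> `|sigma X - sigma Y| <= c * `|X - Y|.
  move=> /G_spec[U [V [XE _]]] /G_spec[U' [V' [YE _]]].
  by have := sigma_lipschitz le_mn XE YE; rewrite mulrA; exact.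
apply/locally_lipschitzP.
exists ((m * n)%:R * (2 * (C + L) * (1 + c))), (Num.min d3 (r / (c + 1))).
have c1 : 0 < c + 1 by rewrite ltr_wpDl.
split.
- by apply: mulr_ge0 => //; apply: mulr_ge0; rewrite ?mulr_ge0 ?addr_ge0.
- by rewrite lt_min d30 divr_gt0.
have Nr Z : `|Z - Xbar| < Num.min d3 (r / (c + 1)) -> N Z /\ `|sigma Z - sigma Xbar| < r.
  rewrite lt_min => /andP[/Hd3 NZ Zr]; split=> //.
  apply: (le_lt_trans (sc _ _ NZ NX)); apply: (@le_lt_trans _ _ ((c + 1) * `|Z - Xbar|)).
    by rewrite ler_wpM2r// lerDl.
  by rewrite mulrC -ltr_pdivlMr.
move=> Y X /Nr[NY Yr] /Nr[N'X Xr].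
have [U [V [[Uo Vo XE] GX]]] := G_spec N'X; have [U' [V' [[U'o V'o YE] GY]]] := G_spec NY.
have gXY : `|g (sigma Y) - g (sigma X)| <= L * `|sigma Y - sigma X|.
  by apply: gL; [exact: lt_le_trans Yr rd1|exact: lt_le_trans Xr rd1].
have gXYi i : `|g (sigma Y) i 0 - g (sigma X) i 0| <= L * `|sigma Y - sigma X|.
  by apply: le_trans gXY; have := le_rvec_norm (g (sigma Y) - g (sigma X)) i; rewrite !mxE.
have sXYi i : `|sigma Y i 0 - sigma X i 0| <= `|sigma Y - sigma X|.
  by have := le_rvec_norm (sigma Y - sigma X) i; rewrite !mxE.
have LC : 0 <= C + L by rewrite addr_ge0.
rewrite GX GY.
(* [sym_lipschitz] handles two coordinates of [sigma Y]; coordinate i is then moved to [sigma X]. *)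
have H a i j : a = 1 \/ a = -1 -> `|g (sigma Y) j 0 - a * g (sigma X) i 0| <=
    (C + L) * (`|sigma Y j 0 - a * sigma X i 0| + `|sigma Y - sigma X|).
  move=> a1.
  exact: (change_point_bound C0 L0 (sign_norm a1) (gXYi i) (sXYi i) (HC (sigma Y) a j i Yr a1)).
have := @svd_comparison R k m n le_mn U U' V V' (sigma X) (sigma Y) Uo U'o Vo V'o X Y XE YE
  (g (sigma X)) (g (sigma Y)) (C + L) `|sigma Y - sigma X| LC (normr_ge0 _).
rewrite /fnorm => /(_ _ _ _)/le_trans; apply.
- by move=> i j; have := H 1 i j (or_introl erefl); rewrite !mul1r.
- by move=> i j; have := H (-1) i j (or_intror erefl); rewrite !mulN1r !opprK.
- move=> i; have := HC (sigma X) (-1) i i Xr (or_intror erefl).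
  move=> /double_bound/le_trans; apply; apply: ler_pM => //; rewrite ?lerDl//.
rewrite -!mulrA ler_wpM2l// ler_wpM2l// ler_wpM2l// mulrDl mul1r lerD2l.
exact: sc.
Qed.

End SpectralOperatorLipschitz.

(** * Derivatives along orbits *)

Section BigO.
Context {R : realType} {k : scalar_kind} {T : Type}.
Local Notation K := (scalars R k).
Variables (A : T -> Prop) (h : T -> R).

(** A bound uniform over [A] rather than a limit: the parameter will include the factors of a
    decomposition, which do not depend continuously on the matrix. *)
Definition matO (e : nat) {p q} (F : T -> 'M[K]_(p, q)) :=
  exists C, 0 <= C /\ forall t, A t -> fnorm (F t) <= C * h t ^+ e.

Hypothesis h01 : forall t, A t -> 0 <= h t <= 1.

Let hX_ge0 t e : A t -> 0 <= h t ^+ e.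
Proof. by move=> /h01/andP[? _]; rewrite exprn_ge0. Qed.

Lemma matO_ext e p q (F F' : T -> 'M[K]_(p, q)) :
  (forall t, A t -> F t = F' t) -> matO e F -> matO e F'.
Proof. by move=> FF' [C [C0 HC]]; exists C; split=> // t At; rewrite -FF'// HC. Qed.

Lemma matOD e p q (F F' : T -> 'M[K]_(p, q)) :
  matO e F -> matO e F' -> matO e (fun t => F t + F' t).
Proof.
move=> [C [C0 HC]] [C' [C'0 HC']]; exists (C + C'); split; first exact: addr_ge0.
by move=> t At; rewrite (le_trans (fnormD _ _))// mulrDl lerD ?HC ?HC'.
Qed.

Lemma matON e p q (F : T -> 'M[K]_(p, q)) : matO e F -> matO e (fun t => - F t).
Proof. by move=> [C [C0 HC]]; exists C; split=> // t At; rewrite fnormN HC. Qed.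

Lemma matOB e p q (F F' : T -> 'M[K]_(p, q)) :
  matO e F -> matO e F' -> matO e (fun t => F t - F' t).
Proof. by move=> FO F'O; apply: matOD => //; exact: matON. Qed.

Lemma matO_ctr e p q (F : T -> 'M[K]_(p, q)) : matO e F -> matO e (fun t => ctr (F t)).
Proof. by move=> [C [C0 HC]]; exists C; split=> // t At; rewrite fnorm_ctr HC. Qed.

Lemma matOM e e' p q r (F : T -> 'M[K]_(p, q)) (F' : T -> 'M[K]_(q, r)) :
  matO e F -> matO e' F' -> matO (e + e') (fun t => F t *m F' t).
Proof.
move=> [C [C0 HC]] [C' [C'0 HC']]; exists ((p * r * q)%:R * (C * C')).
split; first by rewrite !mulr_ge0.
move=> t At; rewrite (le_trans (fnormM _ _))// exprD -mulrA ler_wpM2l//.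
by rewrite mulrACA ler_pM ?fnorm_ge0 ?HC ?HC'.
Qed.

Lemma matO_cst p q (M : 'M[K]_(p, q)) : matO 0 (fun=> M).
Proof. by exists (fnorm M); rewrite fnorm_ge0; split=> // t _; rewrite expr0 mulr1. Qed.

Lemma matO_orthogonal p (F : T -> 'M[K]_p) :
  (forall t, A t -> orthogonal_mx (F t)) -> matO 0 F.
Proof.
move=> Fo; exists ((p * p)%:R * 1); split; first by rewrite mulr_ge0.
move=> t At; rewrite expr0 mulr1; apply: fnorm_le_entries => // i j.
exact: modulus_orthogonal_le1 (Fo _ At).
Qed.

Lemma matOW e e' p q (F : T -> 'M[K]_(p, q)) : (e' <= e)%N -> matO e F -> matO e' F.
Proof.
move=> ee' [C [C0 HC]]; exists C; split=> // t At; rewrite (le_trans (HC _ At))//.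
have /andP[h0 h1] := h01 At.
by rewrite ler_wpM2l// ler_wiXn2l.
Qed.

Lemma matOZ e p q (a : R) (F : T -> 'M[K]_(p, q)) :
  matO e F -> matO e (fun t => of_real a *: F t).
Proof.
move=> [C [C0 HC]]; exists (`|a| * C); split; first by rewrite mulr_ge0.
by move=> t At; rewrite fnormZ -mulrA ler_wpM2l ?HC.
Qed.

Lemma matO_entries e p q (F : T -> 'M[K]_(p, q)) :
  (forall i j, exists C, forall t, A t -> modulus (F t i j) <= C * h t ^+ e) -> matO e F.
Proof.
move=> H; have /choice[C HC] : forall i, exists C : 'I_q -> R,
    forall j t, A t -> modulus (F t i j) <= C j * h t ^+ e.
  by move=> i; have /choice[C HC] := H i; exists C.
pose M := \sum_i \sum_j `|C i j|.
have M0 : 0 <= M by do 2!(apply: sumr_ge0 => ? _).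
exists ((p * q)%:R * M); split; first by rewrite mulr_ge0.
move=> t At; rewrite -mulrA; apply: fnorm_le_entries.
  by rewrite mulr_ge0// hX_ge0.
move=> i j; apply: (le_trans (HC i j t At)); rewrite ler_wpM2r ?hX_ge0//.
apply: (le_trans (ler_norm _)); rewrite /M (bigD1 i)//= (bigD1 j)//= -addrA lerDl.
by rewrite addr_ge0//; [|apply: sumr_ge0 => ? _]; apply: sumr_ge0.
Qed.

Lemma matO_entry e p q (F : T -> 'M[K]_(p, q)) i j : matO e F ->
  exists C, forall t, A t -> modulus (F t i j) <= C * h t ^+ e.
Proof.
move=> [C [C0 HC]]; exists C => t At; exact: le_trans (le_modulus_fnorm _ _ _) (HC _ At).
Qed.

End BigO.

(** * Cayley transforms of skew matrices *)

Section Cayley.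
Context {R : realType} {k : scalar_kind} {p : nat}.
Local Notation K := (scalars R k).
Variable A : 'M[K]_p.
Hypothesis A_skew : ctr A = - A.

Let dot_skew q (Z : 'M[K]_(p, q)) : mat_dot Z (A *m Z) = 0.
Proof.
have : mat_dot Z (A *m Z) = - mat_dot Z (A *m Z).
  by rewrite {1}mat_dotC /mat_dot ctrM A_skew mulmxN mulNmx -mulmxA !raddfN.
lra.
Qed.

(** A Z is orthogonal to Z for the real inner product, so |Z - A Z|^2 = |Z|^2 + |A Z|^2. Hence 1 - A
    is injective and its inverse does not increase norms. *)
Let fnorm_shift q (Z : 'M[K]_(p, q)) : fnorm Z <= fnorm (Z - A *m Z).
Proof.
rewrite -(@ler_pXn2r _ 2%N)// ?nnegrE ?fnorm_ge0// !sqr_fnorm_dot.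
set Y := A *m Z.
have dotNl (Z1 Z2 : 'M[K]_(p, q)) : mat_dot (- Z1) Z2 = - mat_dot Z1 Z2.
  by rewrite /mat_dot ctrN mulNmx !raddfN.
have dotNr (Z1 Z2 : 'M[K]_(p, q)) : mat_dot Z1 (- Z2) = - mat_dot Z1 Z2.
  by rewrite mat_dotC dotNl mat_dotC.
have -> : mat_dot (Z - Y) (Z - Y) = mat_dot Z Z + mat_dot Y Y - 2 * mat_dot Z Y.
  rewrite mat_dotD [mat_dot Z (Z - Y)]mat_dotC [mat_dot (- Y) (Z - Y)]mat_dotC.
  by rewrite !mat_dotD !dotNr !dotNl (mat_dotC Y Z); ring.
by rewrite dot_skew mulr0 subr0 lerDl mat_dot_ge0.
Qed.

Lemma skew_shift_unit : 1%:M - A \in unitmx.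
Proof.
rewrite unitmxE unitfE -det_tr; apply/negP => /det0P[v v0 vA].
have : fnorm v^T <= 0.
  rewrite (le_trans (fnorm_shift _))// -[X in X - _]mul1mx -mulmxBl.
  by rewrite -[_ *m _]trmxK trmx_mul trmxK vA trmx0 fnorm0.
move=> vT; have {}vT : v^T = 0 by apply/eqP; rewrite -(@normr_le0 _ (mat R k p 1)).
by rewrite -[v]trmxK vT trmx0 eqxx in v0.
Qed.

Lemma fnorm_shift_inv q (Y : 'M[K]_(p, q)) : fnorm (invmx (1%:M - A) *m Y) <= fnorm Y.
Proof.
rewrite (le_trans (fnorm_shift _))// -[X in X - _]mul1mx -mulmxBl.
by rewrite mulmxA mulmxV ?skew_shift_unit// mul1mx.
Qed.

Definition cayley := invmx (1%:M - A) *m (1%:M + A).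

Lemma cayley_orthogonal : orthogonal_mx cayley.
Proof.
rewrite /orthogonal_mx /cayley; have Au := skew_shift_unit.
set J := invmx (1%:M - A).
have J1 : (1%:M - A) *m J = 1%:M by rewrite mulmxV.
have J2 : J *m (1%:M - A) = 1%:M by rewrite mulVmx.
have E : (1%:M + A) *m (1%:M - A) = (1%:M - A) *m (1%:M + A).
  by rewrite mulmxDl mulmxBl !mul1mx mulmxBr mulmxDr !mulmx1 opprD !addrA subrK addrK.
have JC : J *m (1%:M + A) = (1%:M + A) *m J.
  rewrite -[LHS]mulmx1 -{2}J1 mulmxA; congr (_ *m J).
  by rewrite -mulmxA E mulmxA J2 mul1mx.
rewrite {1}JC ctrM ctrD A_skew ctr1 -mulmxA (mulmxA _ J) J1 mul1mx.
by rewrite -[1%:M + A]ctrK ctrD A_skew ctr1 -ctrM J1 ctr1.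
Qed.

(** Multiplying the left-hand matrix by 1 - A gives exactly 2 A^2. *)
Lemma cayley_expansion : fnorm (cayley - 1%:M - 2%:R *: A) <= fnorm (2%:R *: (A *m A)).
Proof.
have -> : cayley - 1%:M - 2%:R *: A = invmx (1%:M - A) *m (2%:R *: (A *m A)).
  rewrite -[1%:M in LHS](mulVmx skew_shift_unit) -[2%:R *: A]mul1mx.
  rewrite -[1%:M in X in _ - X](mulVmx skew_shift_unit) -mulmxA -!mulmxBr; congr (_ *m _).
  rewrite mulmxBl mul1mx -scalemxAr !scaler_nat !mulr2n.
  by move: (A *m A) => B; apply/matrixP => i j; rewrite !mxE; ring.
exact: fnorm_shift_inv.
Qed.

End Cayley.

(** Here p is close to 1 + a, and q, in practice a conjugate transpose, is close to 1 - b. Each term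
    on the right contains a second-order defect or both [a] and [b]. *)
Lemma mulmx_expansion (R : comNzRingType) (m n : nat) (p a : 'M[R]_m) (q b : 'M[R]_n)
    (M : 'M[R]_(m, n)) :
  p *m M *m q - M - (a *m M - M *m b) =
  (p - 1%:M - a) *m M *m q + ((1%:M + a) *m M *m (q - 1%:M + b) - a *m M *m b).
Proof.
rewrite !mulmxBl mulmxDl !mul1mx mulmxDr mulmxBr mulmx1 !mulmxDl.
move: (p *m M *m q) (M *m q) (a *m M *m q) (M *m b) (a *m M *m b) (a *m M).
by move=> x1 x2 x3 x4 x5 x6; apply/matrixP => i j; rewrite !mxE; ring.
Qed.

(** * The derivative of G on diagonal and on tangent directions *)

Section Differential.
Context {R : realType} {k : scalar_kind} {m n : nat}.
Hypothesis le_mn : (m <= n)%N.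
Local Notation K := (scalars R k).
Local Notation w := (widen_ord le_mn).
Local Notation D := (@diag0 R k m n).
Variables (N : set (mat R k m n)) (N_open : open N).
Variables (g : rvec R m -> rvec R m) (G : mat R k m n -> mat R k m n).
Hypothesis GE : forall (X : 'M[K]_(m, n)) (U : 'M[K]_m) (V : 'M[K]_n) s,
  N X -> orthogonal_mx U -> orthogonal_mx V -> X = U *m D s *m ctr V ->
  G X = U *m D (g s) *m ctr V.
Variables (U : 'M[K]_m) (V : 'M[K]_n) (s : rvec R m).
Hypotheses (Uo : orthogonal_mx U) (Vo : orthogonal_mx V).
Let emb (y : rvec R m) : mat R k m n := U *m D y *m ctr V.
Hypothesis NX : N (emb s).

Let embB y z : emb (y - z) = emb y - emb z.
Proof. by rewrite /emb diag0B mulmxBr mulmxBl. Qed.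

Let embD y z : emb (y + z) = emb y + emb z.
Proof. by rewrite /emb diag0D mulmxDr mulmxDl. Qed.

Let embZ (a : R) y : emb (a *: y) = a *: emb y.
Proof. by rewrite /emb diag0Z -scalemxAr -scalemxAl. Qed.

Let emb_norm y : `|emb y| = `|y|.
Proof.
rewrite -(fnorm_diag0 (k := k) le_mn) -[LHS]/(fnorm _) /emb.
by rewrite fnorm_mulr ?ctrK// fnorm_mull.
Qed.

Let near_emb : exists2 d, 0 < d & forall y, `|y - s| < d -> N (emb y) /\ G (emb y) = emb (g y).
Proof.
have /near_distP[d d0 Hd] : \forall Y \near emb s, N Y by apply: open_nbhs_nbhs.
exists d => // y ys; have Ny : N (emb y) by apply: Hd; rewrite -embB emb_norm.
by split=> //; exact: GE.
Qed.

Lemma diff_spectral_diag (h : rvec R m) :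
  differentiable G (emb s) -> differentiable g s -> 'd G (emb s) (emb h) = emb ('d g s h).
Proof.
move=> dG dg; have [C C0 HC] := diff_bounded dG.
apply: (frechet_curve HC (differentiable_frechet dG) (y := fun t => emb (s + t *: h))) => e e0.
have h1 : 0 < `|h| + 1 by rewrite ltr_wpDl.
have [d d0 Hd] := differentiable_frechet dg (divr_gt0 e0 h1).
have [d' d'0 Hd'] := near_emb.
exists (Num.min d d' / (`|h| + 1)) => [|t /andP[t0]].
  by rewrite divr_gt0// lt_min d0.
rewrite ltr_pdivlMr// => td.
have E : s + t *: h - s = t *: h by rewrite addrC addKr.
have : `|s + t *: h - s| < Num.min d d'.
  rewrite E normrZ gtr0_norm// (le_lt_trans _ td)//.
  by rewrite (ler_wpM2l (ltW t0))// lerDl.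
rewrite lt_min => /andP[/Hd + /Hd'[_ ->]]; rewrite E => H.
split.
  by rewrite -!embZ -!embB E subrr emb_norm normr0 mulr_ge0// ltW.
have [_ ->] : N (emb s) /\ G (emb s) = emb (g s) by apply: Hd'; rewrite subrr normr0.
rewrite -!embZ -!embB emb_norm -linearZ; apply: (le_trans H).
rewrite normrZ gtr0_norm//.
apply: (@le_trans _ _ (e / (`|h| + 1) * ((`|h| + 1) * t))).
  apply: ler_wpM2l; first by rewrite divr_ge0// ltW.
  by rewrite mulrC (ler_wpM2r (ltW t0))// lerDl.
by rewrite mulrA divfK ?gt_eqF.
Qed.

Let undiag (Z : mat R k m n) : rvec R m := \col_i re ((ctr U *m Z *m V) i (w i)).

Let undiagE Z i j : undiag Z i j = re ((ctr U *m Z *m V) i (w i)).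
Proof. exact: mxE. Qed.

Let undiagD Y Z : undiag (Y + Z) = undiag Y + undiag Z.
Proof.
apply/matrixP => i j; rewrite [RHS]mxE !undiagE -raddfD.
have -> : ctr U *m (Y + Z) *m V = ctr U *m Y *m V + ctr U *m Z *m V.
  by rewrite -mulmxDl -mulmxDr.
by rewrite [X in re X]mxE.
Qed.

Let undiagK y : undiag (emb y) = y.
Proof.
apply/matrixP => i j; rewrite undiagE /emb !mulmxA Uo mul1mx -mulmxA.
by rewrite (Vo : ctr V *m V = _) mulmx1 !mxE eqxx of_realK ord1.
Qed.

Let undiagZ (a : R) Z : undiag (a *: Z) = a *: undiag Z.
Proof.
apply/matrixP => i j; rewrite undiagE -[a *: Z]/(of_real a *: (Z : 'M[K]_(m, n))).
by rewrite -scalemxAr -scalemxAl [X in re X]mxE re_of_realM [RHS]mxE undiagE.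
Qed.

Let undiagB Y Z : undiag (Y - Z) = undiag Y - undiag Z.
Proof. by rewrite -scaleN1r undiagD undiagZ scaleN1r. Qed.

Let undiag_le Z : `|undiag Z| <= m%:R * `|Z|.
Proof.
apply: rvec_norm_le => // i; rewrite undiagE (le_trans (le_re_modulus _))//.
apply: (le_trans (le_modulus_fnorm _ _ _)).
rewrite fnorm_mulr ?orthogonal_mxC// fnorm_mull// ctrK orthogonal_mxC//.
Qed.

(** Near [s], g is the composite of [emb], G and [undiag]; the outer two are linear and bounded. *)
Lemma differentiable_spectral_base :
  differentiable G (emb s) -> differentiable g s.
Proof.
move=> dG; have [C C0 HC] := diff_bounded dG.
pose L h := undiag ('d G (emb s) (emb h)).
have Llin : linear L.
  by move=> a x y; rewrite /L embD embZ linearD linearZ undiagD undiagZ.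
pose LM := GRing.isLinear.Build _ _ _ _ _ Llin.
pose LL : {linear _ -> _} := HB.pack L LM.
have LC h : `|LL h| <= m%:R * C * `|h|.
  by rewrite (le_trans (undiag_le _))// -mulrA ler_wpM2l// -[`|h|]emb_norm HC.
suff /(frechet_differentiable LC)[] : frechet g s LL by [].
move=> e e0; have [d d0 Hd] := near_emb.
have m1 : 0 < m%:R + 1 :> R by rewrite ltr_wpDl.
have [d' d'0 Hd'] := differentiable_frechet dG (divr_gt0 e0 m1).
exists (Num.min d d') => [|y]; first by rewrite lt_min d0.
rewrite lt_min => /andP[yd yd']; have [_ Gy] := Hd y yd.
have [_ Gs] : N (emb s) /\ G (emb s) = emb (g s) by apply: Hd; rewrite subrr normr0.
have := Hd' (emb y); rewrite -embB emb_norm => /(_ yd').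
rewrite Gy Gs => H.
have -> : g y - g s - LL (y - s) =
    undiag (emb (g y) - emb (g s) - 'd G (emb s) (emb (y - s))).
  by rewrite !undiagB !undiagK.
apply: (le_trans (undiag_le _)).
apply: (@le_trans _ _ (m%:R * (e / (m%:R + 1) * `|y - s|))); first by rewrite ler_wpM2l.
rewrite mulrA ler_wpM2r// mulrCA -[leRHS]mulr1 ler_wpM2l ?(ltW e0)//.
by rewrite ler_pdivrMr// mul1r lerDl.
Qed.

(* Differentiate along the curve obtained by moving [U] and [V] by Cayley transforms. *)
Lemma diff_spectral_tangent (A : 'M[K]_m) (B : 'M[K]_n) :
  ctr A = - A -> ctr B = - B -> differentiable G (emb s) ->
  'd G (emb s) (U *m (A *m D s - D s *m B) *m ctr V) =
  U *m (A *m D (g s) - D (g s) *m B) *m ctr V.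
Proof.
move=> Ask Bsk dG; have [C C0 HC] := diff_bounded dG.
have half_skew p (M : 'M[K]_p) (t : R) : ctr M = - M ->
    ctr (of_real (t / 2) *: M) = - (of_real (t / 2) *: M).
  by move=> Msk; rewrite ctrZ Msk scalerN.
(* The half compensates the 2 in the expansion of the Cayley transform: P t = 1 + t A + O(t^2). *)
pose P t := cayley (of_real (t / 2) *: A); pose Q t := cayley (of_real (t / 2) *: B).
pose I01 t := 0 < t <= (1 : R).
have h01 t : I01 t -> 0 <= t <= 1 by move=> /andP[/ltW-> ->].
have Po t : orthogonal_mx (P t) by exact: cayley_orthogonal (half_skew _ _ _ Ask).
have Qo t : orthogonal_mx (Q t) by exact: cayley_orthogonal (half_skew _ _ _ Bsk).
have cayleyO p (M : 'M[K]_p) : ctr M = - M ->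
    matO I01 id 2 (fun t => cayley (of_real (t / 2) *: M) - 1%:M - of_real t *: M).
  move=> Msk; exists (fnorm (M *m M)); split=> [|t /h01/andP[t0 t1]]; first exact: fnorm_ge0.
  have := cayley_expansion (half_skew _ _ t Msk).
  rewrite -scalemxAl -scalemxAr !scalerA -(rmorph_nat (@of_real R k)) -!rmorphM.
  rewrite (_ : 2 * (t / 2) = t); last by field.
  move=> /le_trans; apply; rewrite fnormZ ger0_norm; last by rewrite !mulr_ge0// divr_ge0.
  rewrite mulrC ler_wpM2l ?fnorm_ge0// expr2; nra.
have expand (M : 'M[K]_(m, n)) :
    matO I01 id 2 (fun t => P t *m M *m ctr (Q t) - M - of_real t *: (A *m M - M *m B)).
  have E t : I01 t -> (P t - 1%:M - of_real t *: A) *m M *m ctr (Q t) +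
     ((1%:M + of_real t *: A) *m M *m ctr (Q t - 1%:M - of_real t *: B)
      - (of_real t *: A) *m M *m (of_real t *: B)) =
     P t *m M *m ctr (Q t) - M - of_real t *: (A *m M - M *m B).
    by move=> _; rewrite !ctrB ctr1 ctrZ Bsk scalerN opprK scalerBr scalemxAl scalemxAr mulmx_expansion.
  apply: (matO_ext E).
  have idO p (M' : 'M[K]_p) : matO I01 id 1 (fun t => of_real t *: M').
    exists (fnorm M'); split=> [|t /h01/andP[t0 _]]; first exact: fnorm_ge0.
    by rewrite fnormZ ger0_norm// expr1 mulrC.
  have Q0 : matO I01 id 0 (fun t => ctr (Q t)).
    by apply: matO_ctr; apply: matO_orthogonal.
  apply: matOD.
    apply: (matOM (e := 2) (e' := 0)) => //.
    by apply: (matOM (e := 2) (e' := 0)); [exact: cayleyO|exact: matO_cst].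
  apply: matOB.
    apply: (matOM (e := 0) (e' := 2)); last by apply: matO_ctr; exact: cayleyO.
    apply: (matOM (e := 0) (e' := 0)); last exact: matO_cst.
    apply: matOD; first exact: matO_cst.
    exact: matOW (idO _ A).
  apply: (matOM (e := 1) (e' := 1)); last exact: idO.
  by apply: (matOM (e := 1) (e' := 0)); [exact: idO|exact: matO_cst].
have [C1 [C10 H1]] := expand (D s); have [C2 [C20 H2]] := expand (D (g s)).
have /near_distP[d d0 Hd] : \forall Y \near emb s, N Y by apply: open_nbhs_nbhs.
have conj_norm (M M1 M2 : 'M[K]_(m, n)) (t : R) :
    `|(U *m M *m ctr V : mat R k m n) - (U *m M1 *m ctr V : mat R k m n)
      - t *: (U *m M2 *m ctr V : mat R k m n)| = fnorm (M - M1 - of_real t *: M2).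
  rewrite -[LHS]/(fnorm (U *m M *m ctr V - U *m M1 *m ctr V -
    of_real t *: (U *m M2 *m ctr V))).
  rewrite scalemxAl scalemxAr -!mulmxBl -!mulmxBr.
  by rewrite fnorm_mulr ?ctrK// fnorm_mull.
set H : mat R k m n := U *m (A *m D s - D s *m B) *m ctr V.
pose y t : mat R k m n := U *m (P t *m D s *m ctr (Q t)) *m ctr V.
have yE t : y t = (U *m P t) *m D s *m ctr (V *m Q t) by rewrite /y ctrM !mulmxA.
apply: (frechet_curve HC (differentiable_frechet dG) (y := y)) => e e0.
have C1_gt0 : 0 < C1 + C2 + 1 by rewrite ltr_wpDl// addr_ge0.
have H_gt0 : 0 < `|H| + C1 + 1 by rewrite ltr_wpDl// addr_ge0.
exists (Num.min 1 (Num.min (e / (C1 + C2 + 1)) (d / (`|H| + C1 + 1)))) => [|t /andP[t0]].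
  by rewrite !lt_min ltr01 !divr_gt0.
rewrite !lt_min !ltr_pdivlMr// => /and3P[t1 te td].
have It : I01 t by rewrite /I01 t0 ltW.
have B1 : `|y t - emb s - t *: H| <= C1 * t ^+ 2 by rewrite conj_norm H1.
have NY : N (y t).
  apply: Hd; rewrite -(subrK (t *: H) (y t - emb s)) (le_lt_trans (ler_normD _ _))//.
  rewrite normrZ gtr0_norm//; apply: le_lt_trans td.
  have t2 : C1 * t ^+ 2 <= C1 * t by rewrite ler_wpM2l// expr2 ler_piMl ?ltW.
  by move: B1 t2; lra.
have [_ Gs] : N (emb s) /\ G (emb s) = emb (g s).
  by have [d' d'0] := near_emb; apply; rewrite subrr normr0.
have Gy : G (y t) = U *m (P t *m D (g s) *m ctr (Q t)) *m ctr V.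
  rewrite (GE NY (orthogonal_mxM Uo (Po t)) (orthogonal_mxM Vo (Qo t)) (yE t)).
  by rewrite ctrM !mulmxA.
have B2 : `|G (y t) - G (emb s) - t *: (U *m (A *m D (g s) - D (g s) *m B) *m ctr V : mat R k m n)| <=
    C2 * t ^+ 2.
  by rewrite Gs Gy conj_norm H2.
have e1 : (C1 + C2) * t <= e by rewrite mulrC (le_trans _ (ltW te))// ler_wpM2l ?lerDl// ltW.
split; [apply: (le_trans B1)|apply: (le_trans B2)]; rewrite expr2 mulrA (ler_wpM2r (ltW t0))//.
  by rewrite (le_trans _ e1)// (ler_wpM2r (ltW t0))// lerDl.
by rewrite (le_trans _ e1)// (ler_wpM2r (ltW t0))// lerDr.
Qed.

End Differential.

(** * Orthogonal factors that almost commute with a diagonal *)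

Section BlockAlignment.
Context {R : realType} {k : scalar_kind} {m n : nat} {T : Type}.
Hypothesis le_mn : (m <= n)%N.
Local Notation K := (scalars R k).
Local Notation w := (widen_ord le_mn).
Local Notation D := (@diag0 R k m n).
Variables (A : T -> Prop) (h : T -> R).
Hypothesis h01 : forall t, A t -> 0 <= h t <= 1.
Local Notation O e F := (matO A h e F).
Variables (P : T -> 'M[K]_m) (Q : T -> 'M[K]_n) (s : rvec R m).
Hypothesis s_ge0 : forall i, 0 <= s i 0.
Hypotheses (Po : forall t, A t -> orthogonal_mx (P t)).
Hypotheses (Qo : forall t, A t -> orthogonal_mx (Q t)).

Local Notation E1 := (fun t => P t *m D s - D s *m Q t).
Local Notation E2 := (fun t => Q t *m ctr (D s) - ctr (D s) *m P t).
Hypotheses (E1O : O 1 E1) (E2O : O 1 E2).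

Let dm (f : rvec R m) : 'M[K]_m := diag_mx (\row_j of_real (f j 0)).
Let hd (f g : rvec R m) : rvec R m := \col_i (f i 0 * g i 0).

Let dmE f i j : dm f i j = if i == j then of_real (f i 0) else 0.
Proof. by rewrite !mxE; case: eqVneq => [->|]; rewrite ?mulr1n ?mulr0n. Qed.

Let mul_dm p (M : 'M[K]_(p, m)) f i j : (M *m dm f) i j = M i j * of_real (f j 0).
Proof. by rewrite mul_mx_diag !mxE. Qed.

Let dm_mul p (M : 'M[K]_(m, p)) f i j : (dm f *m M) i j = of_real (f i 0) * M i j.
Proof. by rewrite mul_diag_mx !mxE. Qed.

Let dm_D f g : dm f *m D g = D (hd f g).
Proof.
apply/matrixP => i j; rewrite dm_mul !mxE; case: ifP => _; rewrite ?mulr0//.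
by rewrite rmorphM.
Qed.

Let D_ctrD f g : D f *m ctr (D g) = dm (hd f g).
Proof.
apply/matrixP => i j; rewrite (mulmx_ctr_diag0 le_mn) dmE !mxE /= rmorphM /=.
by have [->|ij] := eqVneq i j; rewrite ?eqxx// ifN ?mul0r.
Qed.

Let ctr_dm f : ctr (dm f) = dm f.
Proof.
apply/matrixP => i j; rewrite ctrE !dmE eq_sym.
by case: eqVneq => [->|_]; rewrite ?conj_of_real ?rmorph0.
Qed.

(** [one] is the indicator of the support of [s], and [inv] its pseudo-inverse, as 0^-1 = 0. [T0] is
    a partial isometry and [Pi] the orthogonal projector onto the kernel of [D s], which contains
    the n - m extra coordinates. *)
Let one : rvec R m := \col_i (s i 0 != 0)%:R.
Let inv : rvec R m := \col_i (s i 0)^-1.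
Let T0 : 'M[K]_(m, n) := D one.
Let Pi : 'M[K]_n := 1%:M - ctr T0 *m T0.

Let hd_inv_s : hd inv s = one.
Proof.
apply/matrixP => i j; rewrite !mxE.
by have [->|s0] := eqVneq (s i 0) 0; rewrite ?mulr0// mulVf.
Qed.

Let hd_one (f : rvec R m) : (forall i, s i 0 = 0 -> f i 0 = 0) -> hd f one = f.
Proof.
move=> f0; apply/matrixP => i j; rewrite !mxE ord1.
by case: eqVneq => [/f0->|_]; rewrite ?mulr0 ?mulr1.
Qed.

Let one0 i : s i 0 = 0 -> one i 0 = 0.
Proof. by rewrite mxE => ->; rewrite eqxx. Qed.

Let T0_ctr : T0 *m ctr T0 = dm one.
Proof. by rewrite D_ctrD hd_one//; exact: one0. Qed.

Let dm_one_T0 : dm one *m T0 = T0.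
Proof. by rewrite dm_D hd_one//; exact: one0. Qed.

Let D_Pi (f : rvec R m) : (forall i, s i 0 = 0 -> f i 0 = 0) -> D f *m Pi = 0.
Proof.
by move=> f0; rewrite mulmxBr mulmx1 mulmxA D_ctrD hd_one// dm_D hd_one// subrr.
Qed.

Let Pi_ctr : ctr Pi = Pi.
Proof. by rewrite /Pi ctrB ctr1 ctrM ctrK. Qed.

Let Pi_D (f : rvec R m) : (forall i, s i 0 = 0 -> f i 0 = 0) -> Pi *m ctr (D f) = 0.
Proof. by move=> f0; rewrite -Pi_ctr -ctrM D_Pi// /ctr trmx0 map_mx0. Qed.

Let Pi_idem : Pi *m Pi = Pi.
Proof.
rewrite {1}/Pi mulmxBl mul1mx -mulmxA (D_Pi one0) mulmx0 subr0; exact: erefl.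
Qed.

(** [N] keeps the blocks of [P] on which [s] is constant. On the support of [s], [M] is copied from
    [N] rather than cut out of [Q], so that both intertwine [D f] exactly; on the kernel [Q] is
    kept. *)
Let N t : 'M[K]_m := \matrix_(i, j) if s i 0 == s j 0 then P t i j else 0.
Let M t : 'M[K]_n := ctr T0 *m N t *m T0 + Pi *m Q t *m Pi.

Let N_dm (f : rvec R m) t : (forall i j, s i 0 = s j 0 -> f i 0 = f j 0) -> N t *m dm f = dm f *m N t.
Proof.
move=> fb; apply/matrixP => i j; rewrite mul_dm dm_mul mxE.
by case: eqP => [/fb->|_]; rewrite ?mulr0 ?mul0r// mulrC.
Qed.

(** Combining [E1] and [E2] bounds P_ij (s_j^2 - s_i^2), and since s >= 0 the factor is nonzero off
    the blocks. *)
Let PNO : O 1 (fun t => P t - N t).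
Proof.
have EO : O 1 (fun t => P t *m D s *m ctr (D s) - D s *m ctr (D s) *m P t).
  apply: (matO_ext (F := fun t => E1 t *m ctr (D s) + D s *m E2 t)).
    by move=> t _; rewrite mulmxBl mulmxBr !mulmxA addrA subrK.
  apply: matOD; first by apply: (matOM (e := 1) (e' := 0)) => //; exact: matO_cst.
  by apply: (matOM (e := 0) (e' := 1)) => //; exact: matO_cst.
apply: matO_entries => // i j.
have [C HC] := matO_entry i j EO.
have [sij|sij] := eqVneq (s i 0) (s j 0).
  by exists 0 => t _; rewrite mxBE mxE sij eqxx subrr modulus0 mul0r.
have [sq|sq] := eqVneq (s j 0 ^+ 2 - s i 0 ^+ 2) 0.
  case/negP: sij; rewrite -(@eqrXn2 _ 2%N)//.
  by move/eqP: sq; rewrite subr_eq0 eq_sym.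
exists (`|s j 0 ^+ 2 - s i 0 ^+ 2|^-1 * C) => t At.
rewrite mxBE mxE (negPf sij) subr0 -mulrA ler_pdivlMl ?normr_gt0//.
rewrite -(modulus_real (k := k)) -modulusM; apply: le_trans (HC t At).
rewrite mxBE (mulmx_ctr_diag0 le_mn) (mulmx_diag0 le_mn) -mulmxA.
rewrite (diag0_mulmx le_mn) (ctr_diag0_mulmx le_mn).
rewrite le_eqVlt; apply/orP; left; apply/eqP; congr modulus.
by rewrite rmorphB !rmorphXn /=; ring.
Qed.

(** Put F = P - N. Inside the blocks the mixed terms ctr(N) F and ctr(F) N vanish, so P orthogonal
    gives ctr(N) N - 1 = - ctr(F) F there, a product of two first-order factors. Outside, ctr(N) N
    and 1 both vanish. *)
Let NNO : O 2 (fun t => ctr (N t) *m N t - 1%:M).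
Proof.
have FFO : O 2 (fun t => ctr (P t - N t) *m (P t - N t)).
  by apply: (matOM (e := 1) (e' := 1)) => //; exact: matO_ctr.
apply: matO_entries => // i j; have [C HC] := matO_entry i j FFO.
have Nz t a b : s a 0 != s b 0 -> N t a b = 0.
  by move=> ab; rewrite mxE (negPf ab).
have Fz t a b : s a 0 = s b 0 -> (P t - N t) a b = 0.
  by move=> ab; rewrite mxBE mxE ab eqxx subrr.
have [sij|sij] := eqVneq (s i 0) (s j 0); last first.
  exists 0 => t At; rewrite mul0r mxBE mxE [1%:M _ _]mxE.
  have -> : (i == j) = false by apply: contra_neqF sij => /eqP ->.
  rewrite big1 ?subrr ?modulus0// => l _; rewrite ctrE.
  have [sli|sli] := eqVneq (s l 0) (s i 0); last by rewrite Nz// rmorph0 mul0r.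
  by rewrite (Nz _ l j) ?mulr0// sli.
exists C => t At.
apply: le_trans (HC t At); rewrite le_eqVlt; apply/orP; left; apply/eqP.
have PP : ctr (N t) *m N t + ctr (N t) *m (P t - N t) + (ctr (P t - N t) *m N t +
    ctr (P t - N t) *m (P t - N t)) = 1%:M.
  rewrite -!mulmxDr !(addrC (N t)) subrK -mulmxDl -ctrD (addrC (N t)) subrK.
  exact: Po.
have NF0 : (ctr (N t) *m (P t - N t)) i j = 0.
  rewrite mxE big1// => l _; rewrite ctrE.
  have [sli|sli] := eqVneq (s l 0) (s i 0); last by rewrite Nz// rmorph0 mul0r.
  by rewrite (Fz _ l j) ?mulr0// sli.
have FN0 : (ctr (P t - N t) *m N t) i j = 0.
  rewrite mxE big1// => l _; rewrite ctrE.
  have [sli|sli] := eqVneq (s l 0) (s i 0); first by rewrite Fz// rmorph0 mul0r.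
  by rewrite (Nz _ l j) ?mulr0// -sij.
rewrite -PP -addrA opprD addrA subrr add0r 2!mxE NF0 add0r [X in modulus (- X)]mxE.
by rewrite FN0 add0r modulusN.
Qed.

(** Multiplying [E1] by the inverse of [s] on the left and by [Pi] on the right kills P D(s), as
    D(s) Pi = 0, and leaves - T0 Q Pi. *)
Let T0QPiO : O 1 (fun t => T0 *m Q t *m Pi).
Proof.
apply: (matO_ext (F := fun t => - (dm inv *m E1 t *m Pi))) => [t _|].
  have D0 : D s *m Pi = 0 by apply: D_Pi.
  rewrite /= (mulmxBr (dm inv)) (mulmxBl _ _ Pi) !mulmxA dm_D hd_inv_s -(mulmxA _ (D s) Pi) D0.
  by rewrite !mulmx0 sub0r opprK.
apply: matON; apply: (matOM (e := 1) (e' := 0)); last exact: matO_cst.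
by apply: (matOM (e := 0) (e' := 1)) => //; exact: matO_cst.
Qed.

Let PiQT0O : O 1 (fun t => Pi *m Q t *m ctr T0).
Proof.
have T0E : ctr T0 = ctr (D s) *m dm inv by rewrite /T0 -hd_inv_s -dm_D ctrM ctr_dm.
apply: (matO_ext (F := fun t => Pi *m E2 t *m dm inv)) => [t _|].
  have D0 : Pi *m ctr (D s) = 0 by apply: Pi_D.
  rewrite /= (mulmxBr Pi) (mulmxBl _ _ (dm inv)) (mulmxA Pi (ctr _)) D0 !mul0mx subr0 T0E !mulmxA.
  exact: erefl.
apply: (matOM (e := 1) (e' := 0)); last exact: matO_cst.
by apply: (matOM (e := 0) (e' := 1)) => //; exact: matO_cst.
Qed.

(** Since Q is orthogonal, the defect of [M] on the kernel is the product of the mixed block T0 Q Pi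
    with its adjoint, hence of second order; on the support it is the defect of [N]. *)
Let MMO : O 2 (fun t => ctr (M t) *m M t - 1%:M).
Proof.
have T0Pi : T0 *m Pi = 0 by apply: D_Pi; exact: one0.
have PiT0 : Pi *m ctr T0 = 0 by apply: Pi_D; exact: one0.
have one_b i j : s i 0 = s j 0 -> one i 0 = one j 0 by rewrite !mxE => ->.
apply: (matO_ext (F := fun t => ctr T0 *m (ctr (N t) *m N t - 1%:M) *m T0 -
  Pi *m ctr (Q t) *m ctr T0 *m (T0 *m Q t *m Pi))) => [t At|].
  have QQ : ctr (Q t) *m (1%:M - Pi) *m Q t = 1%:M - ctr (Q t) *m Pi *m Q t.
    by rewrite mulmxBr mulmx1 mulmxBl (Qo At : ctr (Q t) *m Q t = _).
  have E : ctr T0 *m T0 = 1%:M - Pi by rewrite /Pi opprB addrC subrK.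
  have -> : Pi *m ctr (Q t) *m ctr T0 *m (T0 *m Q t *m Pi) =
      Pi - Pi *m ctr (Q t) *m Pi *m Q t *m Pi.
    transitivity (Pi *m (ctr (Q t) *m (ctr T0 *m T0) *m Q t) *m Pi); first by rewrite !mulmxA.
    by rewrite E QQ (mulmxBr Pi) (mulmxBl _ _ Pi) mulmx1 Pi_idem !mulmxA.
  have -> : ctr (M t) *m M t = ctr T0 *m ctr (N t) *m N t *m T0 +
      Pi *m ctr (Q t) *m Pi *m Q t *m Pi.
    have XX : ctr T0 *m ctr (N t) *m T0 *m (ctr T0 *m N t *m T0) =
        ctr T0 *m ctr (N t) *m N t *m T0.
      transitivity (ctr T0 *m ctr (N t) *m ((T0 *m ctr T0) *m N t *m T0)).
        by rewrite !mulmxA.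
      by rewrite T0_ctr -N_dm// -(mulmxA _ (dm one)) dm_one_T0 !mulmxA.
    have XY : ctr T0 *m ctr (N t) *m T0 *m (Pi *m Q t *m Pi) = 0.
      transitivity (ctr T0 *m ctr (N t) *m (T0 *m Pi) *m Q t *m Pi); first by rewrite !mulmxA.
      by rewrite T0Pi mulmx0 !mul0mx.
    have YX : Pi *m ctr (Q t) *m Pi *m (ctr T0 *m N t *m T0) = 0.
      transitivity (Pi *m ctr (Q t) *m (Pi *m ctr T0) *m N t *m T0); first by rewrite !mulmxA.
      by rewrite PiT0 mulmx0 !mul0mx.
    have YY : Pi *m ctr (Q t) *m Pi *m (Pi *m Q t *m Pi) =
        Pi *m ctr (Q t) *m Pi *m Q t *m Pi.
      transitivity (Pi *m ctr (Q t) *m (Pi *m Pi) *m Q t *m Pi); first by rewrite !mulmxA.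
      by rewrite Pi_idem.
    have -> : ctr (M t) = ctr T0 *m ctr (N t) *m T0 + Pi *m ctr (Q t) *m Pi.
      by rewrite ctrD !ctrM ctrK Pi_ctr !mulmxA.
    rewrite /M mulmxDl (mulmxDr (ctr T0 *m ctr (N t) *m T0)) (mulmxDr (Pi *m ctr (Q t) *m Pi)).
    by rewrite XX XY YX YY addr0 add0r.
  rewrite (mulmxBr (ctr T0)) mulmx1 (mulmxBl _ _ T0) E !mulmxA.
  move: (_ *m T0) (_ *m Pi) => X Y; apply/matrixP => i j; rewrite !mxE; ring.
apply: matOB.
  apply: (matOM (e := 2) (e' := 0)); last exact: matO_cst.
  by apply: (matOM (e := 0) (e' := 2)) => //; exact: matO_cst.
apply: (matOM (e := 1) (e' := 1)) => //.
apply: (matO_ext (F := fun t => ctr (T0 *m Q t *m Pi))) => [t _|]; last exact: matO_ctr.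
by rewrite !ctrM Pi_ctr mulmxA.
Qed.

Let dm_dm f g : dm f *m dm g = dm (hd f g).
Proof.
apply/matrixP => i j; rewrite dm_mul !dmE mxE; case: eqP => [->|_]; rewrite ?mulr0//.
by rewrite rmorphM.
Qed.

Let s_s i : s i 0 = 0 -> s i 0 = 0. Proof. by []. Qed.

Let inv_b i j : s i 0 = s j 0 -> inv i 0 = inv j 0.
Proof. by rewrite !mxE => ->. Qed.

(** Split Q along 1 = ctr(T0) T0 + Pi. Mixed blocks are small, the kernel block belongs to [M], and
    on the support dividing [E1] by [s] compares Q with P, hence with N. *)
Let QMO : O 1 (fun t => Q t - M t).
Proof.
pose F t := ctr T0 *m (dm inv *m (P t - N t) *m D s *m ctr T0 - dm inv *m E1 t *m ctr T0) *m T0 +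
  (ctr T0 *m (T0 *m Q t *m Pi) + Pi *m Q t *m ctr T0 *m T0).
apply: (matO_ext (F := F)) => [t _|].
  pose Gm := ctr T0 *m T0.
  have GPi : Gm + Pi = 1%:M by rewrite addrC /Pi subrK.
  have QE : Q t = (Gm *m Q t *m Gm + Gm *m Q t *m Pi) + (Pi *m Q t *m Gm + Pi *m Q t *m Pi).
    rewrite -(mulmxDr (Gm *m Q t)) -(mulmxDr (Pi *m Q t)) GPi !mulmx1.
    by rewrite -(mulmxDl Gm Pi) GPi mul1mx.
  have FE : dm inv *m (P t - N t) *m D s *m ctr T0 - dm inv *m E1 t *m ctr T0 =
      T0 *m Q t *m ctr T0 - N t *m dm one.
    have NE : dm inv *m N t *m D s *m ctr T0 = N t *m dm one.
      rewrite -(mulmxA _ (D s)) D_ctrD (hd_one s_s) -(N_dm _ inv_b) -(mulmxA (N t)).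
      by rewrite dm_dm hd_inv_s.
    rewrite /= !(mulmxBr (dm inv)) (mulmxBl _ _ (D s)) !(mulmxBl _ _ (ctr T0)) NE.
    rewrite !mulmxA (dm_D inv) hd_inv_s -/T0.
    by rewrite opprB addrC addrA subrK.
  have TE : ctr T0 *m (T0 *m Q t *m ctr T0 - N t *m dm one) *m T0 =
      Gm *m Q t *m Gm - ctr T0 *m N t *m T0.
    rewrite (mulmxBr (ctr T0)) (mulmxBl _ _ T0) !mulmxA.
    by rewrite -(mulmxA _ (dm one)) dm_one_T0.
  have -> : F t = Gm *m Q t *m Gm - ctr T0 *m N t *m T0 + (Gm *m Q t *m Pi + Pi *m Q t *m Gm).
    by rewrite /F FE TE !mulmxA.
  rewrite [X in _ = X - _]QE /M.
  move: (Gm *m Q t *m Gm) (ctr T0 *m N t *m T0) (Gm *m Q t *m Pi) (Pi *m Q t *m Gm)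
    (Pi *m Q t *m Pi) => x1 x2 x3 x4 x5.
  by apply/matrixP => i j; rewrite !mxE; ring.
have cO p q (B : 'M[K]_(p, q)) : O 0 (fun=> B) by exact: matO_cst.
apply: matOD.
  apply: (matOM (e := 1) (e' := 0)) => //; apply: (matOM (e := 0) (e' := 1)) => //.
  apply: matOB; apply: (matOM (e := 1) (e' := 0)) => //.
    by apply: (matOM (e := 1) (e' := 0)) => //; apply: (matOM (e := 0) (e' := 1)).
  by apply: (matOM (e := 0) (e' := 1)).
apply: matOD; first by apply: (matOM (e := 0) (e' := 1)).
by apply: (matOM (e := 1) (e' := 0)).
Qed.

Let D_M (f : rvec R m) t : (forall i j, s i 0 = s j 0 -> f i 0 = f j 0) ->
  (forall i, s i 0 = 0 -> f i 0 = 0) ->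
  ctr (N t) *m D f = D f *m ctr (M t).
Proof.
move=> fb f0; apply: (can_inj (@ctrK _ _ _ _)); rewrite !ctrM !ctrK.
have DfE : D f = dm f *m T0 by rewrite dm_D hd_one.
rewrite /M mulmxDl -(mulmxA _ Pi) Pi_D// mulmx0 addr0.
have T0D : T0 *m ctr (D f) = dm f.
  by rewrite D_ctrD; congr dm; rewrite -[RHS]hd_one//; apply/matrixP => i j; rewrite !mxE mulrC.
rewrite -(mulmxA _ T0) T0D -mulmxA N_dm// mulmxA; congr (_ *m _).
by rewrite DfE ctrM ctr_dm.
Qed.

(** [a] is the skew part of W; for the Hermitian part, W + ctr(W) - 2 = (W ctr(W) - 1) - (W - 1)
    ctr(W - 1). *)
Let near_orthogonal_skew p (W : T -> 'M[K]_p) :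
  O 1 (fun t => W t - 1%:M) -> O 2 (fun t => W t *m ctr (W t) - 1%:M) ->
  exists a, [/\ forall t, ctr (a t) = - a t, O 1 a & O 2 (fun t => W t - 1%:M - a t)].
Proof.
move=> W1 WW; pose a t := of_real 2^-1 *: (W t - ctr (W t)).
exists a; split.
- by move=> t; rewrite ctrZ ctrB ctrK -scalerN opprB.
- apply: matOZ; apply: (matO_ext (F := fun t => (W t - 1%:M) - ctr (W t - 1%:M))).
    by move=> t _; rewrite ctrB ctr1 opprB addrA subrK.
  by apply: matOB => //; exact: matO_ctr.
apply: (matO_ext (F := fun t => of_real 2^-1 *:
    ((W t *m ctr (W t) - 1%:M) - (W t - 1%:M) *m ctr (W t - 1%:M)))) => [t _|].
  rewrite /a ctrB ctr1 mulmxBl !mulmxBr mul1mx !mulmx1 fmorphV rmorph_nat.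
  move: (W t) (ctr (W t)) (W t *m ctr (W t)) => x y z.
  by apply/matrixP => i j; rewrite !mxE; field.
apply: matOZ; apply: matOB => //.
by apply: (matOM (e := 1) (e' := 1)) => //; exact: matO_ctr.
Qed.

(* The orthogonal factors [P] and [Q] almost commute with [D s], hence are close to
   their block-diagonal parts [N] and [M], which are orthogonal up to second order and
   intertwine every [D f]; moving [N] and [M] from one side of [D f] to the other turns
   [P] and [Q] into [P N^*] and [Q M^*], which are close to the identity. *)
Lemma block_alignment : exists a b,
  [/\ forall t, ctr (a t) = - a t, forall t, ctr (b t) = - b t, O 1 a, O 1 b &
    forall f : rvec R m, (forall i j, s i 0 = s j 0 -> f i 0 = f j 0) ->
      (forall i, s i 0 = 0 -> f i 0 = 0) ->
      O 2 (fun t => P t *m D f *m ctr (Q t) - D f - (a t *m D f - D f *m b t))].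
Proof.
have cO p q (B : 'M[K]_(p, q)) : O 0 (fun=> B) by exact: matO_cst.
have PO : O 0 P by exact: matO_orthogonal.
have QO : O 0 Q by exact: matO_orthogonal.
pose W t := P t *m ctr (N t); pose Z t := Q t *m ctr (M t).
have W1 : O 1 (fun t => W t - 1%:M).
  apply: (matO_ext (F := fun t => - (P t *m ctr (P t - N t)))) => [t At|].
    by rewrite ctrB mulmxBr (orthogonal_mxC (Po At)) opprB.
  by apply: matON; apply: (matOM (e := 0) (e' := 1)) => //; exact: matO_ctr.
have Z1 : O 1 (fun t => Z t - 1%:M).
  apply: (matO_ext (F := fun t => - (Q t *m ctr (Q t - M t)))) => [t At|].
    by rewrite ctrB mulmxBr (orthogonal_mxC (Qo At)) opprB.
  by apply: matON; apply: (matOM (e := 0) (e' := 1)) => //; exact: matO_ctr.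
have WW : O 2 (fun t => W t *m ctr (W t) - 1%:M).
  apply: (matO_ext (F := fun t => P t *m (ctr (N t) *m N t - 1%:M) *m ctr (P t))) => [t At|].
    by rewrite mulmxBr mulmxBl mulmx1 (orthogonal_mxC (Po At)) /W ctrM ctrK !mulmxA.
  apply: (matOM (e := 2) (e' := 0)); last exact: matO_ctr.
  exact: (matOM (e := 0) (e' := 2)).
have ZZ : O 2 (fun t => Z t *m ctr (Z t) - 1%:M).
  apply: (matO_ext (F := fun t => Q t *m (ctr (M t) *m M t - 1%:M) *m ctr (Q t))) => [t At|].
    by rewrite mulmxBr mulmxBl mulmx1 (orthogonal_mxC (Qo At)) /Z ctrM ctrK !mulmxA.
  apply: (matOM (e := 2) (e' := 0)); last exact: matO_ctr.
  exact: (matOM (e := 0) (e' := 2)).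
have [a [a_skew aO aE]] := near_orthogonal_skew W1 WW.
have [b [b_skew bO bE]] := near_orthogonal_skew Z1 ZZ.
exists a, b; split=> // f fb f0.
apply: (matO_ext (F := fun t => (W t *m D f *m ctr (Z t) - D f - (a t *m D f - D f *m b t)) -
  P t *m D f *m (ctr (M t) *m M t - 1%:M) *m ctr (Q t))) => [t At|].
  (* [D_M] moves [N] across [D f], where it becomes [M]; replacing ctr(M) M by 1 is a second-order
     error. *)
  have -> : W t *m D f *m ctr (Z t) = P t *m D f *m (ctr (M t) *m M t) *m ctr (Q t).
    by rewrite /W /Z ctrM ctrK -!mulmxA (mulmxA (ctr (N t))) D_M// -!mulmxA.
  rewrite (mulmxBr (P t *m D f)) mulmx1 (mulmxBl _ _ (ctr (Q t))).
  move: (a t *m D f - _) (P t *m D f *m ctr (Q t))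
    (P t *m D f *m (ctr (M t) *m M t) *m ctr (Q t)) => x y z.
  by apply/matrixP => i j; rewrite !mxE; ring.
apply: matOB; last first.
  apply: (matOM (e := 2) (e' := 0)); last exact: matO_ctr.
  by apply: (matOM (e := 0) (e' := 2)) => //; apply: (matOM (e := 0) (e' := 0)).
have ZO : O 0 Z.
  apply: (matO_ext (F := fun t => (Z t - 1%:M) + 1%:M)); first by move=> t _; rewrite subrK.
  by apply: matOD => //; exact: matOW Z1.
apply: (matO_ext (F := fun t => (W t - 1%:M - a t) *m D f *m ctr (Z t) +
   ((1%:M + a t) *m D f *m (ctr (Z t) - 1%:M + b t) - a t *m D f *m b t))) => [t At|].
  by rewrite -mulmx_expansion.
apply: matOD.
  apply: (matOM (e := 2) (e' := 0)); last exact: matO_ctr.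
  exact: (matOM (e := 2) (e' := 0)).
apply: matOB; last first.
  by apply: (matOM (e := 1) (e' := 1)) => //; apply: (matOM (e := 1) (e' := 0)).
apply: (matOM (e := 0) (e' := 2)).
  by apply: (matOM (e := 0) (e' := 0)) => //; apply: matOD => //; exact: matOW aO.
apply: (matO_ext (F := fun t => ctr (Z t - 1%:M - b t))) => [t _|]; last exact: matO_ctr.
by rewrite !ctrB ctr1 b_skew opprK.
Qed.

End BlockAlignment.

Lemma subr_split (E : zmodType) (x y z v : E) : x - v = (x - y) - z - (v - y - z).
Proof. by rewrite -[x - y - z]addrA -[v - y - z]addrA -opprD opprB addrA subrK. Qed.

Lemma subr_cancel (E : zmodType) (x1 x2 x3 x4 x5 : E) :
  x1 - x2 - x3 - (x4 - x2 - x5) = x1 - x4 - x3 + x5.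
Proof.
rewrite [x1 - x2 - x3]addrAC [x4 - x2 - x5]addrAC opprB addrA subrK opprB addrA.
by rewrite [x1 - x4 - x3]addrAC [RHS]addrAC.
Qed.

(** * Semismoothness of G *)

Section SemismoothTransfer.
Context {R : realType} {k : scalar_kind} {m n : nat}.
Hypothesis le_mn : (m <= n)%N.
Local Notation K := (scalars R k).
Local Notation D := (@diag0 R k m n).
Variables (N : set (mat R k m n)) (N_open : open N).
Variables (g : rvec R m -> rvec R m) (sigmaN : set (rvec R m)) (sigmaN_open : open sigmaN).
Hypothesis sub_sigmaN : [set sigma X | X in N] `<=` sigmaN.
Hypothesis g_sym : absolutely_symmetric g sigmaN.
Variables (G : mat R k m n -> mat R k m n) (G_spec : spectral_operator g N G).
Variables (Xb : mat R k m n) (Ub : 'M[K]_m) (Vb : 'M[K]_n).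
Hypotheses (NXb : N Xb) (Xb_svd : svd_pair Xb Ub Vb).

Let GE := spectral_operatorE le_mn sub_sigmaN g_sym G_spec.

(** Absorbs second-order remainders into the order 1 + rho. *)
Lemma sqr_le_powR (x p : R) : 0 <= x <= 1 -> p <= 1 -> x ^+ 2 <= x `^ (1 + p).
Proof.
move=> /andP[x0 x1] p1; rewrite -powR_mulrn//.
have [->|xn0] := eqVneq x 0; first by rewrite powR0 ?powR_ge0// pnatr_eq0.
apply: ger_powR; first by rewrite lt_neqAle eq_sym xn0 x0.
by rewrite (natrD _ 1 1) lerD2l.
Qed.

Lemma semismooth_spectral (rho : R) : 0 < rho -> rho <= 1 ->
  G_semismooth g (sigma Xb) rho -> G_semismooth G Xb rho.
Proof.
move=> rho0 rho1 /G_semismoothP[g_lip [Cg [dg [Cg0 dg0 Hg]]]].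
have G_lip := spectral_operator_lipschitz le_mn N_open sigmaN_open sub_sigmaN g_sym G_spec NXb g_lip.
apply/G_semismoothP; split=> //.
have [L [d1 [L0 d10 HL]]] := (locally_lipschitzP _ _).1 G_lip.
have [Lg [d2 [Lg0 d20 HLg]]] := (locally_lipschitzP _ _).1 g_lip.
have /near_distP[d3 d30 Hd3] : \forall Y \near Xb, N Y by apply: open_nbhs_nbhs.
pose c := m%:R * (2 * m%:R) : R.
have c0 : 0 <= c by rewrite !mulr_ge0.
have c1 : 0 < c + 1 by rewrite ltr_wpDl.
have sc X U V : svd_pair X U V -> `|sigma X - sigma Xb| <= c * `|X - Xb|.
  by move=> XE; have := sigma_lipschitz le_mn XE Xb_svd; rewrite mulrA; exact.
pose dl := Num.min (Num.min 1 d1) (Num.min d3 (Num.min dg d2 / (c + 1))).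
have dl0 : 0 < dl by rewrite !lt_min ltr01 d10 d30 divr_gt0// lt_min dg0.
(* A parameter is a matrix with one of its decompositions, so the constants below do not depend on
   the choice of factors. *)
pose T := (mat R k m n * 'M[K]_m * 'M[K]_n)%type.
pose A (t : T) := svd_pair t.1.1 t.1.2 t.2 /\ `|t.1.1 - Xb| < dl.
pose h (t : T) := `|t.1.1 - Xb|.
have h01 t : A t -> 0 <= h t <= 1.
  by move=> [_]; rewrite /dl !lt_min => /andP[/andP[/ltW ? _] _]; rewrite normr_ge0.
have [Ubo Vbo XbE] := Xb_svd.
pose S (t : T) : 'M[K]_(m, n) := D (sigma t.1.1).
pose Sb : 'M[K]_(m, n) := D (sigma Xb).
pose Tt (t : T) : 'M[K]_(m, n) := D (g (sigma t.1.1)).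
pose Tb : 'M[K]_(m, n) := D (g (sigma Xb)).
pose P (t : T) : 'M[K]_m := ctr t.1.2 *m Ub.
pose Q (t : T) : 'M[K]_n := ctr t.2 *m Vb.
have Po t : A t -> orthogonal_mx (P t).
  by move=> [[Uo _ _] _]; apply: orthogonal_mxM => //; exact: orthogonal_mx_ctr.
have Qo t : A t -> orthogonal_mx (Q t).
  by move=> [[_ Vo _] _]; apply: orthogonal_mxM => //; exact: orthogonal_mx_ctr.
have PO : matO A h 0 P by exact: matO_orthogonal.
have QO : matO A h 0 Q by exact: matO_orthogonal.
have SO : matO A h 1 (fun t => S t - Sb).
  exists c; split=> // t [XE _]; rewrite expr1 -diag0B fnorm_diag0//; exact: sc XE.
have sd t : A t -> `|sigma t.1.1 - sigma Xb| < Num.min dg d2.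
  move=> [XE]; rewrite /dl !lt_min => /and3P[_ _]; rewrite ltr_pdivlMr// => Xd.
  rewrite -lt_min (le_lt_trans _ Xd)// (le_trans (sc _ _ _ XE))// mulrC ler_wpM2l//.
  by rewrite lerDl.
have TO : matO A h 1 (fun t => Tt t - Tb).
  exists (Lg * c); split=> [|t At]; first exact: mulr_ge0.
  have [XE _] := At; rewrite expr1 -diag0B fnorm_diag0//.
  have := sd t At; rewrite lt_min => /andP[_ s2].
  apply: (le_trans (HLg _ _ s2 _)); first by rewrite subrr normr0.
  by rewrite -mulrA ler_wpM2l//; exact: sc XE.
have E1 : matO A h 1 (fun t => P t *m Sb - Sb *m Q t).
  (* [overlap_l] has [S t] on the left of [Q]; replacing it by [Sb] costs the first-order term (S -
     Sb) Q. *)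
  apply: (matO_ext (F := fun t => ctr t.1.2 *m (Xb - t.1.1) *m Vb + (S t - Sb) *m Q t)).
    move=> t [[Uo Vo XE] _]; rewrite (overlap_l Uo Vbo XE XbE) mulmxBl.
    by rewrite addrA subrK.
  apply: matOD; last by apply: (matOM (e := 1) (e' := 0)).
  exists 1; split=> // t [[Uo Vo XE] _]; rewrite mul1r expr1 /h distrC.
  by rewrite fnorm_mulr ?orthogonal_mxC// fnorm_mull// ctrK orthogonal_mxC.
have E2 : matO A h 1 (fun t => Q t *m ctr Sb - ctr Sb *m P t).
  apply: (matO_ext (F := fun t => ctr t.2 *m ctr (Xb - t.1.1) *m Ub + ctr (S t - Sb) *m P t)).
    move=> t [[Uo Vo XE] _]; rewrite (overlap_r Ubo Vo XE XbE) ctrB mulmxBl.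
    by rewrite addrA subrK.
  apply: matOD; last by apply: (matOM (e := 1) (e' := 0)) => //; exact: matO_ctr.
  exists 1; split=> // t [[Uo Vo XE] _]; rewrite mul1r expr1 /h distrC.
  by rewrite fnorm_mulr ?orthogonal_mxC// fnorm_mull ?fnorm_ctr// ctrK orthogonal_mxC.
have [sb_sorted sb_ge0 _] := svd_singular_values le_mn Xb_svd.
have [a [b [a_skew b_skew aO bO abE]]] := block_alignment le_mn h01 sb_ge0 Po Qo E1 E2.
have SbE := abE (sigma Xb) (fun _ _ e => e) (fun _ e => e).
have sXb : sigmaN (sigma Xb) by apply: sub_sigmaN; exists Xb.
(* By symmetry g(sigma Xb) is constant where sigma Xb is, and vanishes where it does, as
   [block_alignment] requires. *)
have TbE : matO A h 2 (fun t => P t *m Tb *m ctr (Q t) - Tb - (a t *m Tb - Tb *m b t)).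
  apply: abE => [i j sij|i]; last exact: sym_fix0 g_sym sXb.
  rewrite -[RHS]mul1r; apply: (sym_fix g_sym sXb); first by left.
  by rewrite mul1r.
(* Moves the tangent vector from Xb to X, where G is differentiable: a (F - F') and (F - F') b are
   products of two first-order factors. *)
have corr (F F' : T -> 'M[K]_(m, n)) : matO A h 1 (fun t => F t - F' t) ->
    matO A h 2 (fun t => P t *m F' t *m ctr (Q t) - F' t - (a t *m F' t - F' t *m b t)) ->
    matO A h 2 (fun t => P t *m F' t *m ctr (Q t) - F' t - (a t *m F t - F t *m b t)).
  move=> FO F'O; apply: (matO_ext (F := fun t =>
    (P t *m F' t *m ctr (Q t) - F' t - (a t *m F' t - F' t *m b t)) -
    (a t *m (F t - F' t) - (F t - F' t) *m b t))) => [t _|].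
    rewrite mulmxBr mulmxBl; move: (F' t) (P t *m F' t *m ctr (Q t))
      (F' t *m b t) (F t *m b t) (a t *m F' t) (a t *m F t).
    by move=> x1 x2 x3 x4 x5 x6; apply/matrixP => i j; rewrite !mxE; ring.
  by apply: matOB => //; apply: matOB; apply: (matOM (e := 1) (e' := 1)).
have [C1 [C10 HC1]] := corr _ _ SO SbE.
have [C2 [C20 HC2]] := corr _ _ TO TbE.
(* The terms come from the estimate of g at sigma X, with c the Lipschitz constant of sigma; from
   the remainder [R2] of G X - G Xb; and from G'(X) applied to the remainder [R1] of X - Xb. *)
exists (Cg * c `^ (1 + rho) + C2 + L * C1), dl; split=> //.
  by rewrite !addr_ge0 ?mulr_ge0 ?powR_ge0.
move=> X Xd dGX; have NX : N X.
  by apply: Hd3; move: Xd; rewrite /dl !lt_min => /and3P[_ ? _].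
have [U [V [XE GX]]] := G_spec NX.
pose t : T := (X, U, V).
have At : A t by [].
have [Uo Vo XE'] := XE.
have := sd t At; rewrite lt_min => /andP[/= sdg sd2].
pose emb (y : 'M[K]_(m, n)) : mat R k m n := U *m y *m ctr V.
have embN y : `|emb y| = fnorm y.
  by rewrite -[LHS]/(fnorm (U *m y *m ctr V)) fnorm_mulr ?ctrK// fnorm_mull.
have embB y z : emb (y - z) = emb y - emb z by rewrite /emb mulmxBr mulmxBl.
have embX : X = emb (S t) by [].
have NeX : N (emb (S t)) by rewrite -embX.
have dGe : differentiable G (emb (S t)) by rewrite -embX.
have dgX := differentiable_spectral_base le_mn N_open GE Uo Vo NeX dGe.
have diagE z := diff_spectral_diag le_mn N_open GE Uo Vo NeX z dGe dgX.
have tangE := diff_spectral_tangent le_mn N_open GE Uo Vo NeX (a_skew t) (b_skew t) dGe.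
have UP M : U *m (P t *m M *m ctr (Q t)) *m ctr V = Ub *m M *m ctr Vb.
  rewrite /P /Q ctrM ctrK !mulmxA (orthogonal_mxC Uo) mul1mx -!mulmxA.
  by rewrite (orthogonal_mxC Vo) mulmx1.
pose R1 := P t *m Sb *m ctr (Q t) - Sb - (a t *m S t - S t *m b t).
pose R2 := P t *m Tb *m ctr (Q t) - Tb - (a t *m Tt t - Tt t *m b t).
have XXb : X - Xb = emb (S t - Sb) - emb (a t *m S t - S t *m b t) - emb R1.
  have -> : X - Xb = emb (S t) - emb (P t *m Sb *m ctr (Q t)).
    by rewrite -embX /emb UP -XbE.
  by rewrite -!embB; congr emb; exact: subr_split.
have GXXb : G X - G Xb = emb (Tt t - Tb) - emb (a t *m Tt t - Tt t *m b t) - emb R2.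
  have -> : G Xb = emb (P t *m Tb *m ctr (Q t)).
    by rewrite /emb UP; exact: GE NXb Ubo Vbo XbE.
  have -> : G X = emb (Tt t) by [].
  by rewrite -!embB; congr emb; exact: subr_split.
have dL : forall v, `|'d G X v| <= L * `|v|.
  have Xd1 : `|X - Xb| < d1 by move: Xd; rewrite /dl !lt_min => /andP[/andP[_ ->]].
  apply: (@diff_lipschitz _ _ _ _ _ _ (d1 - `|X - Xb|)) => //; first by rewrite subr_gt0.
  move=> Y YX; apply: HL => //.
  by rewrite -(subrKA X) (le_lt_trans (ler_normD _ _))// -ltrBrDr.
have dE v : 'd G X v = 'd G (emb (S t)) v by exact: (congr1 (fun Y => 'd G Y v) embX).
have dXXb : 'd G X (X - Xb) = emb (D ('d g (sigma X) (sigma X - sigma Xb))) -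
    emb (a t *m Tt t - Tt t *m b t) - 'd G X (emb R1).
  have d1E : 'd G X (emb (S t - Sb)) = emb (D ('d g (sigma X) (sigma X - sigma Xb))).
    have -> : S t - Sb = D (sigma X - sigma Xb) by rewrite diag0B.
    by rewrite dE; exact: diagE.
  have d2E : 'd G X (emb (a t *m S t - S t *m b t)) = emb (a t *m Tt t - Tt t *m b t).
    by rewrite dE; exact: tangE.
  by rewrite [in LHS]XXb linearB linearB d1E d2E.
have -> : G X - G Xb - 'd G X (X - Xb) =
    emb (D (g (sigma X) - g (sigma Xb) - 'd g (sigma X) (sigma X - sigma Xb))) - emb R2 +
    'd G X (emb R1).
  by rewrite GXXb dXXb subr_cancel -(embB (Tt t - Tb)) !diag0B.
have h1 : 0 <= `|X - Xb| <= 1 := h01 t At.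
have h2 := sqr_le_powR h1 rho1.
have B1 : `|emb (D (g (sigma X) - g (sigma Xb) - 'd g (sigma X) (sigma X - sigma Xb)))| <=
    Cg * c `^ (1 + rho) * `|X - Xb| `^ (1 + rho).
  rewrite embN fnorm_diag0// (le_trans (Hg _ sdg dgX))// -mulrA ler_wpM2l//.
  rewrite -powRM//; apply: ge0_ler_powR; rewrite ?nnegrE ?mulr_ge0//.
    by rewrite addr_ge0// ltW.
  exact: sc XE.
have B2 : `|emb R2| <= C2 * `|X - Xb| `^ (1 + rho).
  by rewrite embN (le_trans (HC2 t At))// ler_wpM2l.
have B3 : `|'d G X (emb R1)| <= L * C1 * `|X - Xb| `^ (1 + rho).
  rewrite (le_trans (dL _))// -mulrA ler_wpM2l// embN (le_trans (HC1 t At))//.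
  by rewrite ler_wpM2l.
rewrite (le_trans (ler_normD _ _))// !mulrDl lerD//.
by rewrite (le_trans (ler_normB _ _))// lerD.
Qed.

End SemismoothTransfer.

(** * Polynomial spectral operators *)

Section HermiteInterpolation.
Context {R : realType}.
Implicit Types (p q : {poly R}) (x y : R).

(** A new node x is served by adding (a + b (y - x)) A(y)^2, where A vanishes at the earlier nodes:
    the square preserves values and derivatives there. At x, [a] fixes the value, then [b] the
    derivative. *)
Lemma hermite_interpolation (r : seq R) (f d : R -> R) :
  exists q, {in r, forall x, q.[x] = f x /\ q^`().[x] = d x}.
Proof.
elim: r => [|x r [q Hq]]; first by exists 0.
have [xr|xr] := boolP (x \in r).
  by exists q => y; rewrite inE => /orP[/eqP->|]; exact: Hq.
pose A := \prod_(y <- r) ('X - y%:P).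
have Ar y : y \in r -> A.[y] = 0 by move=> yr; apply/rootP; rewrite root_prod_XsubC.
have Ax : A.[x] != 0 by rewrite -[_ == 0]/(root A x) root_prod_XsubC.
pose a := (f x - q.[x]) / A.[x] ^+ 2.
pose b := (d x - q^`().[x] - a * (A ^+ 2)^`().[x]) / A.[x] ^+ 2.
pose Q := q + (a%:P + b *: ('X - x%:P)) * A ^+ 2.
have QE y : Q.[y] = q.[y] + (a + b * (y - x)) * A.[y] ^+ 2 by rewrite /Q !hornerE.
have dQE y : Q^`().[y] = q^`().[y] +
    (b * A.[y] ^+ 2 + (a + b * (y - x)) * (A ^+ 2)^`().[y]).
  rewrite /Q derivD derivM derivD derivC derivZ derivXsubC add0r alg_polyC.
  by rewrite !(hornerD, hornerM, hornerZ, hornerC, hornerX, hornerN, horner_exp).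
exists Q => y; rewrite inE => /orP[/eqP->|yr]; rewrite QE dQE.
  by rewrite subrr mulr0 addr0; split; rewrite /b /a; field.
have -> : (A ^+ 2)^`().[y] = 0 by rewrite expr2 derivM hornerD !hornerM Ar// mul0r mulr0 addr0.
by have [-> ->] := Hq y yr; rewrite Ar// expr0n /= !mulr0 !addr0.
Qed.

Definition odd_poly_of q : {poly R} := 'X * (q \Po 'X^2).

Lemma horner_odd q x : (odd_poly_of q).[x] = x * q.[x ^+ 2].
Proof. by rewrite /odd_poly_of !hornerE horner_comp !hornerE. Qed.

(** Interpolate q at the squares, distinct for distinct nonnegative nodes. For x != 0 the conditions
    are q(x^2) = f x / x and q(x^2) + 2 x^2 q'(x^2) = d x; at 0 the value is automatic and the
    derivative is q(0). *)
Lemma odd_hermite_interpolation (r : seq R) (f d : R -> R) :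
  {in r, forall x, 0 <= x} -> f 0 = 0 ->
  exists q, {in r, forall x, (odd_poly_of q).[x] = f x /\ (odd_poly_of q)^`().[x] = d x}.
Proof.
move=> r0 f0.
pose F z := let x := Num.sqrt z in if x == 0 then d 0 else f x / x.
pose E z := let x := Num.sqrt z in (d x - f x / x) / (2 * x ^+ 2).
have [q Hq] := hermite_interpolation [seq x ^+ 2 | x <- r] F E.
exists q => x xr; have [q1 q2] := Hq (x ^+ 2) (map_f _ xr).
move: q1 q2; rewrite /F /E sqrtr_sqr ger0_norm ?r0// => q1 q2.
have D : (odd_poly_of q)^`().[x] = q.[x ^+ 2] + 2 * x ^+ 2 * q^`().[x ^+ 2].
  rewrite /odd_poly_of derivM derivX mul1r deriv_comp derivXn.
  by rewrite hornerD !hornerM !horner_comp hornerMn !hornerXn ?hornerX ?expr1; ring.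
rewrite horner_odd D q1 q2; case: eqVneq => [->|x0].
  by rewrite f0 !mul0r expr0n /= !mulr0 mul0r addr0.
by split; field; rewrite ?x0.
Qed.

Lemma horner_bounded p x : exists2 C, 0 <= C & forall y, `|y - x| <= 1 -> `|p.[y]| <= C.
Proof.
elim/poly_ind: p => [|p c [C C0 HC]]; first by exists 0 => // y _; rewrite horner0 normr0.
exists (C * (`|x| + 1) + `|c|) => [|y yx]; first by rewrite addr_ge0// mulr_ge0// addr_ge0.
rewrite hornerD hornerM hornerX hornerC (le_trans (ler_normD _ _))// lerD2r normrM.
apply: ler_pM => //; first exact: HC.
by rewrite -(subrK x y) (le_trans (ler_normD _ _))// addrC lerD2l.
Qed.

(** Dividing twice by 'X - x gives the remainder v(y) (y - x)^2 with [v] a polynomial. *)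
Lemma horner_taylor p x : exists2 C, 0 <= C & forall y, `|y - x| <= 1 ->
  `|p.[y] - p.[x] - p^`().[x] * (y - x)| <= C * `|y - x| ^+ 2.
Proof.
have /factor_theorem[u uE] : root (p - p.[x]%:P) x by rewrite /root !hornerE subrr.
have /factor_theorem[v vE] : root (u - u.[x]%:P) x by rewrite /root !hornerE subrr.
have pE : p = u * ('X - x%:P) + p.[x]%:P by rewrite -uE subrK.
have uE' : u = v * ('X - x%:P) + u.[x]%:P by rewrite -vE subrK.
have dE : p^`().[x] = u.[x].
  have := congr1 (fun r : {poly R} => r^`().[x]) pE.
  by rewrite derivD derivM derivC derivXsubC addr0 mulr1 hornerD hornerM hornerXsubC subrr mulr0 add0r.
have [C C0 HC] := horner_bounded v x.
exists C => // y yx.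
have -> : p.[y] - p.[x] - p^`().[x] * (y - x) = v.[y] * (y - x) ^+ 2.
  have := congr1 (fun r : {poly R} => r.[y]) pE; rewrite hornerD hornerM hornerXsubC hornerC => ->.
  have := congr1 (fun r : {poly R} => r.[y]) uE'; rewrite hornerD hornerM hornerXsubC hornerC => ->.
  by rewrite dE; ring.
by rewrite normrM normrX ler_wpM2r// HC.
Qed.

End HermiteInterpolation.

Section PolynomialRvec.
Context {R : realType} {m : nat}.
Variable t : rvec R m.

Lemma horner_coord_taylor (p : {poly R}) : exists2 C, 0 <= C & forall x : rvec R m,
  `|x - t| <= 1 -> forall i,
  `|p.[x i 0] - p.[t i 0] - p^`().[t i 0] * (x i 0 - t i 0)| <= C * `|x - t| ^+ 2 /\
  `|p.[x i 0] - p.[t i 0]| <= C * `|x - t|.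
Proof.
have /choice[C HC] : forall i, exists C, 0 <= C /\ forall y, `|y - t i 0| <= 1 ->
  `|p.[y] - p.[t i 0] - p^`().[t i 0] * (y - t i 0)| <= C * `|y - t i 0| ^+ 2.
  by move=> i; have [C C0 HC] := horner_taylor p (t i 0); exists C.
have C0 i : 0 <= C i by have [] := HC i.
pose B i := C i + `|p^`().[t i 0]|.
have B0 i : 0 <= B i by rewrite addr_ge0.
exists (\sum_i B i) => [|x xt i]; first by apply: sumr_ge0.
have xti : `|x i 0 - t i 0| <= `|x - t| by have := le_rvec_norm (x - t) i; rewrite !mxE.
have BC : B i <= \sum_i B i by rewrite (bigD1 i)//= lerDl sumr_ge0.
have H1 : `|p.[x i 0] - p.[t i 0] - p^`().[t i 0] * (x i 0 - t i 0)| <= C i * `|x - t| ^+ 2.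
  have [_ H] := HC i; apply: (le_trans (H _ (le_trans xti xt))).
  by rewrite ler_wpM2l// ler_pXn2r// nnegrE.
split; first by rewrite (le_trans H1)// ler_wpM2r// (le_trans _ BC)// lerDl.
rewrite -(subrK (p^`().[t i 0] * (x i 0 - t i 0)) (p.[x i 0] - p.[t i 0])).
rewrite (le_trans (ler_normD _ _))//.
apply: (@le_trans _ _ (B i * `|x - t|)); last by rewrite ler_wpM2r.
rewrite mulrDl lerD//; last by rewrite normrM ler_wpM2l.
by rewrite (le_trans H1)// ler_wpM2l// expr2 ler_piMl.
Qed.

(* Absolutely symmetric when [P] and the [V d] are odd and the [E d] are even. *)
Definition poly_map (P : {poly R}) (E V : 'I_m -> {poly R}) (x : rvec R m) : rvec R m :=
  \col_i (P.[x i 0] + \sum_d (\sum_j (E d).[x j 0]) * (V d).[x i 0]).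

(** The sums of the [E d] vanish at [t], so they are of first order and each factor [V d] may be
    frozen at [t]. *)
Lemma frechet_poly_map P (E V : 'I_m -> {poly R}) (J : rvec R m -> rvec R m) :
  (forall d j, (E d).[t j 0] = 0) ->
  (forall h i, J h i 0 = P^`().[t i 0] * h i 0 +
     \sum_d (\sum_j (E d)^`().[t j 0] * h j 0) * (V d).[t i 0]) ->
  frechet (poly_map P E V) t J.
Proof.
move=> E0 JE e e0.
have [CP CP0 HP] := horner_coord_taylor P.
have /choice[CE HE] : forall d, exists C, 0 <= C /\ forall x : rvec R m,
  `|x - t| <= 1 -> forall i,
  `|(E d).[x i 0] - (E d).[t i 0] - (E d)^`().[t i 0] * (x i 0 - t i 0)| <= C * `|x - t| ^+ 2 /\
  `|(E d).[x i 0] - (E d).[t i 0]| <= C * `|x - t|.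
  by move=> d; have [C C0 HC] := horner_coord_taylor (E d); exists C.
have /choice[CV HV] : forall d, exists C, 0 <= C /\ forall x : rvec R m,
  `|x - t| <= 1 -> forall i,
  `|(V d).[x i 0] - (V d).[t i 0] - (V d)^`().[t i 0] * (x i 0 - t i 0)| <= C * `|x - t| ^+ 2 /\
  `|(V d).[x i 0] - (V d).[t i 0]| <= C * `|x - t|.
  by move=> d; have [C C0 HC] := horner_coord_taylor (V d); exists C.
pose VV d := \sum_i `|(V d).[t i 0]|.
pose B := CP + \sum_d (m%:R * CE d * VV d + m%:R * CE d * CV d).
have CE0 d : 0 <= CE d by have [] := HE d.
have CV0 d : 0 <= CV d by have [] := HV d.
have VV0 d : 0 <= VV d by apply: sumr_ge0.
have B0 : 0 <= B.
  by rewrite addr_ge0// sumr_ge0// => d _; rewrite addr_ge0// !mulr_ge0.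
have B1 : 0 < m%:R * B + 1 by rewrite ltr_wpDl// mulr_ge0.
exists (Num.min 1 (e / (m%:R * B + 1))) => [|x]; first by rewrite lt_min ltr01 divr_gt0.
rewrite lt_min => /andP[/ltW x1]; rewrite ltr_pdivlMr// => xe.
suff H i : `|(poly_map P E V x - poly_map P E V t - J (x - t)) i 0| <= B * `|x - t| ^+ 2.
  apply: (le_trans (rvec_norm_le _ H)); first by rewrite mulr_ge0.
  rewrite mulrA expr2 mulrA ler_wpM2r// (le_trans _ (ltW xe))// mulrC ler_wpM2l//.
  by rewrite lerDl.
pose S d := \sum_j (E d).[x j 0].
pose S1 d := \sum_j (E d)^`().[t j 0] * (x j 0 - t j 0).
have SS1 d : `|S d - S1 d| <= m%:R * CE d * `|x - t| ^+ 2.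
  rewrite /S /S1 -sumrB (le_trans (ler_norm_sum _ _ _))// -mulrA mulr_natl.
  rewrite -[X in _ *+ X](card_ord m) -sumr_const; apply: ler_sum => j _.
  by have [_ /(_ x x1 j)[+ _]] := HE d; rewrite E0 subr0.
have Sd d : `|S d| <= m%:R * CE d * `|x - t|.
  rewrite /S (le_trans (ler_norm_sum _ _ _))// -mulrA mulr_natl.
  rewrite -[X in _ *+ X](card_ord m) -sumr_const; apply: ler_sum => j _.
  by have [_ /(_ x x1 j)[_]] := HE d; rewrite E0 subr0.
have -> : (poly_map P E V x - poly_map P E V t - J (x - t)) i 0 =
   (P.[x i 0] - P.[t i 0] - P^`().[t i 0] * (x i 0 - t i 0)) +
   \sum_d ((S d - S1 d) * (V d).[t i 0] + S d * ((V d).[x i 0] - (V d).[t i 0])).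
  have subE (u v z : rvec R m) : (u - v - z) i 0 = u i 0 - v i 0 - z i 0 by rewrite !mxE.
  rewrite subE JE [poly_map _ _ _ x i 0]mxE [poly_map _ _ _ t i 0]mxE.
  rewrite [X in _ - (_ + X) - _]big1 => [|d _]; last first.
    by rewrite big1 ?mul0r// => j _; rewrite E0.
  have -> : \sum_d (\sum_j (E d)^`().[t j 0] * (x - t) j 0) * (V d).[t i 0] =
      \sum_d S1 d * (V d).[t i 0].
    by apply: eq_bigr => d _; congr (_ * _); apply: eq_bigr => j _; rewrite !mxE.
  have -> : \sum_d ((S d - S1 d) * (V d).[t i 0] + S d * ((V d).[x i 0] - (V d).[t i 0])) =
      \sum_d S d * (V d).[x i 0] - \sum_d S1 d * (V d).[t i 0].
    by rewrite -sumrB; apply: eq_bigr => d _; ring.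
  rewrite mxE [X in _ * (_ + X)]mxE addr0; ring.
have x2 : `|x - t| ^+ 2 = `|x - t| * `|x - t| by rewrite expr2.
rewrite (le_trans (ler_normD _ _))// /B mulrDl; apply: lerD.
  by have [H _] := HP x x1 i.
rewrite (le_trans (ler_norm_sum _ _ _))// mulr_suml; apply: ler_sum => d _.
rewrite (le_trans (ler_normD _ _))// !normrM [leRHS]mulrDl; apply: lerD.
  rewrite mulrAC; apply: ler_pM => //.
  by rewrite /VV (bigD1 i)//= lerDl sumr_ge0.
have [_ /(_ x x1 i)[_ H]] := HV d.
apply: (le_trans (ler_pM _ _ (Sd d) H)) => //.
by rewrite x2 le_eqVlt; apply/orP; left; apply/eqP; ring.
Qed.

End PolynomialRvec.

Lemma frechet_linear_differentiable (R : realType) (Z Z' : normedModType R) (F : Z -> Z') x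
    (L : Z -> Z') :
  linear L -> (exists C : R, forall h, `|L h| <= C * `|h|) -> frechet F x L ->
  differentiable F x.
Proof.
move=> Llin [C LC] FL.
pose LM := GRing.isLinear.Build _ _ _ _ _ Llin.
pose LL : {linear _ -> _} := HB.pack L LM.
by have [] := @frechet_differentiable _ _ _ F x LL C LC FL.
Qed.

Lemma bilinear_expansion (E : zmodType) (b1 b2 b3 b4 b5 b6 : E) :
  b5 - b2 + (b4 - b1 + b6) = b3 + b4 + (b5 + b6) - b3 - (b2 + b1).
Proof.
rewrite [b3 + b4]addrC [b4 + b3 + _]addrAC addrK [b4 + (b5 + b6)]addrCA opprD [RHS]addrACA.
by congr (_ + _); rewrite addrAC.
Qed.

(** Bilinearity over the reals is all that is asked, so that products involving [ctr] are covered
    for complex entries. *)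
Lemma differentiable_bilinear (R : realType) (Z V1 V2 W : normedModType R)
    (B : V1 -> V2 -> W) (C : R) (F1 : Z -> V1) (F2 : Z -> V2) x :
  0 <= C -> (forall v, linear (B v)) -> (forall v, linear (B^~ v)) ->
  (forall u v, `|B u v| <= C * (`|u| * `|v|)) ->
  differentiable F1 x -> differentiable F2 x ->
  differentiable (fun y => B (F1 y) (F2 y)) x.
Proof.
move=> C0 Br Bl BC d1 d2.
have BDr u v v' : B u (v + v') = B u v + B u v' by have := Br u 1 v v'; rewrite !scale1r.
have BDl u u' v : B (u + u') v = B u v + B u' v by have := Bl v 1 u u'; rewrite !scale1r.
have B0r u : B u 0 = 0 by apply: (addrI (B u 0)); rewrite -BDr !addr0.
have B0l v : B 0 v = 0 by apply: (addrI (B 0 v)); rewrite -BDl !addr0.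
have BZr a u v : B u (a *: v) = a *: B u v by have := Br u a v 0; rewrite B0r !addr0.
have BZl a u v : B (a *: u) v = a *: B u v by have := Bl v a u 0; rewrite B0l !addr0.
have BNr u v : B u (- v) = - B u v by rewrite -scaleN1r BZr scaleN1r.
have BNl u v : B (- u) v = - B u v by rewrite -scaleN1r BZl scaleN1r.
have [C1 C10 HC1] := diff_bounded d1; have [C2 C20 HC2] := diff_bounded d2.
pose L h := B ('d F1 x h) (F2 x) + B (F1 x) ('d F2 x h).
apply: (@frechet_linear_differentiable _ _ _ _ _ L).
- by move=> a u v; rewrite /L !linearP /= BDl BDr BZl BZr addrACA -scalerDr.
- exists (C * (C1 * `|F2 x|) + C * (`|F1 x| * C2)) => h.
  rewrite (le_trans (ler_normD _ _))// mulrDl; apply: lerD.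
    rewrite (le_trans (BC _ _))// -mulrA ler_wpM2l// mulrAC ler_wpM2r//; exact: HC1.
  rewrite (le_trans (BC _ _))// -!mulrA ler_wpM2l// ler_wpM2l//; exact: HC2.
move=> e e0.
pose K := C * `|F2 x| + C * `|F1 x| + C * ((C1 + 1) * (C2 + 1)) + 1.
have K0 : 0 < K by rewrite ltr_wpDl// !addr_ge0// !mulr_ge0// addr_ge0// ltW.
pose e' := Num.min 1 (e / K).
have e'0 : 0 < e' by rewrite lt_min ltr01 divr_gt0.
have [r1 r10 H1] := differentiable_frechet d1 e'0.
have [r2 r20 H2] := differentiable_frechet d2 e'0.
exists (Num.min (Num.min r1 r2) e') => [|y]; first by rewrite lt_min e'0 andbT lt_min r10.
rewrite lt_min => /andP[+ ye]; rewrite lt_min => /andP[yr1 yr2].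
set u := y - x in yr1 yr2 ye *.
have {}H1 := H1 y yr1; have {}H2 := H2 y yr2.
set D1 := F1 y - F1 x in H1; set D2 := F2 y - F2 x in H2.
have e'1 : e' <= 1 by rewrite /e' ge_min lexx.
have e'K : e' * K <= e by rewrite -ler_pdivlMr// /e' ge_min lexx orbT.
have D1_le : `|D1| <= (C1 + 1) * `|u|.
  rewrite -(subrK ('d F1 x u) D1) (le_trans (ler_normD _ _))// mulrDl addrC lerD//.
  by rewrite (le_trans H1)// ler_wpM2r.
have D2_le : `|D2| <= (C2 + 1) * `|u|.
  rewrite -(subrK ('d F2 x u) D2) (le_trans (ler_normD _ _))// mulrDl addrC lerD//.
  by rewrite (le_trans H2)// ler_wpM2r.
have -> : B (F1 y) (F2 y) - B (F1 x) (F2 x) - L u =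
   B (D1 - 'd F1 x u) (F2 x) + (B (F1 x) (D2 - 'd F2 x u) + B D1 D2).
  have -> : F1 y = F1 x + D1 by rewrite addrC subrK.
  have -> : F2 y = F2 x + D2 by rewrite addrC subrK.
  clearbody D1 D2.
  rewrite !BDl !BDr !BNl !BNr /L.
  move: (B (F1 x) ('d F2 x u)) (B ('d F1 x u) (F2 x)) (B (F1 x) (F2 x)) (B (F1 x) D2)
    (B D1 (F2 x)) (B D1 D2) => b1 b2 b3 b4 b5 b6.
  exact/esym/bilinear_expansion.
have T1 : `|B (D1 - 'd F1 x u) (F2 x)| <= e' * (C * `|F2 x|) * `|u|.
  have -> : e' * (C * `|F2 x|) * `|u| = C * (e' * `|u| * `|F2 x|) by ring.
  by rewrite (le_trans (BC _ _))// ler_wpM2l// ler_wpM2r.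
have T2 : `|B (F1 x) (D2 - 'd F2 x u)| <= e' * (C * `|F1 x|) * `|u|.
  have -> : e' * (C * `|F1 x|) * `|u| = C * (`|F1 x| * (e' * `|u|)) by ring.
  by rewrite (le_trans (BC _ _))// ler_wpM2l// ler_wpM2l.
have T3 : `|B D1 D2| <= e' * (C * ((C1 + 1) * (C2 + 1))) * `|u|.
  have -> : e' * (C * ((C1 + 1) * (C2 + 1))) * `|u| =
    C * (((C1 + 1) * `|u|) * ((C2 + 1) * e')) by ring.
  rewrite (le_trans (BC _ _))// ler_wpM2l// ler_pM// (le_trans D2_le)// ler_wpM2l ?(ltW ye)//.
  by rewrite addr_ge0// ltW.
have TK : e' * (C * `|F2 x|) * `|u| + (e' * (C * `|F1 x|) * `|u| +
    e' * (C * ((C1 + 1) * (C2 + 1))) * `|u|) <= e' * K * `|u|.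
  rewrite [leRHS](_ : _ = e' * (C * `|F2 x|) * `|u| + (e' * (C * `|F1 x|) * `|u| +
    e' * (C * ((C1 + 1) * (C2 + 1))) * `|u|) + e' * `|u|); last by rewrite /K; ring.
  by rewrite lerDl mulr_ge0// ltW.
apply: le_trans (le_trans TK _); last by rewrite ler_wpM2r.
by rewrite (le_trans (ler_normD _ _))// lerD// (le_trans (ler_normD _ _))// lerD.
Qed.

Section MatrixPolynomials.
Context {R : realType} {k : scalar_kind} {m n : nat}.
Hypothesis le_mn : (m <= n)%N.
Local Notation K := (scalars R k).
Local Notation D := (@diag0 R k m n).
Implicit Types (X Y : mat R k m n) (q : {poly R}).

(** The l-th power of X ctr(X), times X: singular values are raised to the power 2 l + 1. For a
    rectangular matrix these odd powers replace the usual ones. *)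
Definition mxodd_power (l : nat) X : mat R k m n := iter l (fun Y => X *m ctr X *m Y) X.

Definition mxodd_poly q X : mat R k m n := \sum_(l < size q) q`_l *: mxodd_power l X.

(** The inner product is a symmetric function of all singular values; it couples the coordinates, as
    the off-diagonal entries of a Jacobian demand. *)
Definition mxpoly_map (P : {poly R}) (E V : 'I_m -> {poly R}) X : mat R k m n :=
  mxodd_poly P X + \sum_d mat_dot X (mxodd_poly (E d) X) *: mxodd_poly (V d) X.

Lemma mat_dot_le X Y : `|mat_dot X Y| <= `|X| * `|Y|.
Proof.
rewrite -(@ler_pXn2r _ 2%N)// ?nnegrE ?mulr_ge0// exprMn real_normK ?num_real//.
rewrite -[`|X| ^+ 2]/(fnorm X ^+ 2) -[`|Y| ^+ 2]/(fnorm Y ^+ 2) !sqr_fnorm_dot.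
exact: (ip_cauchy_schwarz mat_dotC mat_dotD mat_dotZ mat_dot_ge0 (@mat_dot_eq0 R k m n)).
Qed.

Lemma differentiable_mulmx (p q r : nat) (F1 : mat R k m n -> mat R k p q)
    (F2 : mat R k m n -> mat R k q r) X :
  differentiable F1 X -> differentiable F2 X ->
  differentiable ((fun Y => F1 Y *m F2 Y) : mat R k m n -> mat R k p r) X.
Proof.
apply: (@differentiable_bilinear R (mat R k m n) (mat R k p q) (mat R k q r) (mat R k p r)
  (fun A B => A *m B) (p * r * q)%:R F1 F2 X) => //.
- move=> v a x y; rewrite -[a *: x]/(of_real a *: (x : 'M[K]_(q, r))) mulmxDr.
  by rewrite -scalemxAr.
- move=> v a x y; rewrite -[a *: x]/(of_real a *: (x : 'M[K]_(p, q))) mulmxDl.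
  by rewrite -scalemxAl.
- by move=> u v; exact: fnormM.
Qed.

Lemma differentiable_gram X :
  differentiable ((fun Y => Y *m ctr Y) : mat R k m n -> mat R k m m) X.
Proof.
apply: (@differentiable_bilinear R (mat R k m n) (mat R k m n) (mat R k m n) (mat R k m m)
  (fun A B => A *m ctr B) (m * m * n)%:R (fun Y => Y) (fun Y => Y) X) => //.
- move=> v a x y; rewrite -[a *: x]/(of_real a *: (x : 'M[K]_(m, n))) ctrD ctrZ mulmxDr.
  by rewrite -scalemxAr.
- move=> v a x y; rewrite -[a *: x]/(of_real a *: (x : 'M[K]_(m, n))) mulmxDl.
  by rewrite -scalemxAl.
- by move=> u v; have := fnormM u (ctr v); rewrite fnorm_ctr; exact.
Qed.

Lemma differentiable_mxodd_poly q X : differentiable (mxodd_poly q) X.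
Proof.
rewrite /mxodd_poly.
have -> : (fun Y => \sum_(l < size q) q`_l *: mxodd_power l Y) =
    \sum_(l < size q) (fun Y => q`_l *: mxodd_power l Y) by apply/funext => Y; rewrite fct_sumE.
apply: differentiable_sum => l; apply: differentiableZ.
elim: (l : nat) => [|j IH]; first by rewrite /mxodd_power.
exact: (differentiable_mulmx (differentiable_gram X) IH).
Qed.

Lemma differentiable_mxpoly_map P (E V : 'I_m -> {poly R}) X :
  differentiable (mxpoly_map P E V) X.
Proof.
have -> : mxpoly_map P E V = mxodd_poly P +
    \sum_d (fun Y => mat_dot Y (mxodd_poly (E d) Y) *: mxodd_poly (V d) Y).
  apply/funext => Y; rewrite /mxpoly_map; congr (_ + _).
  by rewrite fct_sumE.
apply: differentiableD; first exact: differentiable_mxodd_poly.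
apply: differentiable_sum => d.
apply: (@differentiable_bilinear R (mat R k m n) R (mat R k m n) (mat R k m n)
  (fun a Y => a *: Y) 1 (fun Y => mat_dot Y (mxodd_poly (E d) Y)) (mxodd_poly (V d)) X) => //.
- by move=> v a x y; rewrite scalerDr !scalerA mulrC.
- by move=> v a x y; rewrite scalerDl scalerA.
- by move=> u v; rewrite normrZ mul1r.
- apply: (@differentiable_bilinear R (mat R k m n) (mat R k m n) (mat R k m n) R
    mat_dot 1 (fun Y => Y) (mxodd_poly (E d)) X) => //.
  + by move=> v a x y; rewrite mat_dotC mat_dotD mat_dotZ !(mat_dotC v).
  + by move=> v a x y; rewrite mat_dotD mat_dotZ.
  + by move=> u v; rewrite mul1r; exact: mat_dot_le.
  + exact: differentiable_mxodd_poly.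
- exact: differentiable_mxodd_poly.
Qed.

Section OnDiagonal.
Variables (U : 'M[K]_m) (V : 'M[K]_n).
Hypotheses (Uo : orthogonal_mx U) (Vo : orthogonal_mx V).
Let emb (s : rvec R m) : mat R k m n := U *m D s *m ctr V.

Let embD s s' : emb (s + s') = emb s + emb s'.
Proof. by rewrite /emb diag0D mulmxDr mulmxDl. Qed.

Let embZ (a : R) s : emb (a *: s) = a *: emb s.
Proof. by rewrite /emb diag0Z -scalemxAr -scalemxAl. Qed.

Let emb_sum (I : Type) (r : seq I) (f : I -> rvec R m) :
  emb (\sum_(i <- r) f i) = \sum_(i <- r) emb (f i).
Proof.
elim/big_rec2: _ => [|i y x _ <-]; last by rewrite embD.
by rewrite -(scale0r (0 : rvec R m)) embZ scale0r.
Qed.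

Let mxodd_power_diag l s : mxodd_power l (emb s) = emb (\col_i (s i 0 ^+ (l.*2.+1))).
Proof.
elim: l => [|l IH].
  by rewrite /mxodd_power /=; congr emb; apply/matrixP => i j; rewrite mxE ord1 expr1.
rewrite /mxodd_power /= -/(mxodd_power l (emb s)) IH /emb.
rewrite !ctrM ctrK !mulmxA -(mulmxA _ (ctr V) V) (Vo : ctr V *m V = _) mulmx1.
rewrite -(mulmxA _ (ctr U) U) (Uo : ctr U *m U = _) mulmx1.
congr (_ *m _); rewrite -!mulmxA; congr (_ *m _).
apply/matrixP => i j; rewrite diag0_mulmx// ctr_diag0_mulmx// !mxE.
case: ifP => _; last by rewrite !mulr0.
by rewrite -!rmorphM /= mulrA -expr2 -exprD.
Qed.

Lemma mxodd_poly_diag q s :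
  mxodd_poly q (emb s) = emb (\col_i (odd_poly_of q).[s i 0]).
Proof.
rewrite /mxodd_poly.
under eq_bigr do rewrite mxodd_power_diag -embZ.
rewrite -emb_sum; congr emb; apply/matrixP => i j; rewrite ord1 mxE summxE horner_odd.
rewrite horner_coef mulr_sumr; apply: eq_bigr => l _; rewrite !mxE.
by rewrite exprS -muln2 mulnC exprM mulrCA.
Qed.

(** Polarisation of the isometry [emb]. *)
Let mat_dot_diag s s' : mat_dot (emb s) (emb s') = \sum_i s i 0 * s' i 0.
Proof.
have sq (z : rvec R m) : mat_dot (emb z) (emb z) = \sum_i z i 0 ^+ 2.
  rewrite -sqr_fnorm_dot -sqr_rvec_norm -(fnorm_diag0 (k := k) le_mn) /emb.
  by rewrite fnorm_mulr ?ctrK// fnorm_mull.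
have := sq (s + s'); rewrite embD mat_dotD (mat_dotC (emb s) (_ + _)).
rewrite (mat_dotC (emb s') (_ + _)) !mat_dotD (mat_dotC (emb s') (emb s)) !sq.
have -> : \sum_i (s + s') i 0 ^+ 2 =
    \sum_i s i 0 ^+ 2 + \sum_i s' i 0 ^+ 2 + 2 * \sum_i s i 0 * s' i 0.
  by rewrite mulr_sumr -!big_split /=; apply: eq_bigr => i _; rewrite mxE; ring.
lra.
Qed.

Lemma mxpoly_map_diag P (E V' : 'I_m -> {poly R}) s :
  mxpoly_map P E V' (emb s) =
  emb (poly_map (odd_poly_of P) (fun d => 'X * odd_poly_of (E d)) (fun d => odd_poly_of (V' d)) s).
Proof.
rewrite /mxpoly_map mxodd_poly_diag.
under eq_bigr do rewrite !mxodd_poly_diag mat_dot_diag -embZ.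
rewrite -emb_sum -embD; congr emb; apply/matrixP => i j; rewrite ord1 !mxE summxE.
congr (_ + _); apply: eq_bigr => d _; rewrite !mxE; congr (_ * _).
by apply: eq_bigr => l _; rewrite mxE [RHS]hornerM hornerX.
Qed.

End OnDiagonal.
End MatrixPolynomials.

(** * Differentiability of G and semismoothness of g *)

Section SignedPermutationInverse.
Context {R : realType} {m : nat}.
Variables (e : 'I_m -> R) (p : {perm 'I_m}).
Hypothesis e1 : forall i, e i = 1 \/ e i = -1.
Implicit Types x : rvec R m.

Let e' i := e (perm_inv p i).

Lemma sactK : cancel (sact e p) (sact e' (perm_inv p)).
Proof.
by move=> x; apply/matrixP => i j; rewrite !mxE ord1 permKV (sign_mulK _ (e1 _)).
Qed.

Lemma sactVK : cancel (sact e' (perm_inv p)) (sact e p).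
Proof.
by move=> x; apply/matrixP => i j; rewrite !mxE ord1 /e' permK (sign_mulK _ (e1 _)).
Qed.

Variables (g : rvec R m -> rvec R m) (A : set (rvec R m)) (t : rvec R m).
Hypotheses (A_open : open A) (gA : absolutely_symmetric g A) (At : A t).

(** Near [t], equivariance writes g as its conjugate by a signed permutation, which is an
    isometry. *)
Lemma frechet_sact L : frechet g (sact e p t) L ->
  frechet g t (fun h => sact e' (perm_inv p) (L (sact e p h))).
Proof.
move=> gL c c0; have [d d0 Hd] := gL c c0.
have /near_distP[d' d'0 Hd'] : \forall y \near t, A y by apply: open_nbhs_nbhs.
exists (Num.min d d') => [|y]; first by rewrite lt_min d0.
rewrite lt_min => /andP[yd yd'].
have E : sact e p y - sact e p t = sact e p (y - t) by rewrite sactD sactN.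
rewrite -[g y]sactK -[g t]sactK -!(sym_sact p gA _ e1)//; last exact: Hd'.
rewrite -!sactN -!sactD sact_norm; last by move=> i; exact: e1.
rewrite -(sact_norm p (y - t) e1) -E; apply: Hd.
by rewrite E sact_norm.
Qed.

Lemma differentiable_sact : differentiable g (sact e p t) -> differentiable g t.
Proof.
move=> dg; have [C C0 HC] := diff_bounded dg.
apply: frechet_linear_differentiable (frechet_sact (differentiable_frechet dg)).
- by move=> a x y; rewrite sactD sactZ linearP sactD sactZ.
- exists C => h; rewrite sact_norm; last by move=> i; exact: e1.
  by rewrite (le_trans (HC _))// sact_norm.
Qed.

End SignedPermutationInverse.

(** * Symmetries of the Jacobian of g and its interpolation *)

Section SymmetricJet.
Context {R : realType} {m : nat}.
Variables (g : rvec R m -> rvec R m) (A : set (rvec R m)) (t : rvec R m).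
Hypotheses (A_open : open A) (gA : absolutely_symmetric g A) (At : A t).
Hypotheses (t_ge0 : forall i, 0 <= t i 0) (dg : differentiable g t).

Let J : rvec R m -> rvec R m := 'd g t.

(** [sswap] fixes [t], so conjugating [J] by it gives another derivative of [g] at [t]; derivatives
    are unique. *)
Let J_sswap a i j h : a = 1 \/ a = -1 -> t i 0 = a * t j 0 ->
  J (sswap a i j h) = sswap a i j (J h).
Proof.
move=> a1 tij; have [C C0 HC] := diff_bounded dg.
pose e := fun l => if (l == i) || (l == j) then a else 1.
have e1 l : e l = 1 \/ e l = -1 by exact: sswap_sign.
have tE : sact e (tperm i j) t = t by exact: sswap_fix.
have := @frechet_sact _ _ _ (tperm i j) e1 g A t A_open gA At J.
rewrite tE => /(_ (differentiable_frechet dg)) H.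
have hom (b : R) x : sact (fun l => e (perm_inv (tperm i j) l)) (perm_inv (tperm i j))
    (J (sact e (tperm i j) (b *: x))) = b *: sact (fun l => e (perm_inv (tperm i j) l))
    (perm_inv (tperm i j)) (J (sact e (tperm i j) x)).
  by rewrite sactZ /J linearZ sactZ.
have Jh := congr1 (fun f => f h) (frechet_eq HC (differentiable_frechet dg) H hom).
by rewrite /= -/(J h) in Jh; rewrite -Jh /sswap -/e sactVK.
Qed.

Let ev (j : 'I_m) : rvec R m := \col_l (l == j)%:R.
Let c i j := J (ev j) i 0.

Let JE h i : J h i 0 = \sum_j c i j * h j 0.
Proof.
have {1}-> : h = \sum_j h j 0 *: ev j.
  apply/matrixP => l j; rewrite ord1 summxE (bigD1 l)//= !mxE eqxx mulr1.
  by rewrite big1 ?addr0// => b bl; rewrite !mxE eq_sym (negPf bl) mulr0.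
rewrite /J linear_sum summxE; apply: eq_bigr => j _.
by rewrite linearZ mxE mulrC.
Qed.

Let c_tperm i j l b : t i 0 = t j 0 -> c (tperm i j l) (tperm i j b) = c l b.
Proof.
move=> tij; have := @J_sswap 1 i j (ev (tperm i j b)) (or_introl erefl).
rewrite mul1r => /(_ tij)/matrixP/(_ l 0).
rewrite [RHS]mxE (_ : (if _ then _ else _) = 1) ?mul1r; last by case: ifP.
rewrite /c => <-; congr (J _ _ _); apply/matrixP => u v; rewrite !mxE.
by rewrite (_ : (if _ then _ else _) = 1) ?mul1r ?(inj_eq perm_inj)//; case: ifP.
Qed.

(** Flipping the sign of a zero coordinate of [t] fixes [t], negates [ev i] and preserves coordinate
    [l] of the image, so c l i = - c l i. *)
Let c_zero_r i l : t i 0 = 0 -> l != i -> c l i = 0.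
Proof.
move=> ti li; have := @J_sswap (-1) i i (ev i) (or_intror erefl).
rewrite ti mulr0 => /(_ erefl)/matrixP/(_ l 0); rewrite sswapD//.
have -> : sswap (-1) i i (ev i) = - ev i.
  apply/matrixP => u v; rewrite {v}ord1; have [->|ui] := eqVneq u i.
    by rewrite sswapL mulN1r !mxE.
  by rewrite sswapD// !mxE (negPf ui) oppr0.
by rewrite /J linearN mxE -/J -/(c l i); lra.
Qed.

Let c_zero_l i l : t i 0 = 0 -> l != i -> c i l = 0.
Proof.
move=> ti li; have := @J_sswap (-1) i i (ev l) (or_intror erefl).
rewrite ti mulr0 => /(_ erefl)/matrixP/(_ i 0); rewrite sswapL.
have -> : sswap (-1) i i (ev l) = ev l.
  apply: sswap_fix; first by right.
  by rewrite mxE eq_sym (negPf li) mulr0.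
by rewrite -/(c i l); lra.
Qed.

Let c_eql i k j : t i 0 = t k 0 -> i != j -> k != j -> c i j = c k j.
Proof. by move=> tik ij kj; rewrite -(c_tperm k j tik) tpermR tpermD. Qed.

Let c_eqr i j l : t j 0 = t l 0 -> i != j -> i != l -> c i j = c i l.
Proof. by move=> tjl ij il; rewrite -(c_tperm i l tjl) tpermR tpermD// eq_sym. Qed.

(** Indices are changed one at a time in an order that avoids diagonal entries; when k = j and l = i
    no such order exists, and a transposition exchanges both at once. *)
Let c_offdiag i j k l : t i 0 = t k 0 -> t j 0 = t l 0 -> i != j -> k != l -> c i j = c k l.
Proof.
move=> tik tjl ij kl; have [li|li] := eqVneq l i; last first.
  by rewrite (c_eqr tjl ij) 1?eq_sym// (c_eql tik)// eq_sym.
rewrite {}li in tjl kl *; have [kj|kj] := eqVneq k j.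
  by rewrite kj -(c_tperm j i (esym tjl)) tpermL tpermR.
by rewrite (c_eql tik)// (c_eqr tjl).
Qed.

Let c_diag i k : t i 0 = t k 0 -> c i i = c k k.
Proof. by move=> tik; rewrite -(c_tperm k k tik) tpermR. Qed.

Let b (x y : R) : R :=
  if [pick ij : 'I_m * 'I_m | [&& ij.1 != ij.2, t ij.1 0 == x & t ij.2 0 == y]] is Some ij
  then c ij.1 ij.2 else 0.

Let bE i j : i != j -> b (t i 0) (t j 0) = c i j.
Proof.
move=> ij; rewrite /b; case: pickP => [[k l] /= /and3P[kl /eqP tk /eqP tl]|/(_ (i, j))/=].
  exact: c_offdiag.
by rewrite ij !eqxx.
Qed.

Let b0l y : b 0 y = 0.
Proof.
rewrite /b; case: pickP => [[k l] /= /and3P[kl /eqP tk _]|//].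
by rewrite c_zero_l// eq_sym.
Qed.

Let b0r x : b x 0 = 0.
Proof.
rewrite /b; case: pickP => [[k l] /= /and3P[kl _ /eqP tl]|//].
by rewrite c_zero_r.
Qed.

(** Interpolating [b] also puts b x x on the diagonal of the Jacobian, which is subtracted here. If
    x occurs only once in [t], then b x x is the default 0. *)
Let a (x : R) : R :=
  if [pick i : 'I_m | t i 0 == x] is Some i then c i i - b x x else 0.

Let aE i : a (t i 0) = c i i - b (t i 0) (t i 0).
Proof.
rewrite /a; case: pickP => [k /eqP tk|/(_ i)]; last by rewrite eqxx.
by rewrite (c_diag tk).
Qed.

Let f (x : R) : R := if [pick i : 'I_m | t i 0 == x] is Some i then g t i 0 else 0.

Let fE i : f (t i 0) = g t i 0.
Proof.
rewrite /f; case: pickP => [k /eqP tk|/(_ i)]; last by rewrite eqxx.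
rewrite -[RHS]mul1r; apply: (sym_fix gA At); first by left.
by rewrite mul1r.
Qed.

Let f0 : f 0 = 0.
Proof. by rewrite /f; case: pickP => // k /eqP tk; exact: sym_fix0 gA At tk. Qed.

(* Divides out the repetition of the value [y] in sums over indices. *)
Let mult (y : R) : R := \sum_j (t j 0 == y)%:R.

(* By symmetry, for [i != j] the entry [c i j] of the Jacobian of [g] at [t] depends
   only on the values [t i] and [t j], so that it can be interpolated. *)
Lemma poly_map_jet : exists (P : {poly R}) (E V : 'I_m -> {poly R}),
  let G := poly_map (odd_poly_of P) (fun d => 'X * odd_poly_of (E d)) (fun d => odd_poly_of (V d)) in
  G t = g t /\ frechet G t J.
Proof.
pose r := [seq t i 0 | i <- enum 'I_m].
have tr i : t i 0 \in r by apply: map_f; rewrite mem_enum.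
have r0 : {in r, forall x, 0 <= x} by move=> _ /mapP[i _ ->].
have [P HP] := @odd_hermite_interpolation R r f a r0 f0.
(* 'X * E_d then has derivative 1 at the nodes equal to t_d and 0 at the others. If t_d = 0 it is 0
   everywhere on the nodes, which is harmless because [b] vanishes when an argument does. *)
have /choice[E HE] : forall d : 'I_m, exists q, {in r, forall x,
    (odd_poly_of q).[x] = 0 /\ (odd_poly_of q)^`().[x] = if x == t d 0 then x^-1 else 0}.
  by move=> d; exact: (@odd_hermite_interpolation R r (fun=> 0)).
(* All d with the same value t_d contribute the same term, [mult] times in all. *)
have /choice[V HV] : forall d : 'I_m, exists q, {in r, forall x,
    (odd_poly_of q).[x] = b x (t d 0) / mult (t d 0) /\ (odd_poly_of q)^`().[x] = 0}.
  move=> d.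
  apply: (@odd_hermite_interpolation R r (fun x => b x (t d 0) / mult (t d 0)) (fun=> 0)) => //.
  by rewrite b0l mul0r.
have E0 d j : ('X * odd_poly_of (E d)).[t j 0] = 0.
  by rewrite hornerM (HE d _ (tr j)).1 mulr0.
exists P, E, V; split.
  apply/matrixP => i j; rewrite ord1 mxE (HP _ (tr i)).1 fE big1 ?addr0// => d _.
  by rewrite big1 ?mul0r.
apply: frechet_poly_map => // h i.
have dE d j : ('X * odd_poly_of (E d))^`().[t j 0] = ((t j 0 == t d 0) && (t j 0 != 0))%:R.
  have [] := HE d _ (tr j); move: (odd_poly_of (E d)) => o o1 o2.
  rewrite derivM derivX mul1r hornerD hornerM hornerX o1 o2 add0r.
  have [_|_] := eqVneq (t j 0) (t d 0); last by rewrite mulr0.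
  by have [->|t0] := eqVneq (t j 0) 0; rewrite ?mul0r// mulfV.
have -> : \sum_d (\sum_j ('X * odd_poly_of (E d))^`().[t j 0] * h j 0) * (odd_poly_of (V d)).[t i 0] =
    \sum_j b (t i 0) (t j 0) * h j 0.
  under eq_bigr do rewrite mulr_suml.
  rewrite exchange_big /=; apply: eq_bigr => j _.
  have [tj0|tj0] := eqVneq (t j 0) 0.
    by rewrite [X in b _ X]tj0 b0r mul0r big1// => d _; rewrite dE tj0 eqxx andbF !mul0r.
  have mj : mult (t j 0) != 0.
    rewrite gt_eqF// /mult (bigD1 j)//= eqxx ltr_pwDl// sumr_ge0// => l _.
  rewrite (eq_bigr (fun d => (t d 0 == t j 0)%:R * (b (t i 0) (t j 0) / mult (t j 0) * h j 0))).
    by rewrite -mulr_suml -/(mult _); field.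
  move=> d _; rewrite dE tj0 andbT (HV d _ (tr i)).1 eq_sym.
  by case: eqVneq => [->|_]; rewrite ?mul0r//= !mul1r mulrC.
rewrite JE (HP _ (tr i)).2 aE (bigD1 i)//= [in RHS](bigD1 i)//=.
rewrite (eq_bigr (fun j => b (t i 0) (t j 0) * h j 0)); last first.
  by move=> j ji; rewrite bE// eq_sym.
by ring.
Qed.

End SymmetricJet.

Section DifferentiableSpectral.
Context {R : realType} {k : scalar_kind} {m n : nat}.
Hypothesis le_mn : (m <= n)%N.
Local Notation K := (scalars R k).
Local Notation D := (@diag0 R k m n).
Variables (N : set (mat R k m n)) (N_open : open N).
Variables (g : rvec R m -> rvec R m) (sigmaN : set (rvec R m)) (sigmaN_open : open sigmaN).
Hypothesis sub_sigmaN : [set sigma X | X in N] `<=` sigmaN.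
Hypothesis g_sym : absolutely_symmetric g sigmaN.
Variables (G : mat R k m n -> mat R k m n) (G_spec : spectral_operator g N G).

(* Subtract the matrix polynomial map with the same 1-jet: the values of the difference
   have norm o(|sigma Y - sigma X|), and sigma is Lipschitz continuous. *)
Lemma differentiable_spectral (X : mat R k m n) :
  N X -> differentiable g (sigma X) -> differentiable G X.
Proof.
move=> NX dg; have [U [V [XE GX]]] := G_spec NX.
have sX : sigmaN (sigma X) by apply: sub_sigmaN; exists X.
have [s_sorted s_ge0 _] := svd_singular_values le_mn XE.
have [P [E [W]]] := poly_map_jet sigmaN_open g_sym sX s_ge0 dg.
set gt := poly_map _ _ _ => -[gtX gtJ].
pose Gt : mat R k m n -> mat R k m n := mxpoly_map P E W.
have GtE (Y : mat R k m n) U' V' : svd_pair Y U' V' -> Gt Y = U' *m D (gt (sigma Y)) *m ctr V'.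
  by move=> [Uo Vo YE]; rewrite {1}YE; exact: (mxpoly_map_diag le_mn Uo Vo).
clearbody gt.
have dGt : differentiable Gt X by exact: differentiable_mxpoly_map.
have [C C0 HC] := diff_bounded dGt.
have GtX : Gt X = G X by rewrite (GtE _ _ _ XE) gtX GX.
pose c := m%:R * (2 * m%:R) : R.
have c0 : 0 <= c by rewrite !mulr_ge0.
have c1 : 0 < c + 1 by rewrite ltr_wpDl.
apply: (@frechet_linear_differentiable _ _ _ _ _ ('d Gt X)).
- by move=> a x y; rewrite linearP.
- by exists C.
move=> e e0.
have e3 : 0 < e / 2 by rewrite divr_gt0.
have [r1 r10 H1] := differentiable_frechet dGt e3.
have e4 : 0 < e / 2 / (c + 1) by rewrite divr_gt0.
have [r2 r20 H2] := frechet_same_jet gtX (differentiable_frechet dg) gtJ e4.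
have /near_distP[r4 r40 H4] : \forall Y \near X, N Y by apply: open_nbhs_nbhs.
exists (Num.min (Num.min r1 r4) (r2 / (c + 1))) => [|Y].
  by rewrite !lt_min r10 r40 divr_gt0.
rewrite !lt_min ltr_pdivlMr// => /andP[/andP[Y1 Y4] Y2].
have NY := H4 _ Y4; have [U' [V' [YE GY]]] := G_spec NY.
have sYX : `|sigma Y - sigma X| <= c * `|Y - X|.
  by have := sigma_lipschitz le_mn YE XE; rewrite mulrA; exact.
have [U'o V'o _] := YE.
(* [Gt Y] is computed with the factors used for [G Y], so the difference is an isometric image of
   the difference of [g] and [gt] at sigma Y. *)
have B : `|G Y - Gt Y| <= e / 2 * `|Y - X|.
  rewrite GY (GtE _ _ _ YE) -[leLHS]/(fnorm (U' *m D (g (sigma Y)) *m ctr V' -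
    U' *m D (gt (sigma Y)) *m ctr V')).
  rewrite -mulmxBl -mulmxBr fnorm_mulr ?ctrK// fnorm_mull// -diag0B fnorm_diag0//.
  have cY : `|sigma Y - sigma X| / (c + 1) <= `|Y - X|.
    by rewrite ler_pdivrMr// (le_trans sYX)// mulrC ler_wpM2l// lerDl.
  apply: (le_trans (H2 _ _)).
    by rewrite (le_lt_trans sYX)// (le_lt_trans _ Y2)// mulrC ler_wpM2l// lerDl.
  by rewrite -mulrA (mulrC (c + 1)^-1) ler_wpM2l// ltW.
have -> : G Y - G X - 'd Gt X (Y - X) = (G Y - Gt Y) + (Gt Y - Gt X - 'd Gt X (Y - X)).
  by rewrite GtX addrA addrA subrK.
rewrite (le_trans (ler_normD _ _))//.
by rewrite [e]splitr mulrDl; apply: lerD => //; exact: H1.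
Qed.

(** [emb] is a linear isometry that carries g to G and maps sigma Xb to Xb, so the estimate of G at
    [emb s] is that of g at [s], once G is known to be differentiable there. *)
Lemma semismooth_spectral_conv (Xb : mat R k m n) (Ub : 'M[K]_m) (Vb : 'M[K]_n) (rho : R) :
  N Xb -> svd_pair Xb Ub Vb -> locally_lipschitz_near g (sigma Xb) ->
  G_semismooth G Xb rho -> G_semismooth g (sigma Xb) rho.
Proof.
move=> NXb Xb_svd g_lip /G_semismoothP[_ [C [d [C0 d0 Hd]]]].
apply/G_semismoothP; split=> //.
have GE := spectral_operatorE le_mn sub_sigmaN g_sym G_spec.
have [Ubo Vbo XbE] := Xb_svd.
pose emb (y : rvec R m) : mat R k m n := Ub *m D y *m ctr Vb.
have embB y z : emb (y - z) = emb y - emb z by rewrite /emb diag0B mulmxBr mulmxBl.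
have embN y : `|emb y| = `|y|.
  rewrite -[LHS]/(fnorm (Ub *m D y *m ctr Vb)) fnorm_mulr ?ctrK// fnorm_mull//.
  exact: fnorm_diag0.
have /near_distP[r r0 Hr] : \forall Y \near Xb, N Y by apply: open_nbhs_nbhs.
exists C, (Num.min d r); split=> //; first by rewrite lt_min d0.
move=> s; rewrite lt_min => /andP[sd sr] dgs.
have XsE : emb s - Xb = emb (s - sigma Xb) by rewrite embB /emb -XbE.
have NX : N (emb s) by apply: Hr; rewrite XsE embN.
have [U [V [X_svd GX]]] := G_spec NX.
have sX : sigmaN (sigma (emb s)) by apply: sub_sigmaN; exists (emb s).
(* [s] need not be nonnegative or sorted: sigma(emb s) is a signed permutation of it, to which
   differentiability of g is transported by symmetry. *)
have [e [p [t [e1 st t1 t0]]]] := signed_sort s.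
have tE : sigma (emb s) = t.
  apply: (sigma_svd le_mn Ubo Vbo (e := e) (p := p)) => //.
  by rewrite -st.
have dgt : differentiable g t.
  rewrite -tE in sX *; rewrite tE in sX *.
  by apply: (differentiable_sact (p := p) e1 sigmaN_open g_sym sX); rewrite -st.
have dGX : differentiable G (emb s) by apply: differentiable_spectral => //; rewrite tE.
have := Hd (emb s); rewrite XsE embN => /(_ sd dGX).
have -> : 'd G (emb s) (emb (s - sigma Xb)) = emb ('d g s (s - sigma Xb)).
  exact: (diff_spectral_diag le_mn N_open GE Ubo Vbo NX).
have -> : G (emb s) = emb (g s) by exact: GE.
have -> : G Xb = emb (g (sigma Xb)) by exact: GE.
by rewrite -!embB embN.
Qed.

End DifferentiableSpectral.

Theorem theorem5p2 (R : realType) (k : scalar_kind) (m n : nat)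
  (le_mn : (m <= n)%N)
  (N : set (mat R k m n)) (N_neq0 : N !=set0) (N_open : open N)
  (g : rvec R m -> rvec R m)
  (sigmaN : set (rvec R m)) (sigmaN_open : open sigmaN)
  (sub_sigmaN : [set sigma X | X in N] `<=` sigmaN)
  (g_sym : absolutely_symmetric g sigmaN)
  (G : mat R k m n -> mat R k m n) (G_spec : spectral_operator g N G)
  (Xbar : mat R k m n) (N_Xbar : N Xbar)
  (Ubar : 'M[scalars R k]_m) (Vbar : 'M[scalars R k]_n)
  (svd_Xbar : svd_pair Xbar Ubar Vbar)
  (g_lip : locally_lipschitz_near g (sigma Xbar))
  (rho : R) (rho_gt0 : 0 < rho) (rho_le1 : rho <= 1) :
  G_semismooth G Xbar rho <-> G_semismooth g (sigma Xbar) rho.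
Proof.
split; first exact: (semismooth_spectral_conv le_mn N_open sigmaN_open sub_sigmaN g_sym
  G_spec N_Xbar svd_Xbar g_lip).
exact: (semismooth_spectral le_mn N_open sigmaN_open sub_sigmaN g_sym G_spec N_Xbar
  svd_Xbar rho_gt0 rho_le1).
Qed.
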